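(* Let $T>0$, $|\rho|<1$ and $0<\lambda<\infty$. Let $X(t)=Z(t)+J(t)$, $t\in[0,T]$, where $Z$ and $J$ are independent, $Z$ is a centered stationary Gaussian process with $C^1$ paths and covariance function $\Gamma(\tau)=\mathbb E Z(0)Z(\tau)$ satisfying $\Gamma(0)=1/2$, and $J$ is a PAR($\rho,\lambda$) process. Assume that $\Gamma(\tau)\ne\pm1/2$ for all $\tau>0$ (in the domain $[0,T]$ of $\Gamma$), and that the Geman condition holds: the integral $$\int_0^\eta\frac{\theta'(\tau)}{\tau^2}\,d\tau$$ converges for some $\eta>0$, where $\theta$ is defined by $\Gamma(\tau)=\frac12+\Gamma''(0)\frac{\tau^2}{2}+\theta(\tau)$. Let $M(T)=\sup\{X(s):0\le s\le T\}$. Then, as $u\to\infty$, $$\mathbb P(M(T)>u)=1-\Phi(u)+T\sqrt{\frac{-\Gamma''(0)}{2\pi}}\,\varphi(u)+o(\varphi(u)).$$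
   Context: Poisson-auto-regressive process PAR($\rho,\lambda$): let $(\epsilon_n)_{n\ge0}$ be i.i.d. centered Gaussian random variables with variance $1/2$, and set $A_0=\epsilon_0$ and $A_n=\rho A_{n-1}+\sqrt{1-\rho^2}\,\epsilon_n$ for $n\ge1$. Let $\nu=(\nu_t)_{t\ge0}$ be a (simple, homogeneous) Poisson process with intensity $\lambda$, independent of $(\epsilon_n)$. Then $J(t)=A_{\nu_t}$. $\varphi$ and $\Phi$ are the standard Gaussian density and distribution function; $f(u)=o(g(u))$ means $\lim_{u\to\infty}f(u)/g(u)=0$. *)

(* Defs.v *)
From HB Require Import structures.
From mathcomp Require Import all_boot all_order all_algebra.
From mathcomp Require Import all_classical all_reals all_analysis.

Set Implicit Arguments.
Unset Strict Implicit.
Unset Printing Implicit Defensive.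

Import Order.TTheory GRing.Theory Num.Theory.
Import numFieldNormedType.Exports.

Local Open Scope classical_set_scope.
Local Open Scope ring_scope.

Definition sigma_gen (I : Type) (d : measure_display) (Omega : measurableType d)
    (d' : measure_display) (E : measurableType d')
    (D : set I) (X : I -> Omega -> E) : set (set Omega) :=
  <<s \bigcup_(i in D) preimage_set_system setT (X i) measurable >>.

Definition indep_systems (d : measure_display) (Omega : measurableType d)
    (R : realType) (P : probability Omega R) (F G : set (set Omega)) : Prop :=
  forall A B, F A -> G B -> P (A `&` B) = (P A * P B)%E.

Definition mutually_indep (I : eqType) (d : measure_display)
    (Omega : measurableType d) (R : realType) (P : probability Omega R)
    (d' : measure_display) (E : measurableType d')
    (X : I -> Omega -> E) : Prop :=
  forall (s : seq I) (B : I -> set E),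
    uniq s -> (forall i, measurable (B i)) ->
    P (\bigcap_(i in [set` s]) (X i @^-1` B i)) =
    (\prod_(i <- s) P (X i @^-1` B i))%E.

(* A possibly degenerate Gaussian law; [normal_prob m 0] is not a Dirac mass
   in the library, hence the separate case. *)
Definition gaussian_law (d : measure_display) (Omega : measurableType d)
    (R : realType) (P : probability Omega R) (Y : Omega -> R) : Prop :=
  exists m s : R, forall B : set R, measurable B ->
    P (Y @^-1` B) = if s == 0 then \d_m B else normal_prob m s B.

Definition gaussian_process (d : measure_display) (Omega : measurableType d)
    (R : realType) (P : probability Omega R) (D : set R)
    (Z : R -> {RV P >-> R}) : Prop :=
  forall (n : nat) (t c : 'I_n -> R), (forall i, D (t i)) ->
    gaussian_law P (fun w => \sum_(i < n) c i * Z (t i) w).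

Definition centered_process (d : measure_display) (Omega : measurableType d)
    (R : realType) (P : probability Omega R) (D : set R)
    (Z : R -> {RV P >-> R}) : Prop :=
  forall t, D t -> ('E_P[Z t] = 0)%E.

Definition stationary_process (d : measure_display) (Omega : measurableType d)
    (R : realType) (P : probability Omega R) (D : set R)
    (Z : R -> {RV P >-> R}) : Prop :=
  forall (n : nat) (t : 'I_n -> R) (h : R),
    (forall i, D (t i)) -> (forall i, D (t i + h)) ->
    forall B : set (n.-tuple R), measurable B ->
      P [set w | B [tuple Z (t i + h) w | i < n]] =
      P [set w | B [tuple Z (t i) w | i < n]].

(* Derivatives are taken within [D], hence one-sided at the endpoints when [D]
   is a closed interval. *)
Definition C1_on (R : realType) (D : set R) (f : R -> R) : Prop :=
  exists2 g : R -> R, {within D, continuous g} &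
    forall t, D t ->
      (f s - f t) / (s - t) @[s --> within D t^'] --> g t.

(* Covariance function of a stationary process on [0, T], extended to [-T, T]
   by parity, so that the two-sided derivatives of the library apply at 0. *)
Definition cov_fun (d : measure_display) (Omega : measurableType d)
    (R : realType) (P : probability Omega R) (Z : R -> {RV P >-> R})
    (tau : R) : R :=
  fine ('E_P[fun w => (Z 0 w * Z `|tau| w)%R])%E.

Definition geman_rem (R : realType) (Gamma : R -> R) (tau : R) : R :=
  Gamma tau - 2^-1 - (Gamma^`()^`())%classic 0 * (tau ^+ 2 / 2).

(* Convergence of the integral at 0 is understood in the improper sense. *)
Definition geman_condition (R : realType) (T : R) (Gamma : R -> R) : Prop :=
  let f := fun tau : R => ((geman_rem Gamma)^`())%classic tau / tau ^+ 2 in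
  exists2 eta : R, 0 < eta <= T &
    (forall e, 0 < e < eta ->
       (@lebesgue_measure R).-integrable `]e, eta[ (EFin \o f)) /\
    cvg ((\int[@lebesgue_measure R]_(tau in `]e, eta[) f tau)
           @[e --> (0 : R)^'+]).

Definition poisson_process (d : measure_display) (Omega : measurableType d)
    (R : realType) (P : probability Omega R) (lambda : R)
    (nu : R -> {RV P >-> nat}) : Prop :=
  [/\ forall w, [/\ nu 0 w = 0%N,
        forall s t, 0 <= s -> s <= t -> (nu s w <= nu t w)%N,
        forall t, 0 <= t -> \forall s \near t^'+, nu s w = nu t w &
        forall t, 0 < t -> \forall s \near t^'-, (nu t w <= (nu s w).+1)%N],
      forall s t, 0 <= s -> s < t -> forall k : nat,
        P [set w | (nu t w - nu s w)%N = k] =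
        (poisson_pmf (lambda * (t - s)) k)%:E &
      forall t : nat -> R, 0 <= t 0%N -> {homo t : i j / (i <= j)%N >-> i <= j} ->
        mutually_indep P
          (fun (i : nat) w => (nu (t i.+1) w - nu (t i) w)%N)].

Fixpoint ar_chain (R : realType) (Omega : Type) (rho : R)
    (eps : nat -> Omega -> R) (n : nat) (w : Omega) : R :=
  if n is m.+1 then
    rho * ar_chain rho eps m w + Num.sqrt (1 - rho ^+ 2) * eps n w
  else eps 0%N w.

Definition PAR_process (d : measure_display) (Omega : measurableType d)
    (R : realType) (P : probability Omega R) (rho lambda : R)
    (J : R -> {RV P >-> R}) : Prop :=
  exists (eps : nat -> {RV P >-> R}) (nu : R -> {RV P >-> nat}),
  [/\ (forall n (B : set R), measurable B ->
         distribution P (eps n) B = normal_prob 0 (Num.sqrt 2^-1) B) /\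
      mutually_indep P (fun n => eps n : Omega -> R),
      poisson_process lambda nu,
      indep_systems P
        (sigma_gen setT (fun n => eps n : Omega -> R))
        (sigma_gen [set t : R | 0 <= t] (fun t => nu t : Omega -> nat)) &
      forall t w, 0 <= t ->
        J t w = ar_chain rho (fun n => eps n : Omega -> R) (nu t w) w].

Definition std_gauss_pdf (R : realType) (u : R) : R := normal_pdf 0 1 u.

Definition std_gauss_cdf (R : realType) (u : R) : R :=
  fine (normal_prob 0 1 `]-oo, u]).

(* Main.v *)
(** For a Gaussian variable everything is read off characteristic
functions: they determine the law, and a pair whose linear combinations all have
the right characteristic function is independent. Hence Z_t + J_t is standard
normal, and (Z_s + Z_t)/2 + J_s is independent of (Z_t - Z_s)/2, which gives the
probability of an upcrossing of u between s and t = s + delta up to the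
probability that J jumps, at most lambda delta P(N > u). Since
1/2 - Gamma(delta) ~ lambda_2 delta^2 / 2 with lambda_2 = -Gamma''(0), this
probability is about delta sqrt(lambda_2 / 2 pi) phi(u).

Upper bound: paths are right-continuous, so {M > u} is the increasing union of
the events that X exceeds u on a dyadic grid; a first exceedance on the grid is
at 0 or an upcrossing. For fixed u the jumps cost at most
T lambda P(N > u) = o(phi(u)).

Lower bound: Bonferroni on a grid of step delta ~ a/u, then u -> oo, then a -> 0.
The pair {X_0 > u}, {upcrossing on the k-th interval} is empty for k = 1,
negligible for fixed k, since a convex combination of the outer values minus the
middle value is then positive, and its probability is dominated by
C phi(u) / (k^2 u), since the half-sum of the outer values exceeds u.

The bound 1/2 - Gamma(tau) >= c tau^2 on [0, T] and the expansion of Gamma at 0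
follow from C^1 paths and Gamma <> 1/2. *)

Require Import Defs.
From HB Require Import structures.
From mathcomp Require Import all_boot all_order all_algebra.
From mathcomp Require Import all_classical all_reals all_analysis.
From mathcomp Require Import measurable_realfun zify ring lra.

Set Implicit Arguments.
Unset Strict Implicit.
Unset Printing Implicit Defensive.

Import Order.TTheory GRing.Theory Num.Theory.
Import numFieldNormedType.Exports.

Local Open Scope classical_set_scope.
Local Open Scope ring_scope.

(** * Integrals over probability spaces *)

(** Joint laws of X at several times are mixtures over the jumps of J, hence not Gaussian. What is
    exactly Gaussian is a linear combination of values of Z plus a multiple of one value of J, so
    the estimates mostly freeze J at one time and then pay for the event that J moves. This payment
    must carry the factor P(N > u), not only lambda delta: level and jump have to be decoupled. That
    works because all variables of the autoregressive chain have the same law, so each J_r is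
    independent of the Poisson process.

    The step a/u of the lower bound is forced. There are about T u/a intervals, so the double sum is
    negligible against phi(u) only if the pair probabilities, in units of phi(u)/u and summed over
    the distance k, tend to 0. This is dominated convergence in k, with C/k^2 as dominating
    sequence. C depends on a, which is fixed before the cut-off in k. Small a serves the single
    intervals: with u delta of order a, the relative error in the lower bound for one upcrossing is
    O(a). *)

Section BoundedIntegrals.
Context (d : measure_display) (T : measurableType d) (R : realType)
  (P : probability T R).

Lemma bounded_integrable (f : T -> R) (C : R) : measurable_fun setT f ->
  (forall x, `|f x| <= C) -> P.-integrable setT (EFin \o f).
Proof.
move=> mf fC; apply: measurable_bounded_integrable => //.
  by rewrite (le_lt_trans (probability_le1 _ _))// ltry.
exists C; split; first exact: num_real.
by move=> M CM x _ /=; rewrite (le_trans (fC x))// ltW.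
Qed.

Lemma Rintegral_prob_cst (c : R) : \int[P]__ c = c.
Proof. by rewrite /Rintegral integral_cst//= probability_setT mule1. Qed.

Lemma Rintegral_cvg (f_ : (T -> R)^nat) (f g : T -> R) :
  (forall n, measurable_fun setT (f_ n)) ->
  (forall x, f_ n x @[n --> \oo] --> f x) ->
  P.-integrable setT (EFin \o g) ->
  (forall n x, `|f_ n x| <= g x) ->
  \int[P]_x f_ n x @[n --> \oo] --> \int[P]_x f x.
Proof.
move=> mf ff ig fg.
have fin : (\int[P]_x (f x)%:E)%E \is a fin_num.
  apply: integrable_fin_num => //; apply: (le_integrable _ _ _ ig) => //=.
    apply/measurable_EFinP; apply: (measurable_fun_cvg mf) => x _; exact: ff.
  move=> x _; have g0 : 0 <= g x by exact: (le_trans _ (fg 0%N x)).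
  rewrite lee_fin [leRHS]ger0_norm//.
  apply: (cvgr_to_le (cvg_norm (ff x))).
  exact: nearW.
apply: fine_cvg; rewrite fineK//.
apply: (@dominated_cvg _ _ _ P setT measurableT (fun n x => (f_ n x)%:E) (EFin \o f) (EFin \o g)) => //=.
- by move=> n; apply/measurable_EFinP.
- by move=> x _; apply: cvg_EFin; [exact: nearW|exact: ff].
- by move=> n x _; rewrite lee_fin.
Qed.

Lemma Rintegral_cvg_bounded (f_ : (T -> R)^nat) (f : T -> R) (C : R) :
  (forall n, measurable_fun setT (f_ n)) ->
  (forall x, f_ n x @[n --> \oo] --> f x) ->
  (forall n x, `|f_ n x| <= C) ->
  \int[P]_x f_ n x @[n --> \oo] --> \int[P]_x f x.
Proof.
move=> mf ff fg; apply: (@Rintegral_cvg _ _ (cst C)) => //.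
by apply: (@bounded_integrable _ `|C|).
Qed.

End BoundedIntegrals.

Lemma integral_mul_indic (d : measure_display) (T : measurableType d) (R : realType)
  (mu : {measure set T -> \bar R}) (D : set T) (f : T -> R) :
  (\int[mu]_x (f x * \1_D x)%:E = \int[mu]_(x in D) (f x)%:E)%E.
Proof.
rewrite [RHS]integral_mkcond; apply: eq_integral => x _.
by rewrite patchE indicE; case: ifP => _; rewrite ?mulr1// mulr0.
Qed.

Lemma Rintegral_Fubini (d1 d2 : measure_display) (T1 : measurableType d1)
  (T2 : measurableType d2) (R : realType)
  (m1 : {sigma_finite_measure set T1 -> \bar R})
  (m2 : {sigma_finite_measure set T2 -> \bar R}) (f : T1 * T2 -> R) :
  (m1 \x m2)%E.-integrable setT (EFin \o f) ->
  (forall x, m2.-integrable setT (fun y => (f (x, y))%:E)) ->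
  (forall y, m1.-integrable setT (fun x => (f (x, y))%:E)) ->
  \int[m1]_x \int[m2]_y f (x, y) = \int[m2]_y \int[m1]_x f (x, y).
Proof.
move=> imf i1 i2; have := Fubini imf.
rewrite /Rintegral => FF; congr fine.
transitivity (\int[m1]_x \int[m2]_y (EFin \o f) (x, y))%E.
  by apply: eq_integral => x _; rewrite fineK//; exact: integrable_fin_num.
by rewrite FF; apply: eq_integral => y _; rewrite fineK//; exact: integrable_fin_num.
Qed.

Section BoundedFubini.
Context (d1 d2 : measure_display) (T1 : measurableType d1) (T2 : measurableType d2)
  (R : realType) (m1 : probability T1 R) (m2 : probability T2 R).

Lemma bounded_Fubini (f : T1 * T2 -> R) (C : R) : measurable_fun setT f ->
  (forall x, `|f x| <= C) ->
  \int[m1]_x \int[m2]_y f (x, y) = \int[m2]_y \int[m1]_x f (x, y).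
Proof.
move=> mf fC; apply: Rintegral_Fubini.
- exact: (@bounded_integrable _ _ _ (m1 \x m2)%E f C).
- move=> x; apply: (@bounded_integrable _ _ _ m2 (fun y => f (x, y)) C) => //.
  exact: measurableT_comp.
- move=> y; apply: (@bounded_integrable _ _ _ m1 (fun x => f (x, y)) C) => //.
  exact: measurableT_comp.
Qed.

End BoundedFubini.

(** * Normal laws *)

Section IntegralOnLine.
Context {R : realType}.
Notation mu := (@lebesgue_measure R).

Lemma integral_normal_prob (m s : R) (U : set R) (f : R -> \bar R) :
  measurable U -> (normal_prob m s).-integrable U f ->
  (\int[normal_prob m s]_(x in U) f x =
   \int[mu]_(x in U) (f x * (normal_pdf m s x)%:E))%E.
Proof.
move=> mU fi; have mf := measurable_int _ fi.
rewrite -(Radon_Nikodym_change_of_variables (normal_prob_dominates m s))//=.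
apply: ae_eq_integral => //.
- apply: emeasurable_funM => //; apply: (measurable_int mu).
  apply: (integrableS _ _ (@subsetT _ _)) => //=.
  by apply: Radon_Nikodym_integrable; exact: normal_prob_dominates.
- apply: emeasurable_funM => //=; apply/measurableT_comp => //=.
  by apply/measurable_funTS; exact: measurable_normal_pdf.
- apply: ae_eqe_mul2l => /=.
  rewrite Radon_NikodymE//=; first exact: normal_prob_dominates.
  move=> nmu; case: cid => /= h [h1 h2 h3].
  apply: integral_ae_eq => //=.
  + exact: integrableS h2.
  + by apply/measurable_funTS/measurableT_comp => //; exact: measurable_normal_pdf.
  + by move=> E E01 mE; rewrite -h3.
Qed.

(** For nonnegative functions no integrability is asked, so this form can itself establish
    integrability under the normal law. *)
Lemma ge0_integral_normal_prob (m s : R) (U : set R) (f : R -> \bar R) :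
  measurable U -> measurable_fun U f -> (forall x, 0 <= f x)%E ->
  (\int[normal_prob m s]_(x in U) f x =
   \int[mu]_(x in U) (f x * (normal_pdf m s x)%:E))%E.
Proof.
move=> mU mf f0.
have nm := @normal_prob_dominates R m s.
rewrite -(Radon_Nikodym_SigmaFinite.change_of_variables nm)//=.
apply: ae_eq_integral => //.
- apply: emeasurable_funM => //; apply: (measurable_int mu).
  apply: (integrableS _ _ (@subsetT _ _)) => //=.
  exact: Radon_Nikodym_SigmaFinite.f_integrable.
- apply: emeasurable_funM => //=; apply/measurableT_comp => //=.
  by apply/measurable_funTS; exact: measurable_normal_pdf.
- apply: ae_eqe_mul2l => /=; apply: integral_ae_eq => //=.
  + apply: (integrableS _ _ (@subsetT _ _)) => //=.
    exact: Radon_Nikodym_SigmaFinite.f_integrable.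
  + by apply/measurable_funTS/measurableT_comp => //; exact: measurable_normal_pdf.
  + by move=> E E01 mE; rewrite -Radon_Nikodym_SigmaFinite.f_integral.
Qed.

(* No sign condition on [f], unlike in [ge0_continuous_FTC2y]. *)
Lemma integral_derive_line (F f : R -> R) :
  (forall x : R, is_derive x (1 : R) F (f x)) -> continuous f ->
  mu.-integrable setT (EFin \o f) ->
  F x @[x --> +oo] --> (0 : R) -> F x @[x --> -oo] --> (0 : R) ->
  \int[mu]_x f x = 0.
Proof.
move=> dF cf fi Fy FNy.
have cF : continuous F.
  by move=> x; apply: differentiable_continuous; apply/derivable1_diffP; have [] := dF x.
have h n : \int[mu]_x (f \_ `[- n.+1%:R, n.+1%:R]) x = F n.+1%:R - F (- n.+1%:R).
  rewrite -Rintegral_mkcond /Rintegral.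
  have n0 : (- n.+1%:R < n.+1%:R :> R) by rewrite gtrN.
  rewrite (@continuous_FTC2 _ f F)//.
  - exact: continuous_subspaceT.
  - split.
    + by move=> x _; have [] := dF x.
    + exact/cvg_at_right_filter/cF.
    + exact/cvg_at_left_filter/cF.
  - by move=> x _; rewrite derive1E; have [_ ->] := dF x.
have c1 : \int[mu]_x (f \_ `[- n.+1%:R, n.+1%:R]) x @[n --> \oo] --> \int[mu]_x f x.
  apply: fine_cvg; rewrite fineK; last exact: integrable_fin_num.
  have fx x : (f \_ `[- n.+1%:R, n.+1%:R]) x @[n --> \oo] --> f x.
    apply: cvg_near_cst; near=> n; rewrite patchE mem_set//= in_itv/= -ler_norml.
    near: n; apply: filterS (nbhs_infty_ger `|x|) => n xn.
    by rewrite (le_trans xn)// ler_nat.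
  apply: (@dominated_cvg _ _ _ mu setT measurableT
    (fun n x => ((f \_ `[- n.+1%:R, n.+1%:R]) x)%:E) (EFin \o f)
    (fun x => `|f x|%:E)) => //=.
  - move=> n; apply/measurable_EFinP; apply/(measurable_restrictT _ _).1 => //.
    by apply: measurable_funTS; exact: continuous_measurable_fun.
  - by move=> x _; apply: cvg_EFin; [exact: nearW|exact: fx].
  - by have := integrable_norm fi.
  - move=> n x _; rewrite lee_fin patchE; case: ifP => // _; by rewrite normr0.
have ny : n.+1%:R @[n --> \oo] --> (+oo : set_system R).
  by rewrite (cvg_shiftS (fun n => n%:R : R)); exact: cvgr_idn.
have c2 : F n.+1%:R - F (- n.+1%:R) @[n --> \oo] --> 0.
  rewrite -[X in _ --> X]subr0; apply: cvgB.
    exact: (cvg_comp _ _ ny Fy).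
  by apply: (cvg_comp _ _ _ FNy); apply/cvgNrNy.
by move: c1; rewrite (funext h) => c1; exact: (cvg_unique _ c1 c2).
Unshelve. all: by end_near. Qed.

End IntegralOnLine.

(** * Stein's identity, moments and characteristic function of the normal law *)

Section NormalMoments.
Context {R : realType}.
Notation mu := (@lebesgue_measure R).
Variables (m s : R).
Hypothesis s0 : s != 0.
Local Notation p := (normal_pdf m s).

Lemma normal_pdf_derive (x : R) :
  is_derive x (1 : R) p (- ((x - m) / s ^+ 2) * p x).
Proof.
rewrite normal_pdfE//.
rewrite /normal_fun.
have -> : (fun x => normal_peak s * expR (- (x - m) ^+ 2 / (s ^+ 2 *+ 2))) =
  normal_peak s \*: (expR \o (fun x : R => - (x - m) ^+ 2 / (s ^+ 2 *+ 2))).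
  by apply/funext.
apply: is_derive_eq.
rewrite /GRing.scale/= /normal_fun.
have s2 : s ^+ 2 != 0 by rewrite expf_neq0.
by field.
Qed.

(* [y^2 <= 4 e^(y^2/4)] trades a quadratic factor for a doubled variance. *)
Lemma normal_pdf_sqr_ub (x : R) :
  (1 + (x - m) ^+ 2) * p x <=
  (1 + 4 * s ^+ 2) * Num.sqrt 2 * normal_pdf m (Num.sqrt 2 * s) x.
Proof.
have s2 : 0 < s ^+ 2 by rewrite exprn_even_gt0.
have r2 : 0 < Num.sqrt 2 :> R by rewrite sqrtr_gt0.
have t0 : Num.sqrt 2 * s != 0 by rewrite mulf_neq0// gt_eqF.
rewrite !normal_pdfE//.
have pk : normal_peak s = Num.sqrt 2 * normal_peak (Num.sqrt 2 * s).
  rewrite /normal_peak exprMn sqr_sqrtr//.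
  have -> : 2 * s ^+ 2 * pi *+ 2 = 2 * (s ^+ 2 * pi *+ 2) by ring.
  by rewrite sqrtrM// invfM mulrA divff ?gt_eqF// mul1r.
rewrite pk /normal_fun exprMn sqr_sqrtr//.
set k := normal_peak _.
have k0 : 0 <= k by exact: normal_peak_ge0.
set y := x - m.
have e : expR (- y ^+ 2 / (s ^+ 2 *+ 2)) =
   expR (- y ^+ 2 / (2 * s ^+ 2 *+ 2)) * expR (- y ^+ 2 / (2 * s ^+ 2 *+ 2)).
  rewrite -expRD; congr expR.
  by field.
have y2 : y ^+ 2 * expR (- y ^+ 2 / (2 * s ^+ 2 *+ 2)) <= 4 * s ^+ 2.
  have := expR_ge1Dx (y ^+ 2 / (2 * s ^+ 2 *+ 2)).
  rewrite mulNr expRN ler_pdivrMr ?expR_gt0// => h.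
  apply: (@le_trans _ _ (4 * s ^+ 2 * (y ^+ 2 / (2 * s ^+ 2 *+ 2)))).
    rewrite le_eqVlt; apply/orP; left; apply/eqP; by field.
  rewrite ler_wpM2l//; first by lra.
  by apply: le_trans h; lra.
have e1 : expR (- y ^+ 2 / (2 * s ^+ 2 *+ 2)) <= 1.
  rewrite -[leRHS]expR0 ler_expR mulNr oppr_le0 divr_ge0 ?sqr_ge0//; lra.
rewrite e; set E := expR _ in y2 e1 *.
have E0 : 0 <= E by exact: expR_ge0.
have h : (1 + y ^+ 2) * E <= 1 + 4 * s ^+ 2 by rewrite mulrDl mul1r lerD.
rewrite [leLHS](_ : _ = ((1 + y ^+ 2) * E) * (Num.sqrt 2 * (k * E))); last by ring.
rewrite [leRHS](_ : _ = (1 + 4 * s ^+ 2) * (Num.sqrt 2 * (k * E))); last by ring.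
by rewrite ler_wpM2r// !mulr_ge0// ltW.
Qed.

Lemma integrable_normal_pdf_quadratic (K : R) (f : R -> R) :
  0 <= K -> measurable_fun setT f ->
  (forall x, `|f x| <= K * (1 + (x - m) ^+ 2)) ->
  mu.-integrable setT (fun x => (f x * p x)%:E).
Proof.
move=> K0 mf fx.
set C := (1 + 4 * s ^+ 2) * Num.sqrt 2.
apply: (@le_integrable _ _ _ mu setT _ _
  (fun x => (K * (C * normal_pdf m (Num.sqrt 2 * s) x))%:E)) => //.
- by apply/measurable_EFinP/measurable_funM => //; exact: measurable_normal_pdf.
- move=> x _ /=; rewrite lee_fin normrM (ger0_norm (normal_pdf_ge0 _ _ _)).
  apply: le_trans (ler_norm _).
  apply: (@le_trans _ _ (K * ((1 + (x - m) ^+ 2) * p x))).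
    by rewrite mulrA ler_wpM2r// normal_pdf_ge0.
  by rewrite ler_wpM2l// normal_pdf_sqr_ub.
- under eq_fun do rewrite mulrA EFinM.
  by apply: integrableZl => //; exact: integrable_normal_pdf.
Qed.

Lemma integrable_normal_quadratic (K : R) (f : R -> R) :
  0 <= K -> measurable_fun setT f ->
  (forall x, `|f x| <= K * (1 + (x - m) ^+ 2)) ->
  (normal_prob m s).-integrable setT (EFin \o f).
Proof.
move=> K0 mf fx; apply/integrableP; split; first exact/measurable_EFinP.
rewrite ge0_integral_normal_prob//; last first.
  by apply/measurable_EFinP; exact: measurableT_comp.
have /integrableP[_] := integrable_normal_pdf_quadratic K0 mf fx.
congr (_ < _)%E; apply: eq_integral => x _ /=.
by rewrite normrM (ger0_norm (normal_pdf_ge0 _ _ _)).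
Qed.

Lemma Rintegral_normal_quadratic (K : R) (f : R -> R) :
  0 <= K -> measurable_fun setT f ->
  (forall x, `|f x| <= K * (1 + (x - m) ^+ 2)) ->
  \int[normal_prob m s]_x f x = \int[mu]_x (f x * p x).
Proof.
move=> K0 mf fx; rewrite /Rintegral integral_normal_prob//.
exact: (integrable_normal_quadratic K0).
Qed.

(** Boundary terms of the integration by parts below. Linear growth leaves one factor 1 + |x - m| to
    spare in the quadratic bound [normal_pdf_sqr_ub], so the product is at most B / (1 + |x -
    m|). *)
Lemma normal_pdf_linear_cvg0 (f : R -> R) :
  (forall x, `|f x| <= 1 + `|x - m|) ->
  (f x * p x @[x --> +oo] --> (0 : R)) /\ (f x * p x @[x --> -oo] --> (0 : R)).
Proof.
move=> fx.
have t0 : Num.sqrt 2 * s != 0 by rewrite mulf_neq0// gt_eqF// sqrtr_gt0.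
set B := 2 * ((1 + 4 * s ^+ 2) * Num.sqrt 2 * normal_peak (Num.sqrt 2 * s)).
have B0 : 0 <= B.
  rewrite !mulr_ge0// ?normal_peak_ge0// addr_ge0// mulr_ge0//; exact: sqr_ge0.
have bd x : `|f x * p x| <= B / (1 + `|x - m|).
  have y0 := normr_ge0 (x - m).
  rewrite ler_pdivlMr; last by lra.
  rewrite normrM (ger0_norm (normal_pdf_ge0 _ _ _)).
  apply: (@le_trans _ _ (2 * ((1 + (x - m) ^+ 2) * p x))).
    rewrite mulrAC mulrA ler_wpM2r ?normal_pdf_ge0//.
    apply: (@le_trans _ _ ((1 + `|x - m|) * (1 + `|x - m|))).
      by rewrite ler_wpM2r// addr_ge0.
    rewrite -real_normK ?num_real//; set y := `|_| in y0 *.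
    by have := sqr_ge0 (y - 1); nra.
  rewrite ler_wpM2l//; apply: (le_trans (normal_pdf_sqr_ub x)).
  rewrite ler_wpM2l// ?normal_pdf_ub//.
  by rewrite mulr_ge0// addr_ge0// mulr_ge0//; exact: sqr_ge0.
have key (F : set_system R) (FF : Filter F) :
  (forall A : R, \forall x \near F, A <= `|x|) -> f x * p x @[x --> F] --> (0 : R).
  move=> FA; apply/cvgr0Pnorm_le => e e0.
  near=> x; apply: (le_trans (bd x)).
  have y0 := normr_ge0 (x - m).
  rewrite ler_pdivrMr; last by lra.
  have : B / e + `|m| <= `|x| by near: x; exact: FA.
  have : `|x| <= `|x - m| + `|m| by rewrite -[X in `|X| <= _](subrK m) ler_normD.
  move=> h1 h2.
  have : B / e <= `|x - m| by lra.
  by rewrite ler_pdivrMr// => h3; nra.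
split; apply: key => A.
- near=> x; apply: le_trans (ler_norm _); near: x.
  by apply: nbhs_pinfty_ge; exact: num_real.
- near=> x; rewrite -normrN; apply: le_trans (ler_norm _); rewrite lerNr; near: x.
  by apply: nbhs_ninfty_le; exact: num_real.
Unshelve. all: by end_near. Qed.

(** Integration by parts: s^2 G p has derivative s^2 g p - (x - m) G p. Taking G = 1, x - m and a
    sine gives the mean, the variance and the differential equation of the characteristic
    function. *)
Lemma normal_stein (G g : R -> R) :
  (forall x : R, is_derive x (1 : R) G (g x)) -> continuous g ->
  (forall x, `|G x| <= 1 + `|x - m|) ->
  mu.-integrable setT (fun x => (g x * p x)%:E) ->
  \int[mu]_x ((x - m) * G x * p x) = s ^+ 2 * \int[mu]_x (g x * p x).
Proof.
move=> dG cg Gx ig.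
have s2 : s ^+ 2 != 0 by rewrite expf_neq0.
have cG : continuous G.
  by move=> x; apply: differentiable_continuous; apply/derivable1_diffP; have [] := dG x.
have cB : continuous (fun x : R => x - m).
  by move=> x; apply: cvgB => //; exact: cvg_cst.
have iG : mu.-integrable setT (fun x => ((x - m) * G x * p x)%:E).
  apply: (@integrable_normal_pdf_quadratic 2) => //.
    apply: continuous_measurable_fun => x; apply: cvgM; [exact: cB|exact: cG].
  move=> x; rewrite normrM; apply: (@le_trans _ _ (`|x - m| * (1 + `|x - m|))).
    by rewrite ler_wpM2l.
  rewrite -(real_normK (num_real (x - m))); set y := `|_|; have := normr_ge0 (x - m).
  by rewrite -/y => y0; have := sqr_ge0 (y - 1); nra.
have [Fy FNy] := normal_pdf_linear_cvg0 Gx.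
have h : \int[mu]_x (s ^+ 2 * (g x * p x) - (x - m) * G x * p x) = 0.
  apply: (integral_derive_line (F := fun x => s ^+ 2 * (G x * p x))).
  - move=> x; have dp := normal_pdf_derive x; have dGx := dG x.
    apply: is_derive_eq; rewrite /GRing.scale/=; by field.
  - move=> x; apply: cvgB; apply: cvgM.
    + exact: cvg_cst.
    + by apply: cvgM; [exact: cg|exact: continuous_normal_pdf].
    + by apply: cvgM; [exact: cB|exact: cG].
    + exact: continuous_normal_pdf.
  - rewrite (_ : EFin \o _ = (fun x => (s ^+ 2)%:E * (g x * p x)%:E) \- (fun x => ((x - m) * G x * p x)%:E))%E //.
    apply: integrableB => //; exact: integrableZl.
  - by rewrite -[X in _ --> X](mulr0 (s ^+ 2)); apply: cvgM => //; exact: cvg_cst.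
  - by rewrite -[X in _ --> X](mulr0 (s ^+ 2)); apply: cvgM => //; exact: cvg_cst.
move: h; rewrite RintegralB//; last first.
  rewrite (_ : EFin \o _ = (fun x => (s ^+ 2)%:E * (g x * p x)%:E))%E //.
  exact: integrableZl.
by rewrite RintegralZl// => /eqP; rewrite subr_eq0 => /eqP.
Qed.

Lemma normal_mean : \int[normal_prob m s]_x x = m.
Proof.
have ab x : `|x - m| <= 1 * (1 + (x - m) ^+ 2).
  rewrite mul1r -real_normK ?num_real//; set y := `|_|; have := normr_ge0 (x - m).
  by rewrite -/y => y0; nra.
have mB : measurable_fun setT (fun x : R => x - m) by exact: measurable_funB.
have iB := integrable_normal_quadratic ler01 mB ab.
have h : \int[normal_prob m s]_x (x - m) = 0.
  rewrite (Rintegral_normal_quadratic ler01 mB ab).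
  have d1 (x : R) : is_derive x (1 : R) (fun=> 1 : R) 0 by exact: is_derive_cst.
  have b1 x : `|1 : R| <= 1 + `|x - m| by rewrite normr1 lerDl.
  have i0 : mu.-integrable setT (fun x => (0 * p x)%:E).
    by under eq_fun do rewrite mul0r; exact: integrable0.
  have st := normal_stein d1 (fun x => @cst_continuous _ _ (0 : R) x) b1 i0.
  transitivity (\int[mu]_x ((x - m) * 1 * p x)).
    by apply: eq_Rintegral => x _; rewrite mulr1.
  rewrite st; under eq_Rintegral do rewrite mul0r.
  by rewrite Rintegral_cst// mul0r mulr0.
rewrite (_ : (fun x => x) = (fun x : R => (x - m) + m)); last first.
  by apply/funext => x; rewrite subrK.
rewrite RintegralD//= ?h ?add0r; last exact: finite_measure_integrable_cst.
exact: Rintegral_prob_cst.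
Qed.

Lemma normal_variance : \int[normal_prob m s]_x (x - m) ^+ 2 = s ^+ 2.
Proof.
have ab x : `|(x - m) ^+ 2| <= 1 * (1 + (x - m) ^+ 2).
  by rewrite mul1r ger0_norm ?sqr_ge0// lerDr.
have mB : measurable_fun setT (fun x : R => (x - m) ^+ 2).
  by apply: measurable_funX; exact: measurable_funB.
rewrite (Rintegral_normal_quadratic ler01 mB ab).
have d1 (x : R) : is_derive x (1 : R) (fun x => x - m) 1.
  by apply: is_derive_eq; rewrite subr0.
have b1 x : `|x - m| <= 1 + `|x - m| by rewrite lerDr.
have i1 : mu.-integrable setT (fun x => (1 * p x)%:E).
  by under eq_fun do rewrite mul1r; exact: integrable_normal_pdf.
have st := normal_stein d1 (fun x => @cst_continuous _ _ (1 : R) x) b1 i1.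
transitivity (\int[mu]_x ((x - m) * (x - m) * p x)).
  by apply: eq_Rintegral => x _; rewrite expr2.
rewrite st; under eq_Rintegral do rewrite mul1r.
by rewrite /Rintegral integral_normal_pdf mulr1.
Qed.

(** Differentiation under the integral sign, dominated by |x - m| p(x) uniformly in the parameter,
    and [normal_stein] with a sine give I' = - b s^2 I, so that I(b) exp(b^2 s^2 / 2) is
    constant. *)
Lemma normal_cf_centered (a c : R) :
  \int[normal_prob m s]_x cos (a * (x - m) + c) = cos c * expR (- (a ^+ 2 * s ^+ 2) / 2).
Proof.
pose g (a x : R) := cos (a * (x - m) + c) * p x.
have cl (b : R) : continuous (fun x : R => b * (x - m) + c).
  move=> x; apply: cvgD; last exact: cvg_cst.
  apply: cvgM; first exact: cvg_cst.
  by apply: cvgB => //; exact: cvg_cst.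
have cc b : continuous (fun x : R => cos (b * (x - m) + c)).
  by move=> x; apply: continuous_comp; [exact: cl|exact: continuous_cos].
have mc b := continuous_measurable_fun (cc b).
have cb (b x : R) : `|cos (b * (x - m) + c)| <= 1 * (1 + (x - m) ^+ 2).
  by rewrite mul1r (le_trans (cos_max _))// lerDl sqr_ge0.
rewrite (Rintegral_normal_quadratic ler01 (mc a) (cb a)).
have ig b : mu.-integrable setT (EFin \o g b).
  exact: (integrable_normal_pdf_quadratic ler01 (mc b) (cb b)).
have dg (b x : R) : is_derive b (1 : R) (g ^~ x) (- (x - m) * sin (b * (x - m) + c) * p x).
  rewrite /g; apply: is_derive_eq; rewrite /GRing.scale/=; by ring.
have abm x : `|x - m| <= 1 * (1 + (x - m) ^+ 2).
  rewrite mul1r -real_normK ?num_real//; set y := `|_|; have := normr_ge0 (x - m).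
  by rewrite -/y => y0; nra.
have mB : measurable_fun setT (fun x : R => `|x - m|).
  by apply: measurableT_comp => //; exact: measurable_funB.
pose I b := \int[mu]_x g b x.
have dI (b : R) : is_derive b (1 : R) I (- (b * s ^+ 2) * I b).
  have bI : `]b - 1, b + 1[%classic b by rewrite /= in_itv/=; apply/andP; split; lra.
  have hint : forall x : R, `]b - 1, b + 1[%classic x -> mu.-integrable setT (EFin \o g x) by [].
  have hder : forall x y : R, `]b - 1, b + 1[%classic x -> setT y -> derivable (g ^~ y) x 1.
    by move=> x y _ _; have [] := dg x y.
  have G0 y : 0 <= `|y - m| * p y by rewrite mulr_ge0// normal_pdf_ge0.
  have iG : mu.-integrable setT (EFin \o (fun y => `|y - m| * p y)).
    by apply: (integrable_normal_pdf_quadratic ler01 mB) => x; rewrite normr_id.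
  have Gub : forall x y : R, `]b - 1, b + 1[%classic x -> setT y -> `|partial1of2 g x y| <= `|y - m| * p y.
    move=> x y _ _; rewrite partial1of2E; have [_ ->] := dg x y.
    rewrite normrM (ger0_norm (normal_pdf_ge0 _ _ _)) ler_wpM2r ?normal_pdf_ge0//.
    by rewrite normrM normrN ler_piMr// sin_max.
  apply: DeriveDef.
    exact: (derivable_under_integral measurableT bI hint hder G0 iG Gub).
  rewrite -derive1E (differentiation_under_integral measurableT bI hint hder G0 iG Gub).
  transitivity (\int[mu]_x (- ((x - m) * sin (b * (x - m) + c) * p x))).
    apply: eq_Rintegral => x _; rewrite partial1of2E; have [_ ->] := dg b x; by ring.
  have ds (x : R) : is_derive x (1 : R) (fun x => sin (b * (x - m) + c)) (b * cos (b * (x - m) + c)).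
    by apply: is_derive_eq; rewrite /GRing.scale/=; ring.
  have cs : continuous (fun x : R => b * cos (b * (x - m) + c)).
    by move=> x; apply: cvgM; [exact: cvg_cst|exact: cc].
  have bs x : `|sin (b * (x - m) + c)| <= 1 + `|x - m|.
    by rewrite (le_trans (sin_max _))// lerDl.
  have ibg : mu.-integrable setT (fun x => (b * cos (b * (x - m) + c) * p x)%:E).
    under eq_fun do rewrite -mulrA EFinM.
    by apply: integrableZl => //; exact: ig.
  have st := normal_stein ds cs bs ibg.
  have ist : mu.-integrable setT (EFin \o (fun x => (x - m) * sin (b * (x - m) + c) * p x)).
    have msn : measurable_fun setT (fun x : R => (x - m) * sin (b * (x - m) + c)).
      apply: measurable_funM; first exact: measurable_funB.
      apply: continuous_measurable_fun => x.
      by apply: continuous_comp; [exact: cl|exact: continuous_sin].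
    apply: (integrable_normal_pdf_quadratic ler01 msn) => x.
    by rewrite (le_trans _ (abm x))// normrM ler_piMr// sin_max.
  under eq_Rintegral do rewrite -mulN1r.
  rewrite RintegralZl// st; under eq_Rintegral do rewrite -mulrA.
  rewrite RintegralZl//; last exact: ig.
  by rewrite /I /g; ring.
pose H b := I b * expR (b ^+ 2 * s ^+ 2 / 2).
have dH (b : R) : is_derive b (1 : R) H 0.
  have dIb := dI b.
  rewrite /H; apply: is_derive_eq; rewrite /GRing.scale/=; by field.
have I0 : I 0 = cos c.
  rewrite /I /g.
  under eq_Rintegral do rewrite mul0r add0r.
  rewrite RintegralZl//; last exact: integrable_normal_pdf.
  by rewrite /Rintegral integral_normal_pdf mulr1.
have := is_derive_0_is_cst a 0 dH.
rewrite /H I0 expr0n/= mul0r mul0r expR0 mulr1 => <-.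
by rewrite -[LHS]/(I a) -[RHS]mulrA -expRD -mulrDl addrN mul0r expR0 mulr1.
Qed.

Lemma normal_cf (a c : R) :
  \int[normal_prob m s]_x cos (a * x + c) = cos (a * m + c) * expR (- (a ^+ 2 * s ^+ 2) / 2).
Proof.
rewrite -normal_cf_centered; congr (Rintegral _ _ _); apply/funext => x; congr cos; ring.
Qed.

End NormalMoments.

(** * Characteristic functions *)

Section NormalCdf.
Context {R : realType}.
Notation mu := (@lebesgue_measure R).

Definition Ncdf (y : R) : R := fine (normal_prob 0 1 `]-oo, y]).

Lemma Ncdf_ge0_le1 y : 0 <= Ncdf y <= 1.
Proof.
rewrite /Ncdf; apply/andP; split; first exact: fine_ge0.
have := @probability_le1 _ _ _ (normal_prob 0 1 : probability _ R) `]-oo, y] (measurable_itv _).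
by move=> h; rewrite -lee_fin fineK// fin_num_measure.
Qed.

Lemma Ncdf_nd : {homo Ncdf : x y / x <= y}.
Proof.
move=> x y xy; rewrite /Ncdf fine_le ?fin_num_measure//.
by rewrite le_measure ?inE//; apply: subset_itvl; rewrite bnd_simp.
Qed.

(** Under [normal_prob 0 1] this random variable has distribution function [Ncdf], so the general
    limits of distribution functions apply to [Ncdf]. *)
Let idR : measurableTypeR R -> R := idfun.

#[local] HB.instance Definition _ :=
  @isMeasurableFun.Build _ _ _ _ idR (@measurable_id _ _ setT).

Lemma Ncdf_cvgy : Ncdf y @[y --> +oo] --> (1 : R).
Proof.
have := @cvg_cdfy1 _ _ R (normal_prob 0 1 : probability _ R) (idR : {RV _ >-> R}).
by move/fine_cvg.
Qed.

Lemma Ncdf_cvgNy : Ncdf y @[y --> -oo] --> (0 : R).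
Proof.
have := @cvg_cdfNy0 _ _ R (normal_prob 0 1 : probability _ R) (idR : {RV _ >-> R}).
by move/fine_cvg.
Qed.

(** After the substitution, x enters only through a Gaussian density, to which [std_normal_pdf_cf]
    applies. *)
Lemma Ncdf_subst (k x b : R) : 0 < k ->
  (Ncdf (k * (b - x)))%:E =
  (\int[mu]_(q in `]-oo, b]) (normal_pdf 0 1 (k * (q - x)) * k)%:E)%E.
Proof.
move=> k0.
have dF (q : R) : is_derive q (1 : R) (fun q => k * (q - x)) k.
  by apply: is_derive_eq; rewrite /GRing.scale/=; ring.
have F' : (fun q => k * (q - x))^`()%classic = cst k.
  by apply/funext => q; rewrite derive1E; have [_ ->] := dF q.
have cF : continuous (fun q : R => k * (q - x)).
  move=> q; apply: differentiable_continuous; apply/derivable1_diffP; by have [] := dF q.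
rewrite /Ncdf fineK ?fin_num_measure// {1}/normal_prob.
rewrite (@increasing_ge0_integration_by_substitutionNy _ (fun q => k * (q - x)) (normal_pdf 0 1) b).
- by apply: eq_integral => q _; rewrite F' !fctE.
- by move=> u v _ _ uv; rewrite ltr_pM2l// ltrD2r.
- by rewrite F' => u _; exact: cst_continuous.
- by rewrite F'; exact: is_cvg_cst.
- by rewrite F'; exact: cvg_cst.
- split; first by move=> u _; have [] := dF u.
  exact/cvg_at_left_filter/cF.
- apply/gt0_cvgMrNy => //; exact: cvg_addrr_Ny.
- by apply: continuous_subspaceT; apply: continuous_normal_pdf; rewrite oner_neq0.
- by move=> u _; exact: normal_pdf_ge0.
Qed.

(** The Gaussian density is its own Fourier transform up to a constant; this takes the place of a
    Fourier inversion theorem. *)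
Lemma std_normal_pdf_cf (y : R) :
  normal_pdf 0 1 y = normal_peak 1 * \int[normal_prob 0 1]_t cos (t * y).
Proof.
have := @normal_cf R 0 1 (oner_neq0 _) y 0.
rewrite mulr0 addr0 cos0 mul1r expr1n mulr1 => h.
under eq_Rintegral do rewrite mulrC -[_ * _]addr0.
by rewrite h normal_pdfE ?oner_neq0// /normal_fun subr0 expr1n.
Qed.

End NormalCdf.

(** * Uniqueness of laws by Gaussian smoothing *)

Section Smoothing.
Context (d : measure_display) (T : measurableType d) (R : realType)
  (P : probability T R).
Notation mu := (@lebesgue_measure R).
Variables (X h : T -> R) (C : R).
Hypotheses (mX : measurable_fun setT X) (mh : measurable_fun setT h).
Hypothesis hC : forall w, `|h w| <= C.

(* Convolving with a Gaussian kernel of width 1/k turns the distribution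
   function of X into an integral of its characteristic function. *)
Lemma smoothed_cdf_cf (k b : R) : 0 < k ->
  \int[P]_w (Ncdf (k * (b - X w)) * h w) =
  \int[mu]_(q in `]-oo, b]) (normal_peak 1 * k *
     \int[normal_prob 0 1]_t \int[P]_w (cos (- (t * k) * X w + t * k * q) * h w)).
Proof.
move=> k0.
have C0 : 0 <= C by apply: le_trans (hC point).
pose f (x : T * R) := (normal_pdf 0 1 (k * (x.2 - X x.1)) * k * h x.1) * \1_(`]-oo, b]%classic) x.2.
have mf : measurable_fun setT f.
  apply: measurable_funM; last first.
    by apply: measurableT_comp => //; exact: measurable_indic.
  apply: measurable_funM; last exact: measurableT_comp.
  apply: measurable_funM => //.
  apply: measurableT_comp; first exact: measurable_normal_pdf.
  apply: measurable_funM => //; apply: measurable_funB => //.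
  exact: measurableT_comp.
have pdfint (x : R) : mu.-integrable setT (fun q => (normal_pdf 0 1 (k * (q - x)) * k * \1_(`]-oo, b]%classic) q)%:E).
  apply/integrableP; split.
    apply/measurable_EFinP; apply: measurable_funM; last exact: measurable_indic.
    apply: measurable_funM => //; apply: measurableT_comp; first exact: measurable_normal_pdf.
    by apply: measurable_funM => //; exact: measurable_funB.
  under eq_integral => q _.
    rewrite abse_EFin ger0_norm; last by rewrite mulr_ge0// mulr_ge0 ?normal_pdf_ge0// ltW.
    over.
  by rewrite integral_mul_indic -Ncdf_subst// ltry.
have f1 x q : f (x, q) = (normal_pdf 0 1 (k * (q - X x)) * k * \1_(`]-oo, b]%classic) q) * h x.
  by rewrite /f/=; ring.
have step1 : \int[P]_w (Ncdf (k * (b - X w)) * h w) = \int[P]_w \int[mu]_q f (w, q).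
  apply: eq_Rintegral => w _; under eq_Rintegral do rewrite f1.
  rewrite RintegralZr//; last exact: pdfint.
  by rewrite /Rintegral integral_mul_indic -Ncdf_subst.
have pdfb x : `|normal_pdf 0 1 x| <= normal_peak 1 :> R.
  by rewrite ger0_norm ?normal_pdf_ge0// normal_pdf_ub// oner_neq0.
(* Exchange of w and q. Lebesgue measure in q is infinite, but the inner integral of |f| over q is
   at most C because [Ncdf] is at most 1. *)
rewrite step1 Rintegral_Fubini; first last.
- move=> q; apply: (@bounded_integrable _ _ _ P (fun w => f (w, q)) (normal_peak 1 * k * C)).
    exact: measurableT_comp.
  move=> w; rewrite f1.
  have A0 : 0 <= normal_pdf 0 1 (k * (q - X w)) * k.
    by apply: mulr_ge0; [exact: normal_pdf_ge0|exact: ltW].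
  have A1 : normal_pdf 0 1 (k * (q - X w)) * k <= normal_peak 1 * k.
    by rewrite ler_wpM2r ?(ltW k0)// normal_pdf_ub// oner_neq0.
  rewrite normrM ler_pM// normrM (ger0_norm A0) (le_trans _ A1)//.
  by rewrite ler_piMr// indicE normr_nat; case: (_ \in _).
- move=> w; under eq_fun do rewrite f1 mulrC EFinM.
  by apply: integrableZl => //; exact: pdfint.
- apply/integrable12ltyP; first exact/measurable_EFinP.
  apply: (@le_lt_trans _ _ (\int[P]_w C%:E)%E); last first.
    by rewrite integral_cst//= probability_setT mule1 ltry.
  apply: ge0_le_integral => //=.
  - by move=> w _; exact: integral_ge0.
  - have mf' : measurable_fun setT (fun x => (`|f x|)%:E).
      by apply/measurable_EFinP; exact: measurableT_comp.
    by apply: (@measurable_fun_fubini_tonelli_F _ _ _ _ _ mu _ mf').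
  - move=> w _; under eq_integral => q _.
      rewrite f1 normrM (ger0_norm (x := normal_pdf 0 1 _ * _ * _)); last by rewrite mulr_ge0// mulr_ge0 ?normal_pdf_ge0// ltW.
      rewrite EFinM; over.
    rewrite (integralZr measurableT (pdfint (X w))).
    rewrite integral_mul_indic -Ncdf_subst// -EFinM lee_fin -[leRHS]mul1r ler_pM//.
    + by case/andP: (Ncdf_ge0_le1 (k * (b - X w))).
    + by case/andP: (Ncdf_ge0_le1 (k * (b - X w))).
rewrite [RHS]Rintegral_mkcond; apply: eq_Rintegral => q _.
rewrite patchE; case: ifPn => qb; last first.
  under eq_Rintegral do rewrite f1 indicE (negbTE qb) mulr0 mul0r.
  by rewrite Rintegral_prob_cst.
under eq_Rintegral do rewrite f1 indicE qb mulr1.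
have mcos : measurable_fun setT (fun x : T * R => cos (- (x.2 * k) * X x.1 + x.2 * k * q) * h x.1).
  apply: measurable_funM; last exact: measurableT_comp.
  apply: measurableT_comp; first by apply: continuous_measurable_fun; exact: continuous_cos.
  apply: measurable_funD; last by apply: measurable_funM => //; exact: measurable_funM.
  apply: measurable_funM; last exact: measurableT_comp.
  by apply: measurableT_comp => //; exact: measurable_funM.
have cC x : `|cos (- (x.2 * k) * X x.1 + x.2 * k * q) * h x.1| <= C.
  by rewrite normrM -[leRHS]mul1r ler_pM// cos_max.
(* Exchange of w and t: both measures are probabilities and the integrand is bounded by C. *)
rewrite -(bounded_Fubini P (normal_prob 0 1) mcos cC).
have pk0 : normal_peak 1 != 0 :> R by rewrite gt_eqF// normal_peak_gt0// oner_neq0.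
have eqw w : \int[normal_prob 0 1]_t (cos (- (t * k) * X w + t * k * q) * h w) =
    (normal_peak 1)^-1 * normal_pdf 0 1 (k * (q - X w)) * h w.
  rewrite std_normal_pdf_cf mulrA mulVf// mul1r -RintegralZr//; last first.
    apply: (@bounded_integrable _ _ _ (normal_prob 0 1) _ 1); last by move=> t; exact: cos_max.
    apply: measurableT_comp; first by apply: continuous_measurable_fun; exact: continuous_cos.
    exact: measurable_funM.
  apply: eq_Rintegral => t _; congr (cos _ * _); by ring.
under [in RHS]eq_Rintegral => w _ do rewrite eqw.
rewrite -RintegralZl//; last first.
  apply: (@bounded_integrable _ _ _ P _ C).
    apply: measurable_funM => //; apply: measurable_funM => //.
    apply: measurableT_comp; first exact: measurable_normal_pdf.
    by apply: measurable_funM => //; exact: measurable_funB.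
  move=> w; rewrite normrM -[leRHS]mul1r ler_pM// normrM normfV (ger0_norm (normal_peak_ge0 1)).
  by rewrite ler_pdivrMl ?normal_peak_gt0 ?oner_neq0// mulr1.
apply: eq_Rintegral => w _; field; exact: pk0.
Qed.

End Smoothing.

Section CfDet.
Context (d d' : measure_display) (T : measurableType d) (T' : measurableType d')
  (R : realType) (P : probability T R) (P' : probability T' R).
Variables (X h : T -> R) (X' h' : T' -> R) (C : R).
Hypotheses (mX : measurable_fun setT X) (mh : measurable_fun setT h).
Hypotheses (mX' : measurable_fun setT X') (mh' : measurable_fun setT h').
Hypotheses (hC : forall w, `|h w| <= C) (hC' : forall w, `|h' w| <= C).
Hypothesis cf_eq : forall a c,
  \int[P]_w (cos (a * X w + c) * h w) = \int[P']_w (cos (a * X' w + c) * h' w).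

(** Two scales are needed to reach the closed half-line: the sharpness (n+1)^2 beats the shift
    1/(n+1), and at x = p the shift makes the argument n + 1, where an unshifted kernel would stay
    at 1/2. *)
Let lim_ind (p x : R) :
  Ncdf (n.+1%:R ^+ 2 * (p + n.+1%:R^-1 - x)) @[n --> \oo] --> (\1_`]-oo, p] x : R).
Proof.
have ny : (n.+1%:R : R) @[n --> \oo] --> +oo.
  by rewrite (cvg_shiftS (fun n => n%:R : R)); exact: cvgr_idn.
have ex n : n.+1%:R ^+ 2 * (p + n.+1%:R^-1 - x) = n.+1%:R * (n.+1%:R * (p - x) + 1).
  have : n.+1%:R != 0 :> R by rewrite pnatr_eq0.
  by move: (n.+1%:R : R) => N N0; field.
under eq_fun do rewrite ex.
rewrite indicE; case: (boolP (x \in _)) => xp /=.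
  move: xp; rewrite inE/= in_itv/= => xp.
  apply: (cvg_comp _ _ _ Ncdf_cvgy).
  apply: (ger_cvgy _ ny); apply: nearW => n; rewrite ler_peMr// lerDr mulr_ge0// subr_ge0//.
have {}xp : p < x.
  by rewrite ltNge; apply: contra xp => xp; rewrite inE/= in_itv.
apply: (cvg_comp _ _ _ Ncdf_cvgNy).
have nNy : (- n.+1%:R : R) @[n --> \oo] --> -oo by exact/cvgNrNy.
apply: (ler_cvgNy _ nNy).
have d0 : 0 < x - p by rewrite subr_gt0.
near=> n.
rewrite -mulrN1 ler_wpM2l// -lerBrDr.
have : 2 / (x - p) <= n.+1%:R.
  near: n; have := ny => /cvgryPge; apply; exact: num_real.
rewrite ler_pdivrMr//; nra.
Unshelve. all: by end_near. Qed.

(** By [smoothed_cdf_cf] the smoothed integrals depend on the weighted characteristic functions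
    alone, and the smoothing is then removed by bounded convergence. The weight h may change sign:
    independence is proved by taking a cosine or an indicator of a second variable as weight. *)
Lemma cf_det (p : R) :
  \int[P]_w (\1_`]-oo, p] (X w) * h w) = \int[P']_w (\1_`]-oo, p] (X' w) * h' w).
Proof.
have key (d1 : measure_display) (T1 : measurableType d1) (Q : probability T1 R) (Y g : T1 -> R) :
    measurable_fun setT Y -> measurable_fun setT g -> (forall w, `|g w| <= C) ->
  \int[Q]_w (Ncdf (n.+1%:R ^+ 2 * (p + n.+1%:R^-1 - Y w)) * g w) @[n --> \oo] -->
  \int[Q]_w (\1_`]-oo, p] (Y w) * g w).
  move=> mY mg gC.
  apply: (@Rintegral_cvg_bounded _ _ _ _ _ _ C).
  - move=> n; apply: measurable_funM => //.
    apply: measurableT_comp.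
      apply: nondecreasing_measurable => //; exact: Ncdf_nd.
    by apply: measurable_funM => //; exact: measurable_funB.
  - by move=> w; apply: cvgM; [exact: lim_ind|exact: cvg_cst].
  - move=> n w; rewrite normrM -[leRHS]mul1r ler_pM//.
    by have /andP[? ?] := Ncdf_ge0_le1 (n.+1%:R ^+ 2 * (p + n.+1%:R^-1 - Y w)); rewrite ger0_norm.
have k1 := key _ _ P X h mX mh hC.
have k2 := key _ _ P' X' h' mX' mh' hC'.
suff e n : \int[P']_w (Ncdf (n.+1%:R ^+ 2 * (p + n.+1%:R^-1 - X' w)) * h' w) =
  \int[P]_w (Ncdf (n.+1%:R ^+ 2 * (p + n.+1%:R^-1 - X w)) * h w).
  by move: k2; rewrite (funext e); exact: cvg_unique.
have k0 : 0 < n.+1%:R ^+ 2 :> R by rewrite exprn_gt0.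
move: (n.+1%:R ^+ 2) (p + n.+1%:R^-1) k0 => k b k0.
have e1 := @smoothed_cdf_cf _ _ _ P X h C mX mh hC k b k0.
have e2 := @smoothed_cdf_cf _ _ _ P' X' h' C mX' mh' hC' k b k0.
rewrite e1 e2.
by apply: eq_Rintegral => q _; congr (_ * _); apply: eq_Rintegral => t _; rewrite cf_eq.
Qed.

End CfDet.

Lemma measure_eq_cdf (R : realType) (m1 m2 : {measure set (measurableTypeR R) -> \bar R}) :
  m1 setT = m2 setT -> (m1 setT < +oo)%E ->
  (forall x : R, m1 `]-oo, x]%classic = m2 `]-oo, x]%classic) ->
  forall A, measurable A -> m1 A = m2 A.
Proof.
move=> mT mfin mx A mA.
have tail (x : R) : `]x, +oo[%classic = setT `\` `]-oo, x].
  by rewrite setTD -[in RHS]setCitvr setCK.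
have fin1 B : measurable B -> (m1 B < +oo)%E.
  by move=> mB; rewrite (le_lt_trans _ mfin)// le_measure ?inE.
have cov : \bigcup_k (`](- k%:R : R), +oo[%classic) = setT.
  rewrite -subTset => x _; exists (Num.truncn `|x|).+1 => //=.
  rewrite in_itv/= andbT ltrNl (le_lt_trans (ler_norm _))// normrN.
  exact: truncnS_gt.
apply: (@g_sigma_algebra_measure_unique _ R (measurableTypeR R) (@RGenOInfty.G R) _ (fun k => `](- k%:R : R), +oo[%classic) _ cov m1 m2).
- by move=> _ [x ->]; exact: measurable_itv.
- by move=> i; exists (- i%:R).
- move=> _ _ [x ->] [y ->]; exists (Num.max x y); apply/seteqP; split => z /=;
  by rewrite !in_itv/= !andbT gt_max => /andP.
- move=> _ [x ->]; rewrite tail.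
  rewrite !measureD ?setTI//; first by congr (_ - _)%E; [exact: mT|exact: mx].
    by move: mfin; rewrite mT.
- move=> k; exact: fin1.
- have -> : <<s (@RGenOInfty.G R) >> = (@ocitv R).-sigma.-measurable by rewrite RGenOInfty.measurableE.
  exact: mA.
Qed.

(** * Laws and independence of Gaussian variables from characteristic functions *)

Section GaussianCf.
Context (d : measure_display) (T : measurableType d) (R : realType)
  (P : probability T R).

(* The law N(0, v), including the degenerate case v = 0, through its
   characteristic function; the phase c stands for the imaginary part. *)
Definition gcf (Y : T -> R) (v : R) := forall a c,
  \int[P]_w cos (a * Y w + c) = cos c * expR (- (a ^+ 2 * v) / 2).

Lemma Rintegral_indic (d' : measure_display) (T' : measurableType d')
  (Q : probability T' R) (A : set T') : measurable A ->
  \int[Q]_w \1_A w = fine (Q A).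
Proof. by move=> mA; rewrite /Rintegral integral_indic// setIT. Qed.

Lemma measurable_preimage (d' : measure_display) (E : measurableType d') (Y : T -> E) (A : set E) :
  measurable_fun setT Y -> measurable A -> measurable (Y @^-1` A).
Proof. by move=> mY mA; rewrite -[X in measurable X]setTI; exact: mY. Qed.

Lemma Rintegral_indic_preimage (d' : measure_display) (T' : measurableType d')
  (Q : probability T' R) (Y : T' -> R) (A : set R) : measurable_fun setT Y ->
  measurable A -> \int[Q]_w \1_A (Y w) = fine (Q (Y @^-1` A)).
Proof.
move=> mY mA; rewrite -[in RHS](setIT (Y @^-1` A)) -integral_indic//.
by rewrite -[X in measurable X]setTI; exact: mY.
Qed.

Section RealRV.
Variables (Y : T -> R) (mY : measurable_fun setT Y).

Definition real_rv : {RV P >-> measurableTypeR R} :=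
  HB.pack (Y : T -> measurableTypeR R)
    (@isMeasurableFun.Build _ _ T (measurableTypeR R) (Y : T -> measurableTypeR R) mY).


Lemma distribution_real_rv (A : set R) : distribution P real_rv A = P (Y @^-1` A).
Proof. by []. Qed.

End RealRV.

(** For a fixed event E both sides are finite measures in B with total mass P(E), so half-lines
    decide. *)
Lemma event_indep_cdf (E : set T) (Y : T -> R) : measurable E ->
  measurable_fun setT Y ->
  (forall q, P (E `&` Y @^-1` `]-oo, q]) = (P E * P (Y @^-1` `]-oo, q]))%E) ->
  forall B, measurable B -> P (E `&` Y @^-1` B) = (P E * P (Y @^-1` B))%E.
Proof.
move=> mE mY h B mB.
have mrv : measurable_fun setT (real_rv mY) by [].
pose m1f := (pushforward (mrestr P mE) (real_rv mY) : {measure set (measurableTypeR R) -> \bar R}).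
pose m1 := m1f mrv.

have PE : (0 <= fine (P E))%R by exact: fine_ge0.
pose m2 : {measure set (measurableTypeR R) -> \bar R} := mscale (NngNum PE) (distribution P (real_rv mY)).
have fE : P E \is a fin_num by rewrite fin_num_measure.
have m1E A : m1 A = P (E `&` Y @^-1` A) by rewrite setIC.
have m2E A : m2 A = (P E * P (Y @^-1` A))%E by rewrite /m2 /= /mscale /= fineK.
rewrite -m1E -m2E; apply: measure_eq_cdf => //.
- by rewrite m1E m2E !preimage_setT probability_setT mule1 setIT.
- by rewrite m1E preimage_setT setIT (le_lt_trans (probability_le1 _ _))// ltry.
- by move=> q; rewrite m1E m2E.
Qed.

Lemma gcf_law (Y : T -> R) (v : R) : measurable_fun setT Y -> 0 < v ->
  gcf Y v -> forall A, measurable A -> P (Y @^-1` A) = normal_prob 0 (Num.sqrt v) A.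
Proof.
move=> mY v0 gY A mA.
have s0 : Num.sqrt v != 0 by rewrite gt_eqF// sqrtr_gt0.
rewrite -(distribution_real_rv mY).
have e1 : distribution P (real_rv mY) [set: measurableTypeR R] = 1%E := probability_setT _.
have e2 : normal_prob 0 (Num.sqrt v) [set: measurableTypeR R] = 1%E := probability_setT _.
apply: (@measure_eq_cdf R (distribution P (real_rv mY)) (normal_prob 0 (Num.sqrt v))) => //.
- exact: (etrans e1 (esym e2)).
- exact: (eq_ind_r (fun z => (z < +oo)%E) (ltry 1) e1).
move=> x; rewrite [LHS](distribution_real_rv mY).
have mx : measurable (Y @^-1` `]-oo, x]) by exact: measurable_preimage.
have m1 (d1 : measure_display) (T1 : measurableType d1) :
  measurable_fun [set: T1] (cst (1 : R)) by exact: measurable_cst.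
have n1 (T1 : Type) (w : T1) : `|cst (1 : R) w| <= 1 by rewrite normr1.
have cfe a c : \int[P]_w (cos (a * Y w + c) * 1) =
    \int[normal_prob 0 (Num.sqrt v)]_w (cos (a * idfun w + c) * 1).
  under eq_Rintegral do rewrite mulr1; rewrite gY.
  under eq_Rintegral do rewrite mulr1.
  by rewrite normal_cf// mulr0 add0r sqr_sqrtr// ltW.
have := @cf_det _ _ T _ R P (normal_prob 0 (Num.sqrt v)) Y (cst 1) idfun (cst 1) 1 mY
  (m1 _ _) (@measurable_id _ _ setT) (m1 _ _) (n1 _) (n1 _) cfe x.
under eq_Rintegral do rewrite mulr1.
rewrite (Rintegral_indic_preimage _ mY)//.
under eq_Rintegral do rewrite mulr1.
have -> : \int[normal_prob 0 (Num.sqrt v)]_w \1_`]-oo, x] (idfun w) =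
  fine (normal_prob 0 (Num.sqrt v) `]-oo, x]) by exact: Rintegral_indic.
move=> h.
have f1 : P (Y @^-1` `]-oo, x]) \is a fin_num by rewrite fin_num_measure.
have f2 : normal_prob 0 (Num.sqrt v) `]-oo, x] \is a fin_num by rewrite fin_num_measure.
by rewrite -(fineK f1) h fineK.
Qed.

(** The product-to-sum formula turns cos(aX + c) cos(bY + c') into cosines of the combinations aX +
    bY and aX - bY, whose integrals factor. [cf_det] then replaces one cosine at a time by the
    indicator of a half-line: first in X with a cosine of Y as weight, then in Y with that indicator
    as weight. [event_indep_cdf] finally extends half-lines to B and to A. *)
Lemma gcf_indep (X Y : T -> R) (v u : R) :
  measurable_fun setT X -> measurable_fun setT Y ->
  (forall a b, gcf (fun w => a * X w + b * Y w) (a ^+ 2 * v + b ^+ 2 * u)) ->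
  forall A B, measurable A -> measurable B ->
  P (X @^-1` A `&` Y @^-1` B) = (P (X @^-1` A) * P (Y @^-1` B))%E.
Proof.
move=> mX mY g A B mA mB.
have mcos (Z : T -> R) c : measurable_fun setT Z -> measurable_fun setT (fun w => cos (Z w + c)).
  move=> mZ; apply: measurableT_comp; first by apply: continuous_measurable_fun; exact: continuous_cos.
  exact: measurable_funD.
have icos (Z : T -> R) c : measurable_fun setT Z -> P.-integrable setT (EFin \o (fun w => cos (Z w + c))).
  by move=> mZ; apply: (@bounded_integrable _ _ _ P _ 1); [exact: mcos|move=> w; exact: cos_max].
have gX a c : \int[P]_w cos (a * X w + c) = cos c * expR (- (a ^+ 2 * v) / 2).
  have := g a 0 1 c; rewrite expr1n mul1r expr0n/= mul0r addr0 => <-.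
  by apply: eq_Rintegral => w _; rewrite mul0r addr0 mul1r.
have gY b c : \int[P]_w cos (b * Y w + c) = cos c * expR (- (b ^+ 2 * u) / 2).
  have := g 0 b 1 c; rewrite expr1n mul1r expr0n/= mul0r add0r => <-.
  by apply: eq_Rintegral => w _; rewrite mul0r add0r mul1r.
have prod a c b c' : \int[P]_w (cos (a * X w + c) * cos (b * Y w + c')) =
    cos c * expR (- (a ^+ 2 * v) / 2) * (cos c' * expR (- (b ^+ 2 * u) / 2)).
  transitivity (\int[P]_w (2^-1 * (cos (1 * (a * X w + b * Y w) + (c + c')) + cos (1 * (a * X w + - b * Y w) + (c - c'))))).
    apply: eq_Rintegral => w _.
    rewrite (_ : 1 * (a * X w + b * Y w) + (c + c') = (a * X w + c) + (b * Y w + c')); last by ring.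
    rewrite (_ : 1 * (a * X w + - b * Y w) + (c - c') = (a * X w + c) - (b * Y w + c')); last by ring.
    by move: (a * X w + c) (b * Y w + c') => x y; rewrite cosB cosD; field.
  have m1 b0 : measurable_fun setT (fun w => 1 * (a * X w + b0 * Y w)).
    by apply: measurable_funM => //; apply: measurable_funD; exact: measurable_funM.
  rewrite RintegralZl//; last first.
    rewrite (_ : EFin \o _ = (EFin \o (fun w => cos (1 * (a * X w + b * Y w) + (c + c')))) \+
      (EFin \o (fun w => cos (1 * (a * X w + - b * Y w) + (c - c')))))%E//.
    by apply: integrableD => //; exact: icos.
  rewrite RintegralD//; [|exact: icos|exact: icos].
  rewrite !g cosB cosD sqrrN expr1n mul1r.
  rewrite (_ : - (a ^+ 2 * v + b ^+ 2 * u) / 2 = - (a ^+ 2 * v) / 2 + - (b ^+ 2 * u) / 2); last by field.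
  rewrite expRD; by field.
have step1 p b c' : \int[P]_w (\1_`]-oo, p] (X w) * cos (b * Y w + c')) =
    fine (P (X @^-1` `]-oo, p])) * (cos c' * expR (- (b ^+ 2 * u) / 2)).
  set k := cos c' * _.
  have e1 : expR (- (b ^+ 2 * u) / 2) <= 1.
    have := gY b 0; rewrite cos0 mul1r => <-.
    apply: (@le_trans _ _ (\int[P]_w 1)); last by rewrite Rintegral_prob_cst.
    apply: le_Rintegral => //.
    - by apply: icos; exact: measurable_funM.
    - exact: finite_measure_integrable_cst.
  have k1 : `|k| <= 1.
    by rewrite normrM -[leRHS]mul1r ler_pM ?cos_max// ger0_norm ?expR_ge0.
  have mk : measurable_fun [set: T] (cst k) by exact: measurable_cst.
  have mbY : measurable_fun [set: T] (fun w => cos (b * Y w + c')).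
    by apply: mcos; exact: measurable_funM.
  rewrite (@cf_det _ _ T T R P P X (fun w => cos (b * Y w + c')) X (cst k) 1 mX mbY mX mk).
  - rewrite RintegralZr//; first by rewrite Rintegral_indic_preimage.
    by apply: integrable_indic; exact: measurable_preimage.
  - by move=> w; exact: cos_max.
  - by move=> w.
  - move=> a c; rewrite prod RintegralZr ?gX//.
    by apply: icos; exact: measurable_funM.
have step2 p q : P (X @^-1` `]-oo, p] `&` Y @^-1` `]-oo, q]) =
    (P (X @^-1` `]-oo, p]) * P (Y @^-1` `]-oo, q]))%E.
  set k := fine (P (X @^-1` `]-oo, p])).
  have mk : measurable_fun [set: T] (cst k) by exact: measurable_cst.
  have k1 : `|k| <= 1.
    rewrite ger0_norm ?fine_ge0// -lee_fin fineK ?fin_num_measure// ?probability_le1//; exact: measurable_preimage.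
  have mI : measurable_fun [set: T] (fun w => \1_`]-oo, p] (X w) : R).
    by apply: measurableT_comp => //; exact: measurable_indic.
  have := @cf_det _ _ T T R P P Y (fun w => \1_`]-oo, p] (X w)) Y (cst k) 1 mY mI mY mk.
  move=> /(_ _ _ _ q) H.
  have {H} : \int[P]_w (\1_`]-oo, q] (Y w) * \1_`]-oo, p] (X w)) = \int[P]_w (\1_`]-oo, q] (Y w) * k).
    apply: H.
    - by move=> w; rewrite indicE normr_nat; case: (_ \in _).
    - by move=> w.
    - move=> b c; under eq_Rintegral do rewrite mulrC.
      rewrite step1 RintegralZr; [|by []|by apply: icos; exact: measurable_funM].
      by rewrite gY mulrC.
  rewrite RintegralZr//; last by apply: integrable_indic; exact: measurable_preimage.
  rewrite Rintegral_indic_preimage// => H.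
  have f1 : P (X @^-1` `]-oo, p] `&` Y @^-1` `]-oo, q]) \is a fin_num.
    by rewrite fin_num_measure//; apply: measurableI; exact: measurable_preimage.
  have f2 : P (X @^-1` `]-oo, p]) \is a fin_num by rewrite fin_num_measure//; exact: measurable_preimage.
  have f3 : P (Y @^-1` `]-oo, q]) \is a fin_num by rewrite fin_num_measure//; exact: measurable_preimage.
  rewrite -(fineK f1) -(fineK f2) -(fineK f3) -EFinM; congr EFin.
  rewrite mulrC -H -Rintegral_indic; last by apply: measurableI; exact: measurable_preimage.
  apply: eq_Rintegral => w _.
  by rewrite indicI /= mulrC.
have step3 p : P (X @^-1` `]-oo, p] `&` Y @^-1` B) = (P (X @^-1` `]-oo, p]) * P (Y @^-1` B))%E.
  by apply: event_indep_cdf => //; exact: measurable_preimage.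
rewrite setIC muleC; apply: event_indep_cdf => //; first exact: measurable_preimage.
by move=> p; rewrite setIC muleC.
Qed.

End GaussianCf.

Lemma measurable_cos_affine (d : measure_display) (T : measurableType d) (R : realType)
  (Y : T -> R) (a c : R) : measurable_fun setT Y ->
  measurable_fun setT (fun w => cos (a * Y w + c)).
Proof.
move=> mY; apply: measurableT_comp; first by apply: continuous_measurable_fun; exact: continuous_cos.
by apply: measurable_funD => //; exact: measurable_funM.
Qed.

(** * Independent pairs and limits of Gaussian variables *)

Section IndepFubini.
Context (d : measure_display) (T : measurableType d) (R : realType)
  (P : probability T R).

Definition mk_rv (d' : measure_display) (E : measurableType d') (Y : T -> E)
    (mY : measurable_fun setT Y) : {RV P >-> E} :=
  HB.pack Y (@isMeasurableFun.Build _ _ T E Y mY).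

Context (d1 d2 : measure_display) (T1 : measurableType d1) (T2 : measurableType d2).
Variables (X : T -> T1) (Y : T -> T2).
Hypotheses (mX : measurable_fun setT X) (mY : measurable_fun setT Y).
Hypothesis XY : forall A B, measurable A -> measurable B ->
  P (X @^-1` A `&` Y @^-1` B) = (P (X @^-1` A) * P (Y @^-1` B))%E.

(** The product formula on rectangles identifies the law of (X, Y) with the product of the laws;
    Fubini is applied there and pulled back to P. *)
Lemma indep_Fubini (f : T1 * T2 -> R) (C : R) : measurable_fun setT f ->
  (forall x, `|f x| <= C) ->
  \int[P]_w f (X w, Y w) = \int[P]_w1 \int[P]_w2 f (X w1, Y w2).
Proof.
move=> mf fC.
have mXY : measurable_fun setT (fun w => (X w, Y w)) by exact: measurable_fun_pair.
pose rX := mk_rv mX; pose rY := mk_rv mY; pose rXY := mk_rv mXY.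
have U : forall A, measurable A -> (distribution P rX \x distribution P rY)%E A = distribution P rXY A.
  by apply: product_measure_unique => A B mA mB; rewrite /distribution /pushforward/= -XY.
have iXY (g : T1 * T2 -> R) : measurable_fun setT g -> (forall x, `|g x| <= C) ->
  P.-integrable setT (EFin \o (fun w => g (X w, Y w))).
  move=> mg gC; apply: (@bounded_integrable _ _ _ P _ C) => //.
  exact: measurableT_comp.
have e1 : (\int[P]_w (f (X w, Y w))%:E = \int[distribution P rXY]_x (f x)%:E)%E.
  by rewrite integral_distribution//; [exact/measurable_EFinP|exact: iXY].
have e2 : (\int[distribution P rXY]_x (f x)%:E =
    \int[(distribution P rX \x distribution P rY)]_x (f x)%:E)%E.
  by apply: eq_measure_integral => A mA _; exact: esym (U _ mA).
have imf : (distribution P rX \x distribution P rY)%E.-integrable setT (EFin \o f).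
  exact: (@bounded_integrable _ _ _ (distribution P rX \x distribution P rY)%E f C).
have mp (x : T1) : measurable_fun setT (fun w => (x, Y w)) by exact: measurable_fun_pair.
have iY x : P.-integrable setT (EFin \o (fun w => f (x, Y w))).
  apply: (@bounded_integrable _ _ _ P (fun w => f (x, Y w)) C) => //.
  exact: (measurableT_comp mf (mp x)).
pose g x := \int[P]_w2 f (x, Y w2).
have FE : fubini_F (distribution P rY) (EFin \o f) = EFin \o g.
  apply/funext => x; rewrite /fubini_F /g /Rintegral /= fineK; last exact: (integrable_fin_num measurableT (iY x)).
  rewrite integral_distribution//.
    by apply/measurable_EFinP; exact: measurableT_comp.
  exact: iY.
have mg : measurable_fun setT g.
  by have := measurable_fubini_F imf; rewrite FE => /measurable_EFinP.
have gC x : `|g x| <= C.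
  rewrite (le_trans (le_normr_Rintegral _ _))//.
  rewrite -[leRHS](Rintegral_prob_cst P); apply: le_Rintegral => //.
  - exact: (integrable_norm (iY x)).
  - exact: finite_measure_integrable_cst.
rewrite {1}/Rintegral e1 e2 -integral12_prod_meas1// FE integral_distribution//.
  exact/measurable_EFinP.
apply: (@bounded_integrable _ _ _ P _ C) => //; exact: measurableT_comp.
Qed.

End IndepFubini.

Section GcfLimits.
Context (d : measure_display) (T : measurableType d) (R : realType)
  (P : probability T R).

Lemma gcf_unique (Y : T -> R) (v v' : R) : gcf P Y v -> gcf P Y v' -> v = v'.
Proof.
move=> /(_ 1 0) g /(_ 1 0); rewrite g cos0 !mul1r expr1n !mul1r => /expR_inj; lra.
Qed.

Lemma cf_cvg (Y_ : nat -> T -> R) (Y : T -> R) (a c : R) :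
  (forall n, measurable_fun setT (Y_ n)) ->
  (forall w, Y_ n w @[n --> \oo] --> Y w) ->
  \int[P]_w cos (a * Y_ n w + c) @[n --> \oo] --> \int[P]_w cos (a * Y w + c).
Proof.
move=> mY YY; apply: (@Rintegral_cvg_bounded _ _ _ _ _ _ 1).
- by move=> n; exact: measurable_cos_affine.
- move=> w; apply: (cvg_comp _ (@cos R)); last exact: continuous_cos.
  by apply: cvgD; [apply: cvgM; [exact: cvg_cst|exact: YY]|exact: cvg_cst].
- by move=> n w; exact: cos_max.
Qed.

(** Nothing is assumed of the variances. Each is read off by a logarithm from the characteristic
    function at one point a, and these values converge by bounded convergence. *)
Lemma gcf_cvg (Y_ : nat -> T -> R) (Y : T -> R) (v_ : nat -> R) :
  (forall n, measurable_fun setT (Y_ n)) ->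
  (forall w, Y_ n w @[n --> \oo] --> Y w) ->
  (forall n, gcf P (Y_ n) (v_ n)) ->
  exists2 v, v_ n @[n --> \oo] --> v & gcf P Y v.
Proof.
move=> mY YY gY.
have mYl : measurable_fun setT Y by apply: (measurable_fun_cvg mY) => w _; exact: YY.
(* The logarithm needs a positive limit. The characteristic function of Y tends to 1 at 0, so some a
   = 1/(N+1) will do. *)
have [a a0 pa] : exists2 a : R, a != 0 & 0 < \int[P]_w cos (a * Y w + 0).
  have : \int[P]_w cos (1 * (n.+1%:R^-1 * Y w) + 0) @[n --> \oo] --> \int[P]_w cos (1 * 0 + 0).
    apply: (cf_cvg (Y_ := fun n w => n.+1%:R^-1 * Y w) (Y := fun=> 0)).
      by move=> n; exact: measurable_funM.
    move=> w; rewrite -[X in _ --> X](mul0r (Y w)); apply: cvgM; last exact: cvg_cst.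
    exact: cvg_harmonic.
  under [X in _ --> X]eq_Rintegral do rewrite mulr0 addr0 cos0.
  rewrite Rintegral_prob_cst => /cvgr_gt/(_ 0 ltr01)[N _ /(_ N (leqnn _)) h].
  exists N.+1%:R^-1; first by rewrite invr_eq0 pnatr_eq0.
  by move: h => /=; under eq_Rintegral do rewrite mul1r.
set p := \int[P]_w _ in pa.
pose v := - (2 / a ^+ 2) * ln p.
have vv : v_ n @[n --> \oo] --> v.
  have e n : v_ n = - (2 / a ^+ 2) * ln (\int[P]_w cos (a * Y_ n w + 0)).
    by rewrite gY cos0 mul1r expRK; field.
  rewrite (funext e); apply: cvgM; first exact: cvg_cst.
  apply: (cvg_comp _ (@ln R)); first exact: cf_cvg.
  exact: continuous_ln.
exists v => // b c.
have h := @cf_cvg Y_ Y b c mY YY.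
have eg n : \int[P]_w cos (b * Y_ n w + c) = cos c * expR (- (b ^+ 2 * v_ n) / 2) by rewrite gY.
rewrite (funext eg) in h.
suff h' : cos c * expR (- (b ^+ 2 * v_ n) / 2) @[n --> \oo] --> cos c * expR (- (b ^+ 2 * v) / 2).
  exact: cvg_unique h h'.
apply: cvgM; first exact: cvg_cst.
apply: (cvg_comp _ (@expR R)); last exact: continuous_expR.
apply: cvgM; last exact: cvg_cst.
by apply: cvgN; apply: cvgM; [exact: cvg_cst|exact: vv].
Qed.


Lemma gcf_indep_sum (X Y : T -> R) (v u : R) :
  measurable_fun setT X -> measurable_fun setT Y ->
  (forall A B, measurable A -> measurable B ->
    P (X @^-1` A `&` Y @^-1` B) = (P (X @^-1` A) * P (Y @^-1` B))%E) ->
  gcf P X v -> gcf P Y u -> gcf P (fun w => X w + Y w) (v + u).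
Proof.
move=> mX mY XY gX gY a c.
have mf : measurable_fun setT (fun x : R * R => cos (a * (x.1 + x.2) + c)).
  by apply: measurable_cos_affine; exact: measurable_funD.
rewrite (indep_Fubini mX mY XY mf (fun x => cos_max _))/=.
transitivity (\int[P]_w (cos (a * X w + c) * expR (- (a ^+ 2 * u) / 2))).
  apply: eq_Rintegral => w _.
  rewrite -gY; apply: eq_Rintegral => w' _; congr cos; ring.
rewrite RintegralZr//; last first.
  apply: (@bounded_integrable _ _ _ P _ 1); last by move=> w; exact: cos_max.
  exact: measurable_cos_affine.
rewrite gX -mulrA -expRD; congr (_ * expR _); by field.
Qed.

Lemma gcf_scale (X : T -> R) (v b : R) : gcf P X v -> gcf P (fun w => b * X w) (b ^+ 2 * v).
Proof.
move=> gX a c; under eq_Rintegral do rewrite mulrA.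
rewrite gX; congr (_ * expR _); by field.
Qed.

Lemma eq_law_integral (Y : T -> R) (Q : probability (measurableTypeR R) R) (f : R -> R) :
  measurable_fun setT Y -> measurable_fun setT f ->
  (forall B : set R, measurable B -> P (Y @^-1` B) = Q B) ->
  Q.-integrable setT (EFin \o f) ->
  P.-integrable setT (EFin \o (f \o Y)) /\ \int[P]_w f (Y w) = \int[Q]_x f x.
Proof.
move=> mY mf YQ iQ.
have e (g : R -> \bar R) : (\int[distribution P (real_rv P mY)]_x g x = \int[Q]_x g x)%E.
  by apply: eq_measure_integral => A mA _; exact: YQ.
have iP : P.-integrable setT (EFin \o (f \o Y)).
  apply/integrableP; split; first by apply/measurable_EFinP; exact: measurableT_comp.
  have /integrableP[_] := iQ; rewrite -e ge0_integral_distribution//.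
  by apply/measurable_EFinP; exact: measurableT_comp.
split => //; rewrite /Rintegral -e integral_distribution//.
exact/measurable_EFinP.
Qed.

(** The Dirac and the nondegenerate case of [gaussian_law] are merged here once and for all;
    afterwards Gaussian variables are handled through [gcf] only. *)
Lemma gaussian_law_moments (Y : T -> R) : measurable_fun setT Y ->
  gaussian_law P Y ->
  [/\ P.-integrable setT (EFin \o Y),
      P.-integrable setT (EFin \o (fun w => Y w ^+ 2)) &
      \int[P]_w Y w = 0 -> gcf P Y (\int[P]_w Y w ^+ 2)].
Proof.
move=> mY [m [s law]].
have m1 : measurable_fun setT (fun x : R => x) by exact: measurable_id.
have m2 : measurable_fun setT (fun x : R => x ^+ 2) by exact: measurable_funX.
have mc (a c : R) : measurable_fun setT (fun x : R => cos (a * x + c)).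
  apply: measurableT_comp; first by apply: continuous_measurable_fun; exact: continuous_cos.
  by apply: measurable_funD => //; exact: measurable_funM.
move: law; case: (eqVneq s 0) => [_|s0] law.
  pose Q : probability (measurableTypeR R) R := \d_(m : measurableTypeR R).
  have dI (f : R -> R) : measurable_fun setT f -> Q.-integrable setT (EFin \o f).
    move=> mf; apply/integrableP; split; first exact/measurable_EFinP.
    by rewrite integral_dirac//= ?diracT ?mul1e ?ltry//; apply/measurable_EFinP; exact: measurableT_comp.
  have lawQ (B : set R) : measurable B -> P (Y @^-1` B) = Q B by exact: law.
  have E (f : R -> R) (mf : measurable_fun setT f) := eq_law_integral mY mf lawQ (dI f mf).
  have Ed (f : R -> R) : measurable_fun setT f -> \int[Q]_x f x = f m.
    move=> mf; have mf' : measurable_fun setT (EFin \o f) by exact/measurable_EFinP.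
    have e := @integral_dirac _ (measurableTypeR R) m R setT measurableT (EFin \o f) mf'.
    by rewrite /Rintegral [X in fine X]e diracT mul1e.
  have [i1 e1] := E _ m1; have [i2 e2] := E _ m2.
  split => // Y0 a c; have [_ ->] := E _ (mc a c).
  have m0 : m = 0 by rewrite -[LHS](Ed _ m1) -e1.
  by rewrite (Ed _ (mc a c)) e2 (Ed _ m2) m0 expr0n/= !mulr0 oppr0 mul0r expR0 mulr1 add0r.
pose Q : probability (measurableTypeR R) R := normal_prob m s.
(* The factor 2 (1 + m^2) converts growth in x into growth in x - m, as the integrability lemmas
   require. *)
have K0 : 0 <= 2 * (1 + m ^+ 2) by rewrite mulr_ge0// addr_ge0// sqr_ge0.
have q1 x : `|x| <= 2 * (1 + m ^+ 2) * (1 + (x - m) ^+ 2).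
  have := sqr_ge0 (m * (x - m)); have := sqr_ge0 m; have := sqr_ge0 (x - m).
  have := sqr_ge0 (x - 1); have := sqr_ge0 (x + 1); rewrite ler_norml; nra.
have q2 x : `|x ^+ 2| <= 2 * (1 + m ^+ 2) * (1 + (x - m) ^+ 2).
  rewrite ger0_norm ?sqr_ge0//.
  have := sqr_ge0 (m * (x - m)); have := sqr_ge0 (x - m - m); nra.
have lawQ (B : set R) : measurable B -> P (Y @^-1` B) = Q B by exact: law.
have i1 := integrable_normal_quadratic s0 K0 m1 q1.
have i2 := integrable_normal_quadratic s0 K0 m2 q2.
have [j1 e1] := eq_law_integral mY m1 lawQ i1.
have [j2 e2] := eq_law_integral mY m2 lawQ i2.
split => // Y0 a c.
have ic : Q.-integrable setT (EFin \o (fun x => cos (a * x + c))).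
  by apply: (@bounded_integrable _ (measurableTypeR R) R Q _ 1); [exact: mc|move=> x; exact: cos_max].
have [_ ->] := eq_law_integral mY (mc a c) lawQ ic.
have m0 : m = 0 by rewrite -(normal_mean m s0) -e1.
rewrite normal_cf// m0 mulr0 add0r e2; congr (_ * expR (- (_ * _) / 2)).
have nv := normal_variance m s0.
transitivity (\int[Q]_x (x - m) ^+ 2); first exact: esym nv.
by apply: eq_Rintegral => x _; rewrite m0 subr0.
Qed.

End GcfLimits.

Lemma gcf_ge0 (d : measure_display) (T : measurableType d) (R : realType)
  (P : probability T R) (Y : T -> R) (v : R) :
  measurable_fun setT Y -> gcf P Y v -> 0 <= v.
Proof.
move=> mY /(_ 1 0); rewrite cos0 mul1r expr1n mul1r => e.
have : expR (- v / 2) <= expR 0.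
  rewrite -e expR0 -[leRHS](Rintegral_prob_cst P); apply: le_Rintegral => //.
  - apply: (@bounded_integrable _ _ _ P _ 1); last by move=> x; exact: cos_max.
    exact: measurable_cos_affine.
  - exact: finite_measure_integrable_cst.
rewrite ler_expR; lra.
Qed.

Lemma eq_law_Rintegral (d : measure_display) (T : measurableType d) (R : realType)
  (P : probability T R) (Y Y' : T -> R) :
  measurable_fun setT Y -> measurable_fun setT Y' ->
  P.-integrable setT (EFin \o Y) -> P.-integrable setT (EFin \o Y') ->
  (forall B : set R, measurable B -> P (Y @^-1` B) = P (Y' @^-1` B)) ->
  \int[P]_w Y w = \int[P]_w Y' w.
Proof.
move=> mY mY' iY iY' YY; rewrite /Rintegral; congr fine.
have e (Y0 : T -> R) (m0 : measurable_fun setT Y0) : P.-integrable setT (EFin \o Y0) ->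
  (\int[P]_w (Y0 w)%:E = \int[distribution P (mk_rv P m0)]_x x%:E)%E.
  by move=> i0; rewrite integral_distribution//; exact/measurable_EFinP.
rewrite (e _ mY)// (e _ mY')//; apply: eq_measure_integral => A mA _; exact: YY.
Qed.

Lemma integrable_mul_sqr (d : measure_display) (T : measurableType d) (R : realType)
  (P : probability T R) (X Y : T -> R) :
  measurable_fun setT X -> measurable_fun setT Y ->
  P.-integrable setT (EFin \o (fun w => X w ^+ 2)) ->
  P.-integrable setT (EFin \o (fun w => Y w ^+ 2)) ->
  P.-integrable setT (EFin \o (fun w => X w * Y w)).
Proof.
move=> mX mY iX iY.
apply: (@le_integrable _ _ _ P setT _ _ (fun w => (X w ^+ 2)%:E + (Y w ^+ 2)%:E)%E) => //.
- by apply/measurable_EFinP; exact: measurable_funM.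
- move=> w _; rewrite -EFinD !abse_EFin lee_fin [leRHS]ger0_norm ?addr_ge0 ?sqr_ge0//.
  have := sqr_ge0 (X w - Y w); have := sqr_ge0 (X w + Y w).
  have := sqr_ge0 (X w); have := sqr_ge0 (Y w); rewrite ler_norml; nra.
- exact: integrableD.
Qed.

Section SigmaGen.
Context (I : Type) (d d' : measure_display) (T : measurableType d) (E : measurableType d').
Variables (D : set I) (X : I -> T -> E).
Let G : set (set T) := \bigcup_(i in D) preimage_set_system setT (X i) measurable.

(** Changing the sigma-algebra on the domain lets ordinary measurability lemmas show that an event
    belongs to the sigma-algebra generated by the process. *)
Lemma measurable_sigma_gen (i : I) : D i ->
  measurable_fun [set: g_sigma_algebraType G] (X i : g_sigma_algebraType G -> E).
Proof.
move=> Di _ B mB; rewrite setTI; apply: sub_sigma_algebra; exists i => //.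
by exists B => //; rewrite setTI.
Qed.

Lemma sigma_gen_preimage (d2 : measure_display) (F : measurableType d2)
  (Y : g_sigma_algebraType G -> F) (B : set F) : measurable_fun setT Y -> measurable B ->
  sigma_gen D X (Y @^-1` B).
Proof. by move=> mY mB; have := mY measurableT B mB; rewrite setTI. Qed.

End SigmaGen.

(** * The covariance function *)

Section GaussianProcess.
Context (R : realType) (d : measure_display) (Omega : measurableType d)
  (P : probability Omega R) (T : R) (Z : R -> {RV P >-> R}).
Hypotheses (Zgauss : gaussian_process `[0, T] Z)
    (Zcentered : centered_process `[0, T] Z)
    (Zstat : stationary_process `[0, T] Z)
    (Gamma0 : cov_fun Z 0 = 2^-1).

(** The semivariogram: E (Z_t - Z_s)^2 = 2 q(t - s). *)
Let q (tau : R) : R := 2^-1 - cov_fun Z tau.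

Let mZ t : measurable_fun setT (Z t : Omega -> R).
Proof. exact: measurable_funP. Qed.

Lemma gauss1_integrable (t : R) : `[0, T]%classic t ->
  [/\ P.-integrable setT (EFin \o Z t), P.-integrable setT (EFin \o (fun w => Z t w ^+ 2)) &
  \int[P]_w Z t w = 0].
Proof.
move=> Dt.
have := Zgauss (n := 1) (t := fun=> t) (fun=> 1) (fun=> Dt).
rewrite (_ : (fun w => _) = Z t :> (Omega -> R)); last first.
  by apply/funext => w; rewrite big_ord1 mul1r.
move=> /(gaussian_law_moments (mZ t))[i1 i2 _]; split => //.
by have := Zcentered Dt; rewrite expectation_def /Rintegral => ->.
Qed.

Lemma cov_stationary (s t : R) : `[0, T]%classic s -> `[0, T]%classic t ->
  \int[P]_w (Z s w * Z t w) = cov_fun Z (t - s).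
Proof.
wlog st : s t / s <= t => [hw|].
  move=> Ds Dt; have [st|/ltW ts] := leP s t; first exact: hw.
  transitivity (cov_fun Z (s - t)); last by rewrite /cov_fun distrC.
  by rewrite -hw//; apply: eq_Rintegral => w _; rewrite mulrC.
move=> Ds Dt.
have /andP[s0 sT] : 0 <= s <= T by move: Ds; rewrite /= in_itv.
have /andP[t0 tT] : 0 <= t <= T by move: Dt; rewrite /= in_itv.
have D0 : `[0, T]%classic 0 by rewrite /= in_itv/= lexx (le_trans t0).
have Dts : `[0, T]%classic (t - s) by rewrite /= in_itv/= subr_ge0 st lerBlDr (le_trans tT)// lerDl.
rewrite /cov_fun expectation.unlock ger0_norm ?subr_ge0// -/(Rintegral _ _ _).
have [_ i0 _] := gauss1_integrable D0; have [_ is_ _] := gauss1_integrable Ds.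
have [_ it _] := gauss1_integrable Dt; have [_ its _] := gauss1_integrable Dts.
apply: eq_law_Rintegral.
- exact: measurable_funM.
- exact: measurable_funM.
- exact: integrable_mul_sqr.
- exact: integrable_mul_sqr.
move=> B mB.
pose tt (i : 'I_2) : R := if i == ord0 then 0 else t - s.
pose BB : set (2.-tuple R) := (fun v : 2.-tuple R => tnth v ord0 * tnth v ord_max) @^-1` B.
have mBB : measurable BB.
  apply: measurable_preimage => //; apply: measurable_funM; exact: measurable_tnth.
have := Zstat (n := 2) (t := tt) (h := s) _ _ mBB.
have -> : [set w | BB [tuple Z (tt i + s) w | i < 2]] = (fun w => Z s w * Z t w) @^-1` B.
  by apply/funext => w; rewrite /BB/= !tnth_mktuple /tt/= add0r subrK.
have -> : [set w | BB [tuple Z (tt i) w | i < 2]] = (fun w => Z 0 w * Z (t - s) w) @^-1` B.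
  by apply/funext => w; rewrite /BB/= !tnth_mktuple /tt/=.
apply.
- by move=> i; rewrite /tt; case: ifP.
- by move=> i; rewrite /tt; case: ifP => _; rewrite ?add0r ?subrK.
Qed.

(** Three times suffice for every estimate below. The first term is the variance if the three values
    of Z coincided; the terms in q measure the loss from spreading the times, which is what the tail
    bounds exploit. *)
Lemma gcf_comb3 (c1 c2 c3 t1 t2 t3 : R) :
  `[0, T]%classic t1 -> `[0, T]%classic t2 -> `[0, T]%classic t3 ->
  gcf P (fun w => c1 * Z t1 w + c2 * Z t2 w + c3 * Z t3 w)
    ((c1 + c2 + c3) ^+ 2 / 2 -
      2 * (c1 * c2 * q (t2 - t1) + c1 * c3 * q (t3 - t1) + c2 * c3 * q (t3 - t2))).
Proof.
move=> D1 D2 D3.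
pose c (i : 'I_3) : R := nth 0 [:: c1; c2; c3] i.
pose t (i : 'I_3) : R := nth 0 [:: t1; t2; t3] i.
have Dt i : `[0, T]%classic (t i) by case: i => -[|[|[|//]]].
have := Zgauss c Dt.
rewrite (_ : (fun w => _) = (fun w => c1 * Z t1 w + c2 * Z t2 w + c3 * Z t3 w)); last first.
  by apply/funext => w; rewrite !big_ord_recl big_ord0 addr0 addrA.
have [i1 ii1 m1] := gauss1_integrable D1.
have [i2 ii2 m2] := gauss1_integrable D2.
have [i3 ii3 m3] := gauss1_integrable D3.
have iZ (b s : R) : P.-integrable setT (EFin \o Z s) -> P.-integrable setT (EFin \o (fun w => b * Z s w)).
  by move=> h; have := integrableZl measurableT b h.
have iA (f g : Omega -> R) : P.-integrable setT (EFin \o f) -> P.-integrable setT (EFin \o g) ->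
    P.-integrable setT (EFin \o (fun w => f w + g w)).
  by move=> h h'; have := integrableD measurableT h h'.
have mY : measurable_fun setT (fun w => c1 * Z t1 w + c2 * Z t2 w + c3 * Z t3 w).
  by apply: measurable_funD; [apply: measurable_funD|]; exact: measurable_funM.
move=> /(gaussian_law_moments mY)[_ _ g].
have mean0 : \int[P]_w (c1 * Z t1 w + c2 * Z t2 w + c3 * Z t3 w) = 0.
  rewrite RintegralD//; [|by apply: iA; exact: iZ|exact: iZ].
  rewrite RintegralD//; [|exact: iZ|exact: iZ].
  by rewrite !RintegralZl// m1 m2 m3 !mulr0 !addr0.
have {g mean0} g := g mean0.
have iM (b s u : R) : `[0, T]%classic s -> `[0, T]%classic u ->
   P.-integrable setT (EFin \o (fun w => b * (Z s w * Z u w))).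
  move=> Ds Du; have [_ is_ _] := gauss1_integrable Ds; have [_ iu _] := gauss1_integrable Du.
  by have := integrableZl measurableT b (integrable_mul_sqr (mZ s) (mZ u) is_ iu).
have iM1 (s u : R) : `[0, T]%classic s -> `[0, T]%classic u ->
   P.-integrable setT (EFin \o (fun w => Z s w * Z u w)).
  move=> Ds Du; have [_ is_ _] := gauss1_integrable Ds; have [_ iu _] := gauss1_integrable Du.
  exact: integrable_mul_sqr.
have := g; congr (gcf _ _ _).
transitivity (\int[P]_w (c1 ^+ 2 * (Z t1 w * Z t1 w) + (c2 ^+ 2 * (Z t2 w * Z t2 w) +
   (c3 ^+ 2 * (Z t3 w * Z t3 w) + (2 * c1 * c2 * (Z t1 w * Z t2 w) +
   (2 * c1 * c3 * (Z t1 w * Z t3 w) + 2 * c2 * c3 * (Z t2 w * Z t3 w))))))).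
  by apply: eq_Rintegral => w _; ring.
have j1 := iM (c1 ^+ 2) _ _ D1 D1; have j2 := iM (c2 ^+ 2) _ _ D2 D2.
have j3 := iM (c3 ^+ 2) _ _ D3 D3; have j4 := iM (2 * c1 * c2) _ _ D1 D2.
have j5 := iM (2 * c1 * c3) _ _ D1 D3; have j6 := iM (2 * c2 * c3) _ _ D2 D3.
have k5 := iA _ _ j5 j6; have k4 := iA _ _ j4 k5; have k3 := iA _ _ j3 k4.
have k2 := iA _ _ j2 k3.
rewrite (RintegralD measurableT j1 k2) (RintegralD measurableT j2 k3).
rewrite (RintegralD measurableT j3 k4) (RintegralD measurableT j4 k5).
rewrite (RintegralD measurableT j5 j6).
rewrite !RintegralZl//; do ?exact: iM1.
rewrite !cov_stationary// !subrr Gamma0 /q; by field.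
Qed.

Lemma q_ge0 (tau : R) : 0 <= tau <= T -> 0 <= q tau.
Proof.
move=> tauT.
have T0 : 0 <= T by case/andP: tauT => a b; exact: le_trans b.
have D0 : `[0, T]%classic 0 by rewrite /= in_itv/= lexx.
have Dt : `[0, T]%classic tau by rewrite /= in_itv/=.
have g := @gcf_comb3 1 (-1) 0 0 tau 0 D0 Dt D0.
have := gcf_ge0 _ g; rewrite subr0 => /(_ _) h.
suff : 0 <= (1 - 1 + 0) ^+ 2 / 2 - 2 * (1 * -1 * q tau + 1 * 0 * q (0 - 0) + -1 * 0 * q (0 - tau)).
  by lra.
apply: h; apply: measurable_funD; [apply: measurable_funD|]; exact: measurable_funM.
Qed.

End GaussianProcess.

Lemma cvg_ext (T : Type) (R : realType) (F : set_system T) (f g : T -> R) (l : R) :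
  f x @[x --> F] --> l -> f =1 g -> g x @[x --> F] --> l.
Proof. by move=> h /funext <-. Qed.

Lemma cvg_dnbhs_seq (R : realType) (f : R -> R) (p l : R) (D : set R) :
  (\forall x \near p, D x) ->
  (forall u : nat -> R, (forall n, u n != p) -> (forall n, D (u n)) ->
    u n @[n --> \oo] --> p -> f (u n) @[n --> \oo] --> l) ->
  f x @[x --> p^'] --> l.
Proof.
move=> nD h; apply/cvgr_dnbhsP => u [up ucvg].
have [N _ NP] : \forall n \near \oo, D (u n) by apply: ucvg.
rewrite -(cvg_shiftn N).
apply: (h (fun n => u (n + N)%N)) => //.
- by move=> n; apply: NP; exact: leq_addl.
- by rewrite (cvg_shiftn N).
Qed.

Lemma C1_seq (R : realType) (D : set R) (f : R -> R) (g : R) (t : R) (u : nat -> R) :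
  (f s - f t) / (s - t) @[s --> within D t^'] --> g ->
  (forall n, u n != t) -> (forall n, D (u n)) -> u n @[n --> \oo] --> t ->
  (f (u n) - f t) / (u n - t) @[n --> \oo] --> g.
Proof.
move=> fg ut Du uc.
apply: (cvg_comp _ (fun s => (f s - f t) / (s - t))) fg => A hA.
have h : \forall s \near t, s != t -> D s -> A s by exact: hA.
have h2 : \forall n \near \oo, (fun s => s != t -> D s -> A s) (u n) by exact: uc _ h.
suff : \forall n \near \oo, A (u n) by [].
by apply: filterS h2 => n; apply.
Qed.

(** * Second-order expansion of the covariance at 0 *)

Section Covariance.
Context (R : realType) (d : measure_display) (Omega : measurableType d)
  (P : probability Omega R) (T : R) (Z : R -> {RV P >-> R}).
Hypotheses (hT : 0 < T) (Zgauss : gaussian_process `[0, T] Z)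
    (Zcentered : centered_process `[0, T] Z)
    (Zstat : stationary_process `[0, T] Z)
    (ZC1 : forall w, C1_on `[0, T] (fun t => Z t w))
    (Gamma0 : cov_fun Z 0 = 2^-1).

Local Notation G := (cov_fun Z).
Let q (tau : R) : R := 2^-1 - G tau.
Let D : set R := `[0, T]%classic.

Let mZ t : measurable_fun setT (Z t : Omega -> R).
Proof. exact: measurable_funP. Qed.

Let D0 : D 0. Proof. by rewrite /D /= in_itv/= lexx ltW. Qed.

Let qN tau : q (- tau) = q tau.
Proof. by rewrite /q /cov_fun normrN. Qed.

Let qabs tau : q `|tau| = q tau.
Proof. by rewrite /q /cov_fun normr_id. Qed.

Let q0 : q 0 = 0.
Proof. by rewrite /q Gamma0 subrr. Qed.

Let comb3 c1 c2 c3 t1 t2 t3 := @gcf_comb3 R d Omega P T Z Zgauss Zcentered Zstat Gamma0 c1 c2 c3 t1 t2 t3.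

Let m3 (c1 c2 c3 t1 t2 t3 : R) :
  measurable_fun setT (fun w => c1 * Z t1 w + c2 * Z t2 w + c3 * Z t3 w).
Proof. by apply: measurable_funD; [apply: measurable_funD|]; exact: measurable_funM. Qed.

Let comb3_ge0 (c1 c2 c3 t1 t2 t3 : R) : D t1 -> D t2 -> D t3 ->
  0 <= (c1 + c2 + c3) ^+ 2 / 2 -
      2 * (c1 * c2 * q (t2 - t1) + c1 * c3 * q (t3 - t1) + c2 * c3 * q (t3 - t2)).
Proof. by move=> ? ? ?; exact: gcf_ge0 (m3 _ _ _ _ _ _) (comb3 _ _ _ _ _ _). Qed.

(** Cauchy-Schwarz for Z_0 and Z_s - Z_t, obtained from the nonnegative variance of 2 (q(s) - q(t))
    Z_0 + Z_s - Z_t; this coefficient of Z_0 minimizes the variance. *)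
Lemma q_lipschitz_sqrt (s t : R) : D s -> D t -> (q s - q t) ^+ 2 <= q (t - s).
Proof.
move=> Ds Dt; have := comb3_ge0 (2 * (q s - q t)) 1 (-1) D0 Ds Dt.
rewrite !subr0 !addrK; set a := q s; set b := q t; set c := q (t - s) => h; nra.
Qed.

(** Minkowski's inequality for n + 1 increments of equal variance. The induction step uses the
    variance of Z_0 - (1 + N) Z_(N tau) + N Z_((N+1) tau), whose coefficients sum to 0. *)
Lemma q_mulrn (n : nat) (tau : R) : 0 <= tau -> n.+1%:R * tau <= T ->
  q (n.+1%:R * tau) <= n.+1%:R ^+ 2 * q tau.
Proof.
move=> tau0; elim: n => [_|n IH nT]; first by rewrite mul1r expr1n mul1r.
have n0 : 0 < n.+1%:R :> R by [].
have e : n.+2%:R = n.+1%:R + 1 :> R by rewrite -natr1.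
have Dn : D (n.+1%:R * tau).
  rewrite /D /= in_itv/= mulr_ge0//= (le_trans _ nT)// e; nra.
have Dn1 : D (n.+2%:R * tau) by rewrite /D /= in_itv/= mulr_ge0.
have {}IH : q (n.+1%:R * tau) <= n.+1%:R ^+ 2 * q tau.
  by apply: IH; move: Dn; rewrite /D /= in_itv/= => /andP[].
have := comb3_ge0 1 (- (1 + n.+1%:R)) n.+1%:R D0 Dn Dn1.
rewrite !subr0.
rewrite (_ : n.+2%:R * tau - n.+1%:R * tau = tau); last by rewrite e; ring.
move: IH; rewrite e.
move: n0; set N : R := n.+1%:R; set a := q (N * tau); set b := q ((N + 1) * tau); set c := q tau.
move=> N0 IH h.
have {}h : N * b <= N * ((N + 1) ^+ 2 * c).
  have : (1 + N) * a <= (1 + N) * (N ^+ 2 * c) by rewrite ler_wpM2l//; lra.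
  have e0 : 1 + - (1 + N) + N = 0 by ring.
  move: h; rewrite e0; nra.
by rewrite -(ler_pM2l N0).
Qed.

Definition increment (t h : R) (w : Omega) : R := (Z (t + h) w - Z t w) / h.

Let mincr t h : measurable_fun setT (increment t h).
Proof. by apply: measurable_funM => //; exact: measurable_funB. Qed.

(** g is the pathwise derivative. Of its continuity only the part at 0 from the right is kept, which
    is what the second derivative of the covariance at 0 requires. *)
Lemma increment_deriv : exists g : R -> Omega -> R,
  [/\ forall t (u : nat -> R), D t -> (forall n, u n != 0) -> (forall n, D (t + u n)) ->
    u n @[n --> \oo] --> (0 : R) -> forall w, increment t (u n) w @[n --> \oo] --> g t w,
   forall t, D t -> measurable_fun setT (g t) &
   forall (u : nat -> R), (forall n, 0 < u n) -> u n @[n --> \oo] --> (0 : R) ->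
    forall w, g (u n) w @[n --> \oo] --> g 0 w].
Proof.
have /choice[g gP] : forall w, exists g : R -> R, {within D, continuous g} /\
    forall t, D t -> (Z s w - Z t w) / (s - t) @[s --> within D t^'] --> g t.
  by move=> w; have [g g1 g2] := ZC1 w; exists g.
have lim t (u : nat -> R) : D t -> (forall n, u n != 0) -> (forall n, D (t + u n)) ->
    u n @[n --> \oo] --> (0 : R) -> forall w, increment t (u n) w @[n --> \oo] --> g w t.
  move=> Dt u0 Du uc w; have [_ /(_ _ Dt) gt] := gP w.
  rewrite (_ : (fun n => increment t (u n) w) =
    (fun n => (Z (t + u n) w - Z t w) / (t + u n - t))); last first.
    by apply/funext => n; rewrite /increment [t + u n - t]addrAC subrr add0r.
  apply: (@C1_seq R D (Z ^~ w) (g w t) t (fun n => t + u n) gt) => //.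
    by move=> n; rewrite -subr_eq0 addrAC subrr add0r.
  by rewrite -[X in _ --> X]addr0; apply: cvgD => //; exact: cvg_cst.
exists (fun t w => g w t); split => //.
- move=> t Dt.
  (* A step of length at most T/2 in direction e stays inside [0, T], so g at t is a limit of
     measurable quotients also at the endpoints. *)
  pose e : R := if t <= T / 2 then 1 else -1.
  pose u n : R := e * (T / 2) * n.+1%:R^-1.
  have e0 : e != 0 by rewrite /e; case: ifP => _; rewrite ?oppr_eq0 oner_eq0.
  have n1 n : (0 : R) < (n.+1%:R^-1 : R) <= 1 by apply/andP; split; [rewrite invr_gt0|rewrite -[leRHS]invr1 lef_pV2 ?posrE// ler1n].
  have u0 n : u n != 0.
    apply: mulf_neq0; last by rewrite invr_eq0 pnatr_eq0.
    by apply: mulf_neq0 => //; rewrite gt_eqF// divr_gt0.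
  have Du n : D (t + u n).
    move: Dt; rewrite /D /= !in_itv/= /u /e => /andP[t0 tT]; have /andP[k0 k1] := n1 n.
    move: k0 k1; set k := n.+1%:R^-1 => k0 k1.
    case: ifPn => [tt|]; last rewrite -ltNge => tt; apply/andP; split; nra.
  apply: (@measurable_fun_cvg _ _ R _ (fun n => increment t (u n))).
    by move=> n; exact: mincr.
  move=> w _; apply: lim => //.
  rewrite -[X in _ --> X](mulr0 (e * (T / 2))); apply: cvgM; first exact: cvg_cst.
  exact: cvg_harmonic.
- move=> u u0 uc w; have [cg _] := gP w.
  move/continuous_within_itvP : cg => /(_ hT)[_ /cvg_at_rightP + _].
  exact.
Qed.

(** Only the last term is odd in e. It is 2 e times the covariance of the two quotients and contains
    the difference quotient of q at t, divided by t. *)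
Lemma q_comb_increment (t h : R) (e : R) : D t -> D (t + h) -> t != 0 -> h != 0 ->
  gcf P (fun w => increment 0 t w + e * increment t h w)
   (2 * (q t / t ^+ 2) + e ^+ 2 * (2 * (q h / h ^+ 2)) +
    2 * e * ((q (t + h) - q t - q h) / (t * h))).
Proof.
move=> Dt Dth t0 h0.
have := comb3 (- t^-1) (t^-1 - e / h) (e / h) D0 Dt Dth.
rewrite (_ : (fun w => _) = (fun w => increment 0 t w + e * increment t h w)); last first.
  apply/funext => w; rewrite /increment add0r; by field; rewrite t0 h0.
congr (gcf _ _ _).
rewrite !subr0 (_ : t + h - t = h); last by rewrite addrAC subrr add0r.
by rewrite /q; field; rewrite t0 h0.
Qed.

Lemma gcf_increment0 (t : R) : D t -> t != 0 -> gcf P (increment 0 t) (2 * (q t / t ^+ 2)).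
Proof.
move=> Dt t0.
have := comb3 (- t^-1) (t^-1) 0 D0 Dt D0.
rewrite (_ : (fun w => _) = increment 0 t); last first.
  by apply/funext => w; rewrite /increment add0r; field.
congr (gcf _ _ _).
rewrite !subr0 /q; by field.
Qed.

(* Pathwise limits of Gaussian variables are Gaussian with the limit variance:
   applied to the increments at 0 this gives [l2], and applied to their sum and
   difference with the derivative at t it gives, by polarization, the derivative
   of the covariance at t. *)
Lemma covariance_expansion : exists l2 : R,
  [/\ q h / h ^+ 2 @[h --> 0^'] --> l2 / 2,
      (G^`()^`())%classic 0 = - l2 &
      \forall h \near (0 : R), q h <= (l2 / 2 + 1) * h ^+ 2].
Proof.
have [g [gd mg gc]] := increment_deriv.
have nD0 : \forall x \near (0 : R), `|x| < T by exact: nbhs0_lt.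
have Dabs (x : R) : `|x| < T -> D `|x| by move=> xT; rewrite /D /= in_itv/= normr_ge0 ltW.
have ucabs (u : nat -> R) : u n @[n --> \oo] --> (0 : R) -> `|u n| @[n --> \oo] --> (0 : R).
  by move=> /cvg_norm h; rewrite normr0 in h; exact: h.
(* The limit v may seem to depend on the sequence, but it is always the variance of the same
   variable [g 0], so [gcf_unique] makes it unique. *)
have seql (u : nat -> R) : (forall n, u n != 0) -> (forall n, `|u n| < T) ->
    u n @[n --> \oo] --> (0 : R) ->
    exists2 v, 2 * (q (u n) / u n ^+ 2) @[n --> \oo] --> v & gcf P (g 0) v.
  move=> u0 uT uc.
  apply: (@gcf_cvg _ _ _ P (fun n => increment 0 `|u n|) (g 0)) => //.
  - by apply: gd => //; [by move=> n; rewrite normr_eq0|by move=> n; rewrite add0r; exact: Dabs|exact: ucabs].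
  - move=> n; have := @gcf_increment0 `|u n| (Dabs _ (uT n)).
    by rewrite normr_eq0 qabs real_normK ?num_real//; apply.
pose u1 n : R := T / 2 * n.+1%:R^-1.
have u1c : u1 n @[n --> \oo] --> (0 : R).
  rewrite -[X in _ --> X](mulr0 (T / 2)); apply: cvgM; first exact: cvg_cst.
  exact: cvg_harmonic.
have n1 n : (0 : R) < (n.+1%:R^-1 : R) <= 1 by apply/andP; split; [rewrite invr_gt0|rewrite -[leRHS]invr1 lef_pV2 ?posrE// ler1n].
have u1p n : 0 < u1 n.
  by rewrite /u1 mulr_gt0 ?divr_gt0//; have /andP[] := n1 n.
have u1T n : `|u1 n| < T.
  rewrite gtr0_norm//; have /andP[k0 k1] := n1 n.
  have h : u1 n <= T / 2 by rewrite /u1 ler_piMr// ltW// divr_gt0.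
  by apply: (le_lt_trans h); rewrite ltr_pdivrMr// ltr_pMr// ltr1n.
have [l2 _ gl2] := seql u1 (fun n => lt0r_neq0 (u1p n)) u1T u1c.
have ql : q h / h ^+ 2 @[h --> 0^'] --> l2 / 2.
  apply: (cvg_dnbhs_seq nD0) => u u0 uT uc.
  have [v vc gv] := seql u u0 uT uc.
  rewrite (gcf_unique gl2 gv).
  by apply: (cvg_ext (cvgM vc (cvg_cst (2^-1 : R)))) => n /=; field; exact: u0.
have qlu (u : nat -> R) : (forall n, u n != 0) -> u n @[n --> \oo] --> (0 : R) ->
    q (u n) / u n @[n --> \oo] --> (0 : R).
  move=> u0 uc.
  have qu : q (u n) / u n ^+ 2 @[n --> \oo] --> l2 / 2.
    by move/cvgr_dnbhsP : ql; apply; split.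
  rewrite -[X in _ --> X](mulr0 (l2 / 2)).
  by apply: (cvg_ext (cvgM qu uc)) => n /=; field; exact: u0.
(* (Vk.1 - Vk.2) / 4 is the covariance of the increment at 0 with the derivative at t. Multiplied by
   t it is the limit of the difference quotient of q at t, since the remaining term q(h) / h
   vanishes. *)
have qder (t : R) : 0 < t < T -> exists Vk : R * R,
    [/\ gcf P (fun w => increment 0 t w + 1 * g t w) Vk.1,
       gcf P (fun w => increment 0 t w + (-1) * g t w) Vk.2 &
      h^-1 * (q (h + t) - q t) @[h --> 0^'] --> t * ((Vk.1 - Vk.2) / 4)].
  move=> /andP[t0 tT].
  have Dt : D t by rewrite /D /= in_itv/= !ltW.
  pose E : set R := [set h | D (t + h)].
  have nE : \forall h \near (0 : R), E h.
    have : \forall h \near (0 : R), `|h| < Num.min t (T - t).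
      by apply: nbhs0_lt; rewrite lt_min t0 subr_gt0.
    apply: filterS => h; rewrite lt_min => /andP[h1 h2]; rewrite /E/= /D/= in_itv/=.
    move: h1 h2; rewrite !ltr_norml; lra.
  have seqV (e : R) (u : nat -> R) : (forall n, u n != 0) -> (forall n, E (u n)) ->
      u n @[n --> \oo] --> (0 : R) ->
      exists2 v, 2 * (q t / t ^+ 2) + e ^+ 2 * (2 * (q (u n) / u n ^+ 2)) +
        2 * e * ((q (t + u n) - q t - q (u n)) / (t * u n)) @[n --> \oo] --> v &
        gcf P (fun w => increment 0 t w + e * g t w) v.
    move=> u0 uE uc.
    apply: (@gcf_cvg _ _ _ P (fun n w => increment 0 t w + e * increment t (u n) w)).
    - by move=> n; apply: measurable_funD => //; exact: measurable_funM.
    - move=> w; apply: cvgD; first exact: cvg_cst.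
      by apply: cvgM; [exact: cvg_cst|exact: gd].
    - by move=> n; apply: (q_comb_increment e Dt (uE n)); [rewrite gt_eqF|exact: u0].
  have u1E : exists2 u : nat -> R, (forall n, u n != 0) /\ (forall n, E (u n)) & u n @[n --> \oo] --> (0 : R).
    pose m := Num.min t (T - t).
    have m0 : 0 < m by rewrite lt_min t0 subr_gt0.
    exists (fun n => m / 2 * n.+1%:R^-1).
      split=> n; have /andP[k0 k1] := n1 n; move: (n.+1%:R^-1) k0 k1 => k k0 k1.
        by rewrite gt_eqF// mulr_gt0// divr_gt0.
      have mt : m <= t by rewrite ge_min lexx.
      have mT : m <= T - t by rewrite ge_min lexx orbT.
      rewrite /E/= /D/= in_itv/=; apply/andP; split; nra.
    rewrite -[X in _ --> X](mulr0 (m / 2)); apply: cvgM; first exact: cvg_cst.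
    exact: cvg_harmonic.
  have [u [u0 uE] uc] := u1E.
  have [Vp _ gp] := seqV 1 u u0 uE uc.
  have [Vm _ gm] := seqV (-1) u u0 uE uc.
  exists (Vp, Vm); split => //=.
  apply: (cvg_dnbhs_seq nE) => {u u0 uE uc}u u0 uE uc.
  have [v1 c1 g1] := seqV 1 u u0 uE uc.
  have [v2 c2 g2] := seqV (-1) u u0 uE uc.
  rewrite (gcf_unique gp g1) (gcf_unique gm g2).
  rewrite (_ : t * ((v1 - v2) / 4) = t / 4 * (v1 - v2) + 0); last by field.
  apply: (cvg_ext (cvgD (cvgM (cvg_cst (t / 4 : R)) (cvgB c1 c2)) (qlu u u0 uc))) => n /=.
  rewrite !fctE (addrC (u n) t).
  have un0 := u0 n.
  have tn0 : t != 0 by rewrite gt_eqF.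
  by field; rewrite tn0 un0.
have qderN (t : R) : t != 0 -> `|t| < T -> exists Vk : R * R,
    [/\ gcf P (fun w => increment 0 `|t| w + 1 * g `|t| w) Vk.1,
       gcf P (fun w => increment 0 `|t| w + (-1) * g `|t| w) Vk.2 &
      h^-1 * (q (h + t) - q t) @[h --> 0^'] --> t * ((Vk.1 - Vk.2) / 4)].
  move=> t0 tT; have [|Vk [g1 g2 c]] := qder `|t|; first by rewrite normr_gt0 t0.
  exists Vk; split => //.
  have [tp|tn|te] := ltgtP 0 t; last by rewrite -te eqxx in t0.
    by move: c; rewrite gtr0_norm.
  move: c; rewrite ltr0_norm// => /cvgr_dnbhsP c.
  apply/cvgr_dnbhsP => u [u0 uc].
  have un : (forall n, - u n != 0) /\ - u n @[n --> \oo] --> (0 : R).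
    split; first by move=> n; rewrite oppr_eq0.
    by rewrite -[X in _ --> X]oppr0; exact: cvgN.
  have c' := c _ un.
  rewrite (_ : t * _ = - (- t * ((Vk.1 - Vk.2) / 4))); last by ring.
  apply: (cvg_ext (cvgN c')) => n /=.
  by rewrite -opprD !qN invrN mulNr opprK.
have G'E (t l : R) : h^-1 * (q (h + t) - q t) @[h --> 0^'] --> l -> (G^`())%classic t = - l.
  move=> c; apply: cvg_lim => //; apply: (cvg_ext (cvgN c)) => h /=.
  by rewrite /q /GRing.scale/=; ring.
have G'0 : (G^`())%classic 0 = 0.
  rewrite -[RHS]oppr0; apply: G'E; apply/cvgr_dnbhsP => u [u0 uc].
  apply: (cvg_ext (qlu u u0 uc)) => n.
  by rewrite addr0 q0 subr0 mulrC.
exists l2; split => //.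
- apply: cvg_lim => //.
  apply: (cvg_dnbhs_seq nD0) => u u0 uT uc.
  have /choice[Vk VkP] : forall n, exists Vk : R * R,
    [/\ gcf P (fun w => increment 0 `|u n| w + 1 * g `|u n| w) Vk.1,
       gcf P (fun w => increment 0 `|u n| w + (-1) * g `|u n| w) Vk.2 &
      h^-1 * (q (h + u n) - q (u n)) @[h --> 0^'] --> u n * ((Vk.1 - Vk.2) / 4)].
    by move=> n; exact: qderN.
  have up n : 0 < `|u n| by rewrite normr_gt0.
  have ic w : increment 0 `|u n| w @[n --> \oo] --> g 0 w.
    apply: gd => //; [by move=> n; rewrite normr_eq0|by move=> n; rewrite add0r; exact: Dabs|exact: ucabs].
  have icg (e : R) w : increment 0 `|u n| w + e * g `|u n| w @[n --> \oo] --> g 0 w + e * g 0 w.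
    apply: cvgD => //; apply: cvgM; first exact: cvg_cst.
    by apply: gc => //; exact: ucabs.
  have micg (e : R) n : measurable_fun setT (fun w => increment 0 `|u n| w + e * g `|u n| w).
    by apply: measurable_funD => //; apply: measurable_funM => //; apply: mg; exact: Dabs.
  have Vk1 n : gcf P (fun w => increment 0 `|u n| w + 1 * g `|u n| w) (Vk n).1 by have [] := VkP n.
  have Vk2 n : gcf P (fun w => increment 0 `|u n| w + (-1) * g `|u n| w) (Vk n).2 by have [] := VkP n.
  have [v1 c1 g1] := gcf_cvg (micg 1) (icg 1) Vk1.
  have [v2 c2 g2] := gcf_cvg (micg (-1)) (icg (-1)) Vk2.
  (* As the time tends to 0 the sum of the two variables tends to 2 [g 0] and the difference to 0,
     so (v1 - v2) / 4 = l2. *)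
  have e1 : v1 = 2 ^+ 2 * l2.
    apply: (gcf_unique g1); have := gcf_scale 2 gl2.
    by congr (gcf _ _ _); apply/funext => w; ring.
  have e2 : v2 = 0 ^+ 2 * l2.
    apply: (gcf_unique g2); have := gcf_scale 0 gl2.
    by congr (gcf _ _ _); apply/funext => w; ring.
  rewrite (_ : - l2 = - ((v1 - v2) / 4)); last by rewrite e1 e2; field.
  apply: (cvg_ext (cvgN (cvgM (cvgB c1 c2) (cvg_cst (4^-1 : R))))) => n.
  have [_ _ /G'E dn] := VkP n.
  rewrite addr0 G'0 subr0 dn /GRing.scale/= mulrN mulKf; last exact: u0.
  by [].
- have : \forall h \near 0^', q h / h ^+ 2 < l2 / 2 + 1.
    by apply: (cvgr_lt _ ql); rewrite ltrDl.
  move=> h1; have {h1} : \forall h \near (0 : R), h != 0 -> q h / h ^+ 2 < l2 / 2 + 1 by exact: h1.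
  apply: filterS => h hh; have [->|h0] := eqVneq h 0.
    by rewrite q0 expr0n/= mulr0.
  by rewrite -ler_pdivrMr ?exprn_even_gt0// ltW// hh.
Qed.

End Covariance.

(** * Gaussian tails and the crossing integral *)

Section GaussianBounds.
Context {R : realType}.
Notation mu := (@lebesgue_measure R).

Lemma normal_pdf0E (s x : R) : 0 < s ->
  normal_pdf 0 s x = (s * Num.sqrt (2 * pi))^-1 * expR (- (x ^+ 2 / (2 * s ^+ 2))).
Proof.
move=> s0; rewrite normal_pdfE ?gt_eqF// /normal_peak /normal_fun subr0.
congr (_^-1 * expR _); last by rewrite mulNr -[s ^+ 2 *+ 2]mulr_natl.
rewrite -mulrnAr sqrtrM ?sqr_ge0// sqrtr_sqr gtr0_norm//.
by rewrite -[pi *+ 2]mulr_natl.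
Qed.

Lemma normal_pdf0_shift (s x y : R) : 0 < s ->
  normal_pdf 0 s (x + y) = normal_pdf 0 s x * expR (- ((x * y + y ^+ 2 / 2) / s ^+ 2)).
Proof.
move=> s0; rewrite !normal_pdf0E// -[RHS]mulrA -expRD; congr (_ * expR _).
by field; rewrite gt_eqF.
Qed.

Lemma integral_linear_gauss (b a : R) : 0 < b -> 0 <= a ->
  (\int[mu]_(x in `[a, +oo[) (x * expR (- (b * x ^+ 2 / 2)))%:E =
  (expR (- (b * a ^+ 2 / 2)) / b)%:E)%E.
Proof.
move=> b0 a0.
pose F x : R := - expR (- (b * x ^+ 2 / 2)) / b.
have dF (x : R) : is_derive x (1 : R) F (x * expR (- (b * x ^+ 2 / 2))).
  pose h (x : R) : R := - (b * x ^+ 2 / 2).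
  have hd : is_derive x (1 : R) h (- (b * x)).
    rewrite (_ : h = fun x => (- (b / 2)) *: (x ^+ 2)); last first.
      by apply/funext => y; rewrite /h /GRing.scale/=; ring.
    apply: is_derive_eq; rewrite /GRing.scale/= -[1 *+ 2]/(2) ; by field.
  have := @is_derive1_comp R expR h x (expR (h x)) (- (b * x)) (is_derive_expR _) hd.
  move=> hd'; rewrite (_ : F = fun x => (- b^-1) *: (expR \o h) x); last first.
    by apply/funext => y; rewrite /F /h /GRing.scale/= mulNr mulrC mulNr.
  apply: is_derive_eq; rewrite /GRing.scale/= /h; field; by rewrite gt_eqF.
have cF : continuous F.
  by move=> x; apply: differentiable_continuous; apply/derivable1_diffP; case: (dF x).
rewrite (@ge0_continuous_FTC2y _ _ F _ 0).
- by rewrite /F mulNr EFinN sub0e oppeK.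
- by move=> x ax; rewrite mulr_ge0 ?expR_ge0// (le_trans a0).
- apply: continuous_subspaceT => x.
  apply: cvgM; first exact: cvg_id.
  apply: continuous_comp; last exact: continuous_expR.
  apply: cvgN; apply: cvgM; last exact: cvg_cst.
  by apply: cvgM; [exact: cvg_cst|exact: exprn_continuous].
- rewrite -(mul0r (b^-1)) -oppr0; apply: cvgM; last exact: cvg_cst.
  apply: cvgN; apply: (@cvg_comp _ _ _ (fun x : R => b * x ^+ 2 / 2) (fun y : R => expR (- y)) _ +oo); last exact: cvgr_expR.
  apply/cvgryPge => A; near=> x.
  have x1 : 1 <= x by near: x; exact: nbhs_pinfty_ge.
  have xA : 2 * A / b <= x by near: x; apply: nbhs_pinfty_ge; exact: num_real.
  rewrite ler_pdivlMr// mulrC; apply: le_trans (_ : b * x <= _).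
    by move: xA; rewrite ler_pdivrMr// [x * b]mulrC.
  apply: ler_wpM2l; first exact: ltW.
  by rewrite expr2 ler_peMl// (le_trans _ x1).
- by move=> x _; case: (dF x).
- by apply: cvg_at_right_filter; exact: cF.
- by move=> x _; rewrite derive1E; case: (dF x).
Unshelve. all: by end_near.
Qed.

(** Mills' bound: inserting the factor x/u, at least 1 for x > u, makes the integrand an exact
    derivative. *)
Lemma normal_tail (s u : R) : 0 < s -> 0 < u ->
  (normal_prob 0 s `]u, +oo[ <= (s ^+ 2 / u * normal_pdf 0 s u)%:E)%E.
Proof.
move=> s0 u0.
have b0 : 0 < s ^- 2 by rewrite invr_gt0 exprn_gt0.
pose K := (s * Num.sqrt (2 * pi))^-1.
have K0 : 0 <= K by rewrite invr_ge0 mulr_ge0 ?sqrtr_ge0// ltW.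
have key (x E : R) : u < x -> 0 <= E -> K * E <= K / u * (x * E).
  move=> ux E0; rewrite mulrA; apply: ler_wpM2r => //.
  by rewrite -mulrA ler_peMr// mulrC ler_pdivlMr// mul1r ltW.
have mlin : measurable_fun setT (fun x : R => (K / u * (x * expR (- (s ^- 2 * x ^+ 2 / 2))))%:E).
  apply/measurable_EFinP; apply: measurable_funM => //; apply: measurable_funM => //.
  apply: measurableT_comp => //.
  by apply: measurable_funN => //; apply: measurable_funM => //; exact: measurable_funM.
apply: (@le_trans _ _ (\int[mu]_(x in `[u, +oo[) (K / u * (x * expR (- (s ^- 2 * x ^+ 2 / 2))))%:E)%E); last first.
  under eq_integral do rewrite EFinM.
  rewrite ge0_integralZl//=.
  - rewrite (@integral_linear_gauss (s ^- 2) u b0 (ltW u0)) -EFinM lee_fin normal_pdf0E// -/K le_eqVlt; apply/orP; left; apply/eqP.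
    have -> : s ^- 2 * u ^+ 2 / 2 = u ^+ 2 / (2 * s ^+ 2) by field; rewrite gt_eqF.
    by field; rewrite ?gt_eqF.
  - apply/measurable_EFinP; apply: measurable_funM => //; apply: measurableT_comp => //.
    apply: measurable_funN => //; apply: measurable_funM => //; exact: measurable_funM.
  - by move=> x /=; rewrite in_itv/= andbT => ux; rewrite lee_fin mulr_ge0 ?expR_ge0// (le_trans _ ux)// ltW.
  - by rewrite lee_fin divr_ge0// ltW.
rewrite -integral_itv_obnd_cbnd; last first.
  exact: measurable_funS mlin.
rewrite /normal_prob; apply: ge0_le_integral => //=.
- by move=> x _; rewrite lee_fin normal_pdf_ge0.
- by apply/measurable_EFinP; apply: measurable_funTS; exact: measurable_normal_pdf.
- exact: measurable_funS mlin.
- move=> x; rewrite in_itv/= andbT => ux; rewrite lee_fin normal_pdf0E// -/K.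
  have -> : x ^+ 2 / (2 * s ^+ 2) = s ^- 2 * x ^+ 2 / 2 by field; rewrite gt_eqF.
  by apply: key => //; exact: expR_ge0.
Qed.

(** Completing the square moves the mean of the density to a s^2. *)
Lemma normal_mgf (s a : R) : 0 < s ->
  (\int[normal_prob 0 s]_x (expR (a * x))%:E = (expR (a ^+ 2 * s ^+ 2 / 2))%:E)%E.
Proof.
move=> s0; rewrite ge0_integral_normal_prob//; last first.
  by apply/measurable_EFinP; apply: measurableT_comp => //; exact: measurable_funM.
transitivity (\int[mu]_x ((expR (a ^+ 2 * s ^+ 2 / 2))%:E * (normal_pdf (a * s ^+ 2) s x)%:E))%E.
  apply: eq_integral => x _; rewrite -!EFinM; congr EFin.
  rewrite !normal_pdfE ?gt_eqF// /normal_fun mulrCA [RHS]mulrCA -!expRD.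
  congr (_ * expR _); field; by rewrite gt_eqF.
rewrite ge0_integralZl//=.
- by rewrite integral_normal_pdf mule1.
- by apply/measurable_EFinP; exact: measurable_normal_pdf.
- by move=> x _; rewrite lee_fin normal_pdf_ge0.
Qed.

Lemma normal_chernoff (s a y : R) : 0 < s -> 0 <= a ->
  (normal_prob 0 s `]y, +oo[ <= (expR (- (a * y) + a ^+ 2 * s ^+ 2 / 2))%:E)%E.
Proof.
move=> s0 a0; rewrite expRD EFinM -(@normal_mgf s a s0).
have mE : measurable_fun setT (fun x : R => (expR (a * x))%:E).
  apply/measurable_EFinP; apply: measurableT_comp => //; exact: measurable_funM.
rewrite -ge0_integralZl//=.
rewrite -[X in normal_prob 0 s X](@setIT R) -integral_indic//=.
apply: ge0_le_integral => //=.
- by apply/measurable_EFinP.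
- by apply: emeasurable_funM => //.
- move=> x _; rewrite -EFinM lee_fin -expRD indicE; case: (boolP (x \in _)) => [|_]; last by rewrite expR_ge0.
  by rewrite inE/= in_itv/= andbT => yx /=; rewrite -expR0 ler_expR addrC -mulrBr mulr_ge0// subr_ge0 ltW.
Qed.

Let lebesgue_itv_cst (a b K : R) : a <= b ->
  (\int[mu]_(x in `]a, b]) K%:E = ((b - a) * K)%:E)%E.
Proof.
move=> ab; rewrite integral_cst//= lebesgue_measure_itv/= lte_fin.
move: ab; rewrite le_eqVlt => /predU1P[->|ab]; first by rewrite ltxx mule0 subrr mul0r.
by rewrite ab -EFinD -EFinM mulrC.
Qed.

Lemma normal_itv_ge (s a b K : R) : 0 <= K -> a <= b ->
  (forall x, a < x <= b -> K <= normal_pdf 0 s x) ->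
  (((b - a) * K)%:E <= normal_prob 0 s `]a, b])%E.
Proof.
move=> K0 ab H; rewrite -lebesgue_itv_cst// /normal_prob; apply: ge0_le_integral => //=.
- by apply/measurable_EFinP; apply: measurable_funTS; exact: measurable_normal_pdf.
Qed.

Lemma normal_itv_le (s a b K : R) : a <= b ->
  (forall x, a < x <= b -> normal_pdf 0 s x <= K) ->
  (normal_prob 0 s `]a, b] <= ((b - a) * K)%:E)%E.
Proof.
move=> ab H; rewrite -lebesgue_itv_cst// /normal_prob; apply: ge0_le_integral => //=.
- by move=> x _; rewrite lee_fin normal_pdf_ge0.
- by apply/measurable_EFinP; apply: measurable_funTS; exact: measurable_normal_pdf.
Qed.
End GaussianBounds.

(** * Two-sided bounds for the crossing integral *)

Section CrossingIntegral.
Context {R : realType}.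
Notation mu := (@lebesgue_measure R).
Variables (S c u eta : R).
Hypotheses (S0 : 0 < S) (c0 : 0 < c) (u0 : 0 < u) (eta0 : 0 < eta).
(** The decay rate at u, minus the logarithmic derivative, of the N(0, c^2) density. *)
Let k : R := u / c ^+ 2.
Let f (h : R) : \bar R := normal_prob 0 c `]u - h, u + h].
Hypothesis mf : measurable_fun setT f.

Let k0 : 0 < k. Proof. by rewrite divr_gt0// exprn_gt0. Qed.

(** Young's inequality: the exponent k h costs a constant factor exp(eta) and a quadratic term that
    merges with the Gaussian weight of h, so the integrals can be computed in closed form. *)
Let linear_exp_le (h : R) : k * h <= eta + k ^+ 2 * h ^+ 2 / (4 * eta).
Proof.
rewrite -subr_ge0 (_ : _ - _ = (2 * eta - k * h) ^+ 2 / (4 * eta)).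
  by rewrite divr_ge0 ?sqr_ge0// mulr_ge0// ltW.
by field; rewrite gt_eqF.
Qed.

Let pdf_shift (h y : R) : - h < y <= h ->
  normal_pdf 0 c u * expR (- (k * h) - h ^+ 2 / (2 * c ^+ 2)) <= normal_pdf 0 c (u + y)
  <= normal_pdf 0 c u * expR (k * h).
Proof.
move=> /andP[h1 h2]; rewrite normal_pdf0_shift//.
have c2 : 0 < c ^- 2 by rewrite invr_gt0 exprn_gt0.
have hh : y ^+ 2 <= h ^+ 2.
  have : 0 <= (h - y) * (h + y) by rewrite mulr_ge0//; lra.
  nra.
have -> : (u * y + y ^+ 2 / 2) / c ^+ 2 = k * y + y ^+ 2 / 2 * c ^- 2 by rewrite /k; field; rewrite gt_eqF.
have -> : h ^+ 2 / (2 * c ^+ 2) = h ^+ 2 / 2 * c ^- 2 by field; rewrite gt_eqF.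
have e0 : y ^+ 2 / 2 * c ^- 2 <= h ^+ 2 / 2 * c ^- 2.
  by apply: ler_wpM2r; [exact: ltW|lra].
have e1 : 0 <= y ^+ 2 / 2 * c ^- 2 by apply: mulr_ge0; [rewrite divr_ge0// sqr_ge0|exact: ltW].
have e2 : k * y <= k * h by rewrite ler_pM2l.
have e3 : - (k * h) <= k * y by rewrite -mulrN ler_pM2l// ltW.
by rewrite !ler_wpM2l ?normal_pdf_ge0// ler_expR; lra.
Qed.

Let f_le0 h : h <= 0 -> f h = 0%E.
Proof.
move=> h0; rewrite /f set_itv_ge ?measure0//= bnd_simp -leNgt; lra.
Qed.

Let f_bounds h : 0 < h ->
  ((2 * h * (normal_pdf 0 c u * expR (- (k * h) - h ^+ 2 / (2 * c ^+ 2))))%:E <= f h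
  <= (2 * h * (normal_pdf 0 c u * expR (k * h)))%:E)%E.
Proof.
move=> h0; have uh : u - h <= u + h by lra.
have e : 2 * h = u + h - (u - h) by ring.
have sh x : u - h < x <= u + h -> exists2 y, - h < y <= h & x = u + y.
  by move=> /andP[h1 h2]; exists (x - u); [apply/andP; split; lra|rewrite addrC subrK].
rewrite e; apply/andP; split.
  apply: normal_itv_ge => //; first by rewrite mulr_ge0 ?normal_pdf_ge0// expR_ge0.
  by move=> x /sh[y /pdf_shift /andP[hy _] ->].
by apply: normal_itv_le => // x /sh[y /pdf_shift /andP[_ hy] ->].
Qed.

Let K : R := (S * Num.sqrt (2 * pi))^-1.
Let K0 : 0 < K. Proof. by rewrite invr_gt0 mulr_gt0// sqrtr_gt0 mulr_gt0// pi_gt0. Qed.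

Let integral_lin (A b : R) : 0 <= A -> 0 < b ->
  (\int[mu]_h (A * (h * expR (- (b * h ^+ 2 / 2))) * \1_`[0, +oo[%classic h)%:E = (A / b)%:E)%E.
Proof.
move=> A0 b0; rewrite integral_mul_indic.
under eq_integral do rewrite EFinM.
rewrite ge0_integralZl//=.
- by rewrite integral_linear_gauss// expr0n/= mulr0 mul0r oppr0 expR0 -EFinM mul1r.
- apply/measurable_EFinP; apply: measurable_funTS; apply: measurable_funM => //.
  apply: measurableT_comp => //; apply: measurable_funN => //.
  by apply: measurable_funM => //; exact: measurable_funM.
- by move=> x /=; rewrite in_itv/= andbT => ux; rewrite lee_fin mulr_ge0 ?expR_ge0.
Qed.

Let measurable_lin (A b : R) :
  measurable_fun setT (fun h : R => (A * (h * expR (- (b * h ^+ 2 / 2))) * \1_`[0, +oo[%classic h)%:E).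
Proof.
apply/measurable_EFinP; apply: measurable_funM; last exact: measurable_indic.
apply: measurable_funM => //; apply: measurable_funM => //.
apply: measurableT_comp => //; apply: measurable_funN => //.
by apply: measurable_funM => //; exact: measurable_funM.
Qed.

(** The main term is 2 p(u) E(H^+) = 2 p(u) S / sqrt(2 pi) for H of law N(0, S^2) and p the N(0,
    c^2) density. The hypothesis keeps the merged quadratic exponent b positive. *)
Lemma crossing_integral_le : S ^+ 2 * k ^+ 2 < 2 * eta ->
  (\int[normal_prob 0 S]_h f h <=
   (2 * normal_pdf 0 c u * expR eta * (S / Num.sqrt (2 * pi)) /
     (1 - S ^+ 2 * k ^+ 2 / (2 * eta)))%:E)%E.
Proof.
move=> Sk; rewrite ge0_integral_normal_prob//.
pose A := 2 * normal_pdf 0 c u * expR eta * K.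
pose b := S ^- 2 - k ^+ 2 / (2 * eta).
have A0 : 0 <= A.
  by rewrite mulr_ge0// ?(ltW K0)// mulr_ge0 ?expR_ge0// mulr_ge0// normal_pdf_ge0.
have S2 : 0 < S ^+ 2 by rewrite exprn_gt0.
have bE : b = (1 - S ^+ 2 * k ^+ 2 / (2 * eta)) / S ^+ 2 by rewrite /b; field; rewrite !gt_eqF.
have b0 : 0 < b.
  by rewrite bE divr_gt0// subr_gt0 ltr_pdivrMr ?mul1r// mulr_gt0.
have -> : 2 * normal_pdf 0 c u * expR eta * (S / Num.sqrt (2 * pi)) /
     (1 - S ^+ 2 * k ^+ 2 / (2 * eta)) = A / b.
  have : 1 - S ^+ 2 * k ^+ 2 / (2 * eta) != 0 by rewrite gt_eqF// subr_gt0 ltr_pdivrMr ?mul1r// mulr_gt0.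
  have : Num.sqrt (2 * pi) != 0 :> R by rewrite gt_eqF// sqrtr_gt0 mulr_gt0// pi_gt0.
  rewrite bE /A /K; move: (1 - _) (Num.sqrt _) => x y y0 x0; field.
  by rewrite x0 y0 gt_eqF.
rewrite -(integral_lin A0 b0); apply: ge0_le_integral => //=.
- by move=> h _; rewrite mule_ge0// lee_fin normal_pdf_ge0.
- by apply: emeasurable_funM => //; apply/measurable_EFinP; exact: measurable_normal_pdf.
- exact: measurable_lin.
move=> h _; have [h0|h0] := leP h 0.
  rewrite f_le0// mul0e lee_fin indicE; case: (boolP (h \in _)) => [|_]; last by rewrite mulr0.
  rewrite inE/= in_itv/= andbT => h1; have -> : h = 0 by apply/eqP; rewrite eq_le h0 h1.
  by rewrite mul0r mulr0 mul0r.
rewrite indicE mem_set/= ?in_itv/= ?andbT ?(ltW h0)// mulr1.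
have /andP[_ fh] := f_bounds h0.
apply: (le_trans (lee_wpmul2r _ fh)); first by rewrite lee_fin normal_pdf_ge0.
rewrite -EFinM lee_fin (normal_pdf0E h S0) -/K.
have -> : - (b * h ^+ 2 / 2) = k ^+ 2 * h ^+ 2 / (4 * eta) + (- (h ^+ 2 / (2 * S ^+ 2))).
  by rewrite /b; field; rewrite !gt_eqF.
rewrite expRD /A.
have -> : 2 * normal_pdf 0 c u * expR eta * K * (h * (expR (k ^+ 2 * h ^+ 2 / (4 * eta)) * expR (- (h ^+ 2 / (2 * S ^+ 2)))))
  = 2 * h * (normal_pdf 0 c u * expR (eta + k ^+ 2 * h ^+ 2 / (4 * eta))) * (K * expR (- (h ^+ 2 / (2 * S ^+ 2)))).
  by rewrite expRD; ring.
apply: ler_wpM2r; first by rewrite mulr_ge0 ?expR_ge0 ?ltW.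
apply: ler_wpM2l; first by rewrite mulr_ge0 ?ltW.
by apply: ler_wpM2l; [exact: normal_pdf_ge0|rewrite ler_expR].
Qed.

Lemma crossing_integral_ge :
  ((2 * normal_pdf 0 c u * expR (- eta) * (S / Num.sqrt (2 * pi)) /
     (1 + S ^+ 2 * (k ^+ 2 / (2 * eta) + c ^- 2)))%:E <=
   \int[normal_prob 0 S]_h f h)%E.
Proof.
rewrite ge0_integral_normal_prob//.
pose A := 2 * normal_pdf 0 c u * expR (- eta) * K.
(* The extra c^-2 comes from the quadratic term in the shifted density, which the upper bound could
   simply drop. *)
pose b := S ^- 2 + k ^+ 2 / (2 * eta) + c ^- 2.
have A0 : 0 <= A.
  by rewrite mulr_ge0// ?(ltW K0)// mulr_ge0 ?expR_ge0// mulr_ge0// normal_pdf_ge0.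
have S2 : 0 < S ^+ 2 by rewrite exprn_gt0.
have bE : b = (1 + S ^+ 2 * (k ^+ 2 / (2 * eta) + c ^- 2)) / S ^+ 2 by rewrite /b; field; rewrite !gt_eqF.
have b1 : 0 < 1 + S ^+ 2 * (k ^+ 2 / (2 * eta) + c ^- 2).
  rewrite addr_gt0// mulr_gt0// addr_gt0 ?invr_gt0 ?exprn_gt0//.
  by rewrite divr_gt0 ?exprn_gt0// mulr_gt0.
have b0 : 0 < b by rewrite bE divr_gt0.
have -> : 2 * normal_pdf 0 c u * expR (- eta) * (S / Num.sqrt (2 * pi)) /
     (1 + S ^+ 2 * (k ^+ 2 / (2 * eta) + c ^- 2)) = A / b.
  have : 1 + S ^+ 2 * (k ^+ 2 / (2 * eta) + c ^- 2) != 0 by rewrite gt_eqF.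
  have : Num.sqrt (2 * pi) != 0 :> R by rewrite gt_eqF// sqrtr_gt0 mulr_gt0// pi_gt0.
  rewrite bE /A /K; move: (1 + _) (Num.sqrt _) => x y y0 x0; field.
  by rewrite x0 y0 gt_eqF.
rewrite -(integral_lin A0 b0); apply: ge0_le_integral => //=.
- move=> h _; rewrite lee_fin indicE; case: (boolP (h \in _)) => [|_]; last by rewrite mulr0.
  by rewrite inE/= in_itv/= andbT => h1; rewrite mulr1 mulr_ge0// mulr_ge0// expR_ge0.
- exact: measurable_lin.
- by apply: emeasurable_funM => //; apply/measurable_EFinP; exact: measurable_normal_pdf.
move=> h _; have [h0|h0] := leP h 0.
  rewrite f_le0// mul0e lee_fin indicE; case: (boolP (h \in _)) => [|_]; last by rewrite mulr0.
  rewrite inE/= in_itv/= andbT => h1; have -> : h = 0 by apply/eqP; rewrite eq_le h0 h1.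
  by rewrite mul0r mulr0 mul0r.
rewrite indicE mem_set/= ?in_itv/= ?andbT ?(ltW h0)// mulr1.
have /andP[fh _] := f_bounds h0.
apply: le_trans (lee_wpmul2r _ fh); last by rewrite lee_fin normal_pdf_ge0.
rewrite -EFinM lee_fin (normal_pdf0E h S0) -/K.
have -> : - (b * h ^+ 2 / 2) = - (k ^+ 2 * h ^+ 2 / (4 * eta)) + (- (h ^+ 2 / (2 * c ^+ 2))) + (- (h ^+ 2 / (2 * S ^+ 2))).
  by rewrite /b; field; rewrite !gt_eqF.
set a1 := k ^+ 2 * h ^+ 2 / (4 * eta); set a2 := h ^+ 2 / (2 * c ^+ 2).
rewrite expRD /A.
have -> : 2 * normal_pdf 0 c u * expR (- eta) * K * (h * (expR (- a1 + - a2) * expR (- (h ^+ 2 / (2 * S ^+ 2)))))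
  = 2 * h * (normal_pdf 0 c u * expR (- eta + (- a1 + - a2))) * (K * expR (- (h ^+ 2 / (2 * S ^+ 2)))).
  by rewrite [expR (- eta + _)]expRD; ring.
apply: ler_wpM2r; first by rewrite mulr_ge0 ?expR_ge0 ?ltW.
apply: ler_wpM2l; first by rewrite mulr_ge0 ?ltW.
apply: ler_wpM2l; first exact: normal_pdf_ge0.
by rewrite ler_expR addrA lerD2r -opprD lerN2 linear_exp_le.
Qed.
End CrossingIntegral.

Lemma clamp_lipschitz (R : realDomainType) (a b x y : R) :
  `|Num.max a (Num.min x b) - Num.max a (Num.min y b)| <= `|x - y|.
Proof.
have := ler_norm (x - y); have := ler_norm (y - x); rewrite (distrC y x) => h1 h2.
have n0 := normr_ge0 (x - y).
rewrite ler_norml; case: (leP x b) => ?; case: (leP y b) => ?;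
  repeat match goal with |- context [Num.max a ?z] => case: (leP a z) => ? end;
  by apply/andP; split; lra.
Qed.

(** * Quadratic lower bound for 1/2 - Gamma *)

Section CovarianceBound.
Context (R : realType) (d : measure_display) (Omega : measurableType d)
  (P : probability Omega R) (T : R) (Z : R -> {RV P >-> R}).
Hypotheses (hT : 0 < T) (Zgauss : gaussian_process `[0, T] Z)
    (Zcentered : centered_process `[0, T] Z)
    (Zstat : stationary_process `[0, T] Z)
    (ZC1 : forall w, C1_on `[0, T] (fun t => Z t w))
    (Gamma0 : cov_fun Z 0 = 2^-1)
    (Gamma_neq : forall tau, 0 < tau <= T -> cov_fun Z tau != 2^-1).

Let q (tau : R) : R := 2^-1 - cov_fun Z tau.

Let q_gt0 tau : 0 < tau <= T -> 0 < q tau.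
Proof.
move=> h; rewrite lt_neqAle (q_ge0 Zgauss Zcentered Zstat Gamma0)//; last first.
  by have /andP[/ltW -> ->] := h.
by rewrite eq_sym subr_eq0 eq_sym Gamma_neq.
Qed.

Let qN tau : q (- tau) = q tau.
Proof. by rewrite /q /cov_fun normrN. Qed.

(** A positive continuous function on a compact interval. Continuity holds because
    [q_lipschitz_sqrt] bounds an increment of q by the square root of q near 0, which is O(h). *)
Let q_min : exists2 m, 0 < m & forall tau, T / 2 <= tau <= T -> m <= q tau.
Proof.
have [l2 [_ _ qub]] := covariance_expansion hT Zgauss Zcentered Zstat ZC1 Gamma0.
pose cl (x : R) := Num.max (T / 2) (Num.min x T).
have T2 : T / 2 <= T by rewrite ler_pdivrMr// ler_peMr ?ler1n// ltW.
have clD x : T / 2 <= cl x <= T by rewrite /cl le_max lexx/= ge_max T2 ge_min lexx orbT.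
have clid x : T / 2 <= x <= T -> cl x = x.
  by move=> /andP[x1 x2]; rewrite /cl (min_idPl x2) (max_idPr x1).
have [r r0 rP] : exists2 r : R, 0 < r & forall h : R, `|h| < r -> q h <= (l2 / 2 + 1) * h ^+ 2.
  have [r /= r0 rP] := qub; exists r => // h hr.
  by apply: rP; rewrite /ball_/= sub0r normrN.
(* K is at least 1, so that |l2 / 2 + 1| <= K <= K^2 and the bound becomes a square. *)
pose K := `|l2 / 2 + 1| + 1.
have K1 : 1 <= K by rewrite lerDr.
have K0 : 0 < K by rewrite (lt_le_trans ltr01).
have qK h : `|h| < r -> q h <= (K * h) ^+ 2.
  move=> hr; have h1 := rP h hr; apply: (le_trans h1).
  rewrite exprMn ler_wpM2r ?sqr_ge0// (le_trans (ler_norm _))// (@le_trans _ _ K) ?lerDl//.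
  by rewrite expr2 ler_peMl// ltW.
have clD0 x : `[0, T]%classic (cl x).
  have /andP[c1 c2] := clD x; by rewrite /= in_itv/= c2 andbT (le_trans _ c1)// divr_ge0// ltW.
(* Clamping makes q continuous on the whole line. *)
have cf : continuous (q \o cl).
  move=> x; apply/cvgrPdist_lt => e e0.
  have re0 : 0 < Num.min r (e / K) by rewrite lt_min r0 divr_gt0.
  apply: (@filterS _ _ _ (fun y => `|x - y| < Num.min r (e / K))); last by apply/nbhs_ballP; exists (Num.min r (e / K)).
  move=> y xy0 /=.
  have h1 := q_lipschitz_sqrt hT Zgauss Zcentered Zstat Gamma0 (clD0 x) (clD0 y).
  have xy : `|cl y - cl x| < Num.min r (e / K) by apply: (le_lt_trans (clamp_lipschitz _ _ _ _)); rewrite distrC.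
  move: xy; rewrite lt_min => /andP[/qK h2]; rewrite ltr_pdivlMr// => h3.
  rewrite -(ltr_pXn2r (n := 2))// ?nnegrE// ?ltW// real_normK ?num_real//.
  apply: (le_lt_trans h1); apply: (le_lt_trans h2).
  rewrite -[X in X < _]real_normK ?num_real//.
  rewrite ltr_pXn2r ?nnegrE// ?ltW//.
  by rewrite normrM gtr0_norm// mulrC.
have [c c_itv cmin] := EVT_min T2 (continuous_subspaceT cf).
move: c_itv; rewrite in_itv/= => c_itv.
exists (q c).
  by apply: q_gt0; move: c_itv => /andP[h1 ->]; rewrite andbT (lt_le_trans _ h1)// divr_gt0.
move=> tau htau; have /= := cmin tau; rewrite !clid// in_itv/=; exact.
Qed.

Lemma covariance_facts : exists l2 c : R,
  [/\ 0 < l2 /\ 0 < c,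
      q h / h ^+ 2 @[h --> 0^'] --> l2 / 2,
      ((cov_fun Z)^`()^`())%classic 0 = - l2 &
      forall tau, 0 <= tau <= T -> c * tau ^+ 2 <= q tau].
Proof.
have [l2 [ql G2 qub]] := covariance_expansion hT Zgauss Zcentered Zstat ZC1 Gamma0.
have qmul := q_mulrn hT Zgauss Zcentered Zstat Gamma0.
have l20 : 0 < l2.
  (* Limit of q(T) <= N^2 q(T/N) as N grows; the left side is positive, hence so is l2. *)
  have : q T / T ^+ 2 <= l2 / 2.
    have u1 : (forall n, T * n.+1%:R^-1 != 0) /\ T * n.+1%:R^-1 @[n --> \oo] --> (0 : R).
      split; first by move=> n; rewrite mulf_neq0// gt_eqF.
      by rewrite -[X in _ --> X](mulr0 T); apply: cvgM; [exact: cvg_cst|exact: cvg_harmonic].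
    move/cvgr_dnbhsP : ql => /(_ _ u1) c.
    rewrite -(cvg_lim _ c)//; apply: limr_ge; first by apply/cvg_ex; exists (l2 / 2).
    apply: nearW => n /=.
    have n0 : 0 < n.+1%:R :> R by [].
    have := qmul n (T * n.+1%:R^-1).
    move: n0; set N : R := n.+1%:R => N0.
    rewrite [N * _]mulrC mulfVK ?gt_eqF//.
    have TN : 0 <= T / N by rewrite divr_ge0// ltW.
    move=> /(_ TN (lexx _)); rewrite -/(q _) -/(q _) => h.
    rewrite ler_pdivrMr ?exprn_gt0//; apply: (le_trans h).
    by rewrite le_eqVlt; apply/orP; left; apply/eqP; field; rewrite !gt_eqF.
  have : 0 < q T / T ^+ 2 by rewrite divr_gt0 ?exprn_gt0// q_gt0// hT lexx.
  by lra.
have [m m0 mP] := q_min.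
exists l2, (m / T ^+ 2); split => //; first by rewrite l20 divr_gt0// exprn_gt0.
move=> tau /andP[tau0 tauT].
have [->|] := eqVneq tau 0; first by rewrite expr0n mulr0 /q Gamma0 subrr.
move=> tn0; have {tn0 tau0}t0 : 0 < tau by rewrite lt_neqAle eq_sym tn0.
(* The largest multiple of tau within [0, T] lies in [T/2, T], where q is at least m; [q_mulrn]
   carries this bound back to tau. *)
have [N [N1 N2]] : exists N : nat, T / 2 <= N.+1%:R * tau /\ N.+1%:R * tau <= T.
  pose n := Num.truncn (T / tau).
  have n1 : (n%:R <= T / tau < n.+1%:R) by apply: truncn_itv; rewrite divr_ge0 ?ltW.
  move: n1 => /andP[]; rewrite ler_pdivlMr// ltr_pdivrMr// => h1 h2.
  have n_gt0 : (0 < n)%N.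
    rewrite lt0n; apply/eqP => n0; move: h2; rewrite n0 mul1r ltNge tauT//.
  exists n.-1; rewrite prednK//; split => //.
  have : 1 <= n%:R :> R by rewrite ler1n.
  by move: h2; rewrite -natr1; set k : R := n%:R => h2 k1; nra.
have := qmul N tau (ltW t0) N2; rewrite -/(q _) -/(q _).
have := mP (N.+1%:R * tau); rewrite N1 N2 => /(_ isT).
have : 0 < N.+1%:R :> R by [].
move: N1 N2; set k : R := N.+1%:R => N1 N2 k0 h1 h2.
rewrite -(@ler_pM2l _ (k ^+ 2)) ?exprn_gt0//; apply: le_trans h2; apply: le_trans h1.
rewrite (_ : k ^+ 2 * (m / T ^+ 2 * tau ^+ 2) = (k * tau) ^+ 2 / T ^+ 2 * m); last by field; rewrite gt_eqF.
apply: ler_piMl; first exact: ltW.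
by rewrite ler_pdivrMr ?exprn_gt0// mul1r ler_sqr// nnegrE ?mulr_ge0// ltW.
Qed.
End CovarianceBound.

(** * The process J *)

Lemma event_indep_measurable (d d' : measure_display) (T : measurableType d)
  (E : measurableType d') (R : realType) (P : probability T R)
  (A : set T) (Y : T -> E) (G : set (set E)) :
  d'.-measurable%classic = <<s G >> -> setI_closed G -> G setT ->
  measurable A -> measurable_fun setT Y ->
  (forall B, G B -> P (A `&` Y @^-1` B) = (P A * P (Y @^-1` B))%E) ->
  forall B, measurable B -> P (A `&` Y @^-1` B) = (P A * P (Y @^-1` B))%E.
Proof.
move=> GE GI GT mA mY h B mB.
pose rY := mk_rv P mY.
have mrv : measurable_fun setT rY by [].
pose m1f := (pushforward (mrestr P mA) rY : {measure set E -> \bar R}).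
pose m1 := m1f mrv.
have PA : (0 <= fine (P A))%R by exact: fine_ge0.
pose m2 : {measure set E -> \bar R} := mscale (NngNum PA) (distribution P rY).
have fA : P A \is a fin_num by rewrite fin_num_measure.
have m1E C : m1 C = P (A `&` Y @^-1` C) by rewrite setIC.
have m2E C : m2 C = (P A * P (Y @^-1` C))%E by rewrite /m2 /= /mscale /= fineK.
rewrite -m1E -m2E; apply: (@measure_unique _ R E G (fun=> setT)) => //.
- by rewrite bigcup_const//; exists 0%N.
- by move=> C GC; rewrite m1E m2E h.
- move=> k; rewrite m1E preimage_setT setIT (le_lt_trans (probability_le1 _ _))//.
  by rewrite ltry.
Qed.

Lemma event_indep_pair (d d1 d2 : measure_display) (T : measurableType d)
  (T1 : measurableType d1) (T2 : measurableType d2) (R : realType) (P : probability T R)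
  (A : set T) (X : T -> T1) (Y : T -> T2) :
  measurable A -> measurable_fun setT X -> measurable_fun setT Y ->
  (forall B C, measurable B -> measurable C ->
    P (A `&` (X @^-1` B `&` Y @^-1` C)) = (P A * P (X @^-1` B `&` Y @^-1` C))%E) ->
  forall S, measurable S ->
    P (A `&` (fun w => (X w, Y w)) @^-1` S) = (P A * P ((fun w => (X w, Y w)) @^-1` S))%E.
Proof.
move=> mA mX mY h; apply: event_indep_measurable (measurable_prod_measurableType T1 T2) _ _ mA _ _.
- move=> _ _ [B1 mB1 [C1 mC1 <-]] [B2 mB2 [C2 mC2 <-]]; rewrite -setXI.
  by exists (B1 `&` B2); [exact: measurableI|exists (C1 `&` C2) => //; exact: measurableI].
- by exists setT => //; exists setT => //; rewrite setXTT.
- exact: measurable_fun_pair.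
- by move=> _ [B mB [C mC <-]]; exact: h.
Qed.

Lemma gcf_normal (d : measure_display) (T : measurableType d) (R : realType)
  (P : probability T R) (Y : T -> R) (v : R) : 0 < v -> measurable_fun setT Y ->
  (forall B : set R, measurable B -> P (Y @^-1` B) = normal_prob 0 (Num.sqrt v) B) ->
  gcf P Y v.
Proof.
move=> v0 mY lawY a b.
have s0 : Num.sqrt v != 0 :> R by rewrite gt_eqF// sqrtr_gt0.
have mc := measurable_cos_affine a b (@measurable_id _ R setT).
have [_ ->] := @eq_law_integral _ _ R P Y (normal_prob 0 (Num.sqrt v))
  (fun x => cos (a * x + b)) mY mc lawY
  (@bounded_integrable _ (measurableTypeR R) R (normal_prob 0 (Num.sqrt v))
    (fun x => cos (a * x + b)) 1 mc (fun x => cos_max _)).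
by rewrite normal_cf// mulr0 add0r sqr_sqrtr// ltW.
Qed.

Lemma bigcap_cons (I : eqType) (T : Type) (F : I -> set T) (x : I) (s : seq I) :
  \bigcap_(i in [set` x :: s]) F i = F x `&` \bigcap_(i in [set` s]) F i.
Proof.
rewrite -bigcap_setU1; congr (bigcap _ _); apply/seteqP; split => i /=.
  by rewrite inE => /predU1P[->|]; [left|right].
by move=> [->|si]; rewrite inE ?eqxx// si orbT.
Qed.

Section AutoRegressive.
Context (R : realType) (d : measure_display) (Omega : measurableType d)
  (P : probability Omega R) (rho : R) (eps : nat -> {RV P >-> R}).
Hypotheses (hrho : `|rho| < 1)
  (eps_law : forall n (B : set R), measurable B ->
         distribution P (eps n) B = normal_prob 0 (Num.sqrt 2^-1) B)
  (eps_indep : mutually_indep P (fun n => eps n : Omega -> R)).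
Local Notation A := (ar_chain rho (fun n => eps n : Omega -> R)).

Let c : R := Num.sqrt (1 - rho ^+ 2).

Let meps n : measurable_fun setT (eps n : Omega -> R).
Proof. exact: measurable_funP. Qed.

Lemma measurable_ar_chain n : measurable_fun setT (A n).
Proof. by elim: n => [|n IH] //=; apply: measurable_funD; exact: measurable_funM. Qed.

(** A_n depends on the innovations up to n only. Independence from a whole finite family of later
    innovations is what makes the induction close: at step n + 1 the innovation n + 1 is taken out
    of the family. *)
Lemma ar_chain_indep n (B : set R) (s : seq nat) (C : nat -> set R) :
  measurable B -> (forall i, measurable (C i)) -> uniq s -> all (leq n.+1) s ->
  P (A n @^-1` B `&` \bigcap_(i in [set` s]) (eps i @^-1` C i)) =
  (P (A n @^-1` B) * P (\bigcap_(i in [set` s]) (eps i @^-1` C i)))%E.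
Proof.
elim: n B s C => [|n IH] B s C mB mC us ns.
  have n0 : 0%N \notin s by apply/negP => /(allP ns).
  pose C' i := if i == 0%N then B else C i.
  have mC' i : measurable (C' i) by rewrite /C'; case: ifP.
  have CE i : i \in s -> C' i = C i.
    by move=> si; rewrite /C'; case: eqP => // i0; rewrite -i0 si in n0.
  have -> : \bigcap_(i in [set` s]) (eps i @^-1` C i) = \bigcap_(i in [set` s]) (eps i @^-1` C' i).
    by apply: eq_bigcapr => i /= si; rewrite CE.
  have := @eps_indep (0%N :: s) C'; rewrite /= n0 us => /(_ isT mC').
  rewrite bigcap_cons big_cons {1 2}/C'/= => ->.
  by congr (_ * _)%E; rewrite eps_indep.
pose E := \bigcap_(i in [set` s]) (eps i @^-1` C i).
have mE : measurable E.
  by apply: bigcap_measurableType => i _; exact: measurable_preimage.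
rewrite setIC muleC -/E.
have mf : measurable_fun setT (fun x : R * R => rho * x.1 + c * x.2).
  by apply: measurable_funD; apply: measurable_funM.
apply: (@event_indep_pair _ _ _ _ _ _ _ P E (A n) (eps n.+1) mE (measurable_ar_chain n) (meps _) _
  ((fun x : R * R => rho * x.1 + c * x.2) @^-1` B)); last exact: measurable_preimage.
move=> B' D mB' mD.
have ns' : n.+1 \notin s by apply/negP => /(allP ns); rewrite ltnn.
pose C' i := if i == n.+1 then D else C i.
have mC' i : measurable (C' i) by rewrite /C'; case: ifP.
have CE i : i \in s -> C' i = C i.
  by move=> si; rewrite /C'; case: eqP => // i0; rewrite -i0 si in ns'.
have EE : E = \bigcap_(i in [set` s]) (eps i @^-1` C' i).
  by apply: eq_bigcapr => i /= si; rewrite CE.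
have h1 : P (A n @^-1` B' `&` (eps n.+1 @^-1` D `&` E)) =
    (P (A n @^-1` B') * P (eps n.+1 @^-1` D `&` E))%E.
  have := IH B' (n.+1 :: s) C' mB' mC'; rewrite /= ns' us ltnSn/= => /(_ isT).
  rewrite bigcap_cons -EE {1 2}/C' eqxx; apply.
  by apply: sub_all ns => i; exact: ltnW.
have h2 : P (eps n.+1 @^-1` D `&` E) = (P (eps n.+1 @^-1` D) * P E)%E.
  have := @eps_indep (n.+1 :: s) C'; rewrite /= ns' us => /(_ isT mC').
  rewrite bigcap_cons -EE big_cons {1 2}/C' eqxx => ->.
  by congr (_ * _)%E; rewrite EE eps_indep.
have h3 : P (A n @^-1` B' `&` eps n.+1 @^-1` D) = (P (A n @^-1` B') * P (eps n.+1 @^-1` D))%E.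
  have := IH B' [:: n.+1] (fun=> D) mB' (fun=> mD); rewrite /= ltnSn => /(_ isT isT).
  by rewrite set_cons1 bigcap_set1.
by rewrite setIC -setIA h1 h2 h3 muleA muleC.
Qed.

(** Stationarity of the recursion: rho^2 / 2 + (1 - rho^2) / 2 = 1/2. *)
Lemma gcf_ar_chain n : gcf P (A n) 2^-1.
Proof.
have geps i : gcf P (eps i) 2^-1 by apply: gcf_normal => //; exact: eps_law.
elim: n => [|n IH]; first exact: geps.
have := @gcf_indep_sum _ _ R P (fun w => rho * A n w) (fun w => c * eps n.+1 w) (rho ^+ 2 * 2^-1) (c ^+ 2 * 2^-1).
have -> : rho ^+ 2 * 2^-1 + c ^+ 2 * 2^-1 = 2^-1.
  rewrite -mulrDl sqr_sqrtr ?subrKC ?mul1r// subr_ge0.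
  by rewrite -(real_normK (num_real rho)) expr_le1// ltW.
apply; [exact: measurable_funM (measurable_ar_chain n)|exact: measurable_funM| |exact: gcf_scale|exact: gcf_scale].
move=> B C mB mC.
pose B' := (fun x : R => rho * x) @^-1` B; pose C' := (fun x : R => c * x) @^-1` C.
have mB' : measurable B' by apply: measurable_preimage => //; exact: measurable_funM.
have mC' : measurable C' by apply: measurable_preimage => //; exact: measurable_funM.
have := @ar_chain_indep n B' [:: n.+1] (fun=> C') mB' (fun=> mC'); rewrite /= ltnSn => /(_ isT isT).
by rewrite set_cons1 bigcap_set1.
Qed.
End AutoRegressive.

(** * One-time law and jumps of the Poisson-auto-regressive process *)

Section PAR.
Context (R : realType) (d : measure_display) (Omega : measurableType d)
  (P : probability Omega R) (rho lambda : R) (J : R -> {RV P >-> R}).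
Hypotheses (hrho : `|rho| < 1) (hlambda : 0 < lambda)
  (JPAR : PAR_process rho lambda J).

(** Decompose along the value k of nu_r: all A_k have the same law and are independent of nu, so J_r
    is independent of every event of nu, for any position of r relative to [s, t]. A jump of J is
    contained in the event nu_s <> nu_t, of probability 1 - exp(- lambda (t - s)). *)
Lemma PAR_law_jump (s t r : R) (B : set R) : 0 <= s -> s <= t -> 0 <= r -> measurable B ->
  P (J r @^-1` B) = normal_prob 0 (Num.sqrt 2^-1) B /\
  (P (J r @^-1` B `&` [set w | J s w != J t w]) <=
   (lambda * (t - s))%:E * P (J r @^-1` B))%E.
Proof.
move=> s0 st r0 mB.
have [eps [nu [[eps_law eps_indep] [nu_path nu_law _] en JE]]] := JPAR.
pose A := ar_chain rho (fun n => eps n : Omega -> R).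
have mA k : measurable_fun setT (A k) by exact: measurable_ar_chain.
pose N B := normal_prob 0 (Num.sqrt 2^-1) B : \bar R.
have AN k C : measurable C -> P (A k @^-1` C) = N C.
  by move=> mC; apply: gcf_law => //; exact: gcf_ar_chain.
pose G1 : set (set Omega) := \bigcup_(i in [set: nat]) preimage_set_system setT (eps i : Omega -> R) measurable.
pose G2 : set (set Omega) := \bigcup_(i in [set t : R | 0 <= t]) preimage_set_system setT (nu i : Omega -> nat) measurable.
have mnu u : 0 <= u -> measurable_fun [set: g_sigma_algebraType G2] (nu u : g_sigma_algebraType G2 -> nat).
  by move=> u0; exact: measurable_sigma_gen.
have mA1 k : measurable_fun [set: g_sigma_algebraType G1] (A k : g_sigma_algebraType G1 -> R).
  have me i : measurable_fun [set: g_sigma_algebraType G1] (eps i : g_sigma_algebraType G1 -> R).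
    exact: measurable_sigma_gen.
  by elim: k => [|k IH]; [exact: me|apply: measurable_funD; exact: measurable_funM].
have ind k C (E : set Omega) : measurable C -> <<s G2 >> E ->
    P (A k @^-1` C `&` E) = (N C * P E)%E.
  move=> mC GE; rewrite -(AN k)//; apply: en => //.
  exact: (sigma_gen_preimage (mA1 k) mC).
have subG2 E : <<s G2 >> E -> measurable E.
  apply: smallest_sub; first exact: sigma_algebra_measurable.
  by move=> _ [i _ [C mC <-]]; rewrite setTI; exact: measurable_preimage.
have law C (E : set Omega) : measurable C -> <<s G2 >> E ->
    P (J r @^-1` C `&` E) = (N C * P E)%E.
  move=> mC GE.
  have Ek k : <<s G2 >> (nu r @^-1` [set k] `&` E).
    have h : (@measurable _ (g_sigma_algebraType G2)) (nu r @^-1` [set k] `&` E).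
      apply: measurableI => //.
      by have := mnu r r0 measurableT [set k] I; rewrite setTI.
    exact: h.
  have -> : J r @^-1` C `&` E = \bigcup_k (A k @^-1` C `&` (nu r @^-1` [set k] `&` E)).
    apply/seteqP; split => w /=.
      by move=> [Cw Ew]; exists (nu r w) => //; split => //; move: Cw; rewrite /= JE.
    by move=> [k _ [Cw [/= e Ew]]]; split => //; move: Cw; rewrite /= JE// e.
  have -> : P E = P (\bigcup_k (nu r @^-1` [set k] `&` E)).
    congr (P _); apply/seteqP; split => w; first by move=> Ew; exists (nu r w).
    by move=> [k _ []].
  rewrite !measure_bigcup//; last 4 first.
  - by move=> k _; exact: subG2.
  - by move=> i j _ _ [w [[/= e1 _] [/= e2 _]]]; rewrite -e1 -e2.
  - by move=> k _; apply: measurableI; [exact: measurable_preimage|exact: subG2].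
  - by move=> i j _ _ [w [[_ [/= e1 _]] [_ [/= e2 _]]]]; rewrite -e1 -e2.
  have N0 : (0 <= fine (N C))%R by exact: fine_ge0.
  have fN : N C \is a fin_num by rewrite /N fin_num_measure.
  rewrite -(fineK fN) -nneseriesZl//.
  by apply: eq_eseriesr => k _; rewrite fineK//; exact: ind.
pose E : set Omega := [set w | nu s w != nu t w].
have GE : <<s G2 >> E.
  have h : (@measurable _ (g_sigma_algebraType G2)) E.
    have mf := measurable_fun_eqn (mnu s s0) (mnu t (le_trans s0 st)).
    have := mf measurableT [set false] I; rewrite setTI.
    by congr measurable; apply/seteqP; split => w /=; rewrite /E/=; case: eqP.
  exact: h.
have JN : P (J r @^-1` B) = N B.
  have GT : <<s G2 >> setT.
    have h : (@measurable _ (g_sigma_algebraType G2)) setT by [].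
    exact: h.
  by have := law B setT mB GT; rewrite setIT probability_setT mule1.
split; first exact: JN.
apply: (@le_trans _ _ (P (J r @^-1` B `&` E))).
  apply: le_measure; rewrite ?inE.
  - apply: measurableI; first exact: measurable_preimage.
    have : measurable_fun setT (fun w => J s w == J t w) by apply: measurable_fun_eqr.
    move=> /(_ measurableT [set false] I); rewrite setTI.
    by congr measurable; apply/seteqP; split => w /=; case: eqP.
  - by apply: measurableI; [exact: measurable_preimage|exact: subG2].
  - move=> w [Bw /= Jw]; split => //; rewrite /E/=; apply: contra Jw => /eqP e.
    by rewrite !JE ?(le_trans s0 st)// e.
rewrite law// JN muleC; apply: lee_wpmul2r; first exact: measure_ge0.
(* The law of the increments of nu is given for s < t only. *)
have [e|st'] := eqVneq s t.
  have -> : E = set0 by apply/seteqP; split => w //=; rewrite /E/= e eqxx.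
  by rewrite measure0 e subrr mulr0.
have {}st' : s < t by rewrite lt_neqAle st'.
have -> : E = ~` [set w | (nu t w - nu s w)%N = 0%N].
  apply/seteqP; split => w; rewrite /E/=; have [_ /(_ s t s0 st) nst _ _] := nu_path w.
    move=> /eqP h /eqP; rewrite subn_eq0 => h2; apply: h.
    by apply/eqP; rewrite eqn_leq nst.
  by move=> h; apply/eqP => e; apply: h; rewrite e subnn.
rewrite probability_setC; last first.
  have h : measurable_fun setT (fun w => nu t w - nu s w)%N by exact: measurable_fun_subn.
  have := h measurableT [set 0%N] I.
  by rewrite setTI.
rewrite nu_law// /poisson_pmf mulr_gt0 ?subr_gt0// expr0 fact0 divr1 mul1r.
rewrite -EFinB lee_fin.
by have := expR_ge1Dx (- (lambda * (t - s))); lra.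
Qed.

Lemma gcf_PAR (t : R) : 0 <= t -> gcf P (J t) 2^-1.
Proof.
move=> t0; apply: gcf_normal => //.
by move=> B mB; have [] := PAR_law_jump t0 (lexx t) t0 mB.
Qed.

Lemma PAR_right_cont (t : R) (w : Omega) : 0 <= t -> \forall s \near t^'+, J s w = J t w.
Proof.
move=> t0; have [eps [nu [_ [nu_path _ _] _ JE]]] := JPAR.
have [_ _ /(_ t t0) h _] := nu_path w.
near=> s; rewrite !JE//; last by rewrite (le_trans t0)//; near: s; exact: nbhs_right_ge.
by congr ar_chain; near: s.
Unshelve. all: by end_near.
Qed.

(** Up to time T the path takes its values among A_0, ..., A_k with k = nu_T, so the sum of their
    absolute values is a bound. *)
Lemma PAR_bounded (T : R) (w : Omega) : 0 <= T ->
  exists C : R, forall t, 0 <= t <= T -> J t w <= C.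
Proof.
move=> T0; have [eps [nu [_ [nu_path _ _] _ JE]]] := JPAR.
have [_ nd _ _] := nu_path w.
exists (\sum_(k < (nu T w).+1) `|ar_chain rho (fun n => eps n : Omega -> R) k w|) => t /andP[t0 tT].
have h : (nu t w < (nu T w).+1)%N by rewrite ltnS; exact: nd.
rewrite JE// (bigD1 (Ordinal h))//= (le_trans (ler_norm _))// lerDl.
by apply: sumr_ge0.
Qed.
End PAR.

(** Conditioning on X by Fubini. The law of X enters as a separate measure m1, which may be an
    explicit normal law; measurability of the conditional probability is returned because integrals
    of it are compared afterwards. *)
Lemma indep_section (d d1 d2 : measure_display) (T : measurableType d)
  (T1 : measurableType d1) (T2 : measurableType d2) (R : realType) (P : probability T R)
  (X : T -> T1) (Y : T -> T2) (m1 : probability T1 R) (S : set (T1 * T2)) :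
  measurable_fun setT X -> measurable_fun setT Y ->
  (forall A B, measurable A -> measurable B ->
    P (X @^-1` A `&` Y @^-1` B) = (P (X @^-1` A) * P (Y @^-1` B))%E) ->
  (forall A, measurable A -> P (X @^-1` A) = m1 A) -> measurable S ->
  measurable_fun setT (fun x => P (Y @^-1` xsection S x)) /\
  P [set w | S (X w, Y w)] = (\int[m1]_x P (Y @^-1` xsection S x))%E.
Proof.
move=> mX mY XY hX mS.
have mXY : measurable_fun setT (fun w => (X w, Y w)) by exact: measurable_fun_pair.
pose rY := mk_rv P mY; pose rXY := mk_rv P mXY.
split; first exact: (@measurable_fun_xsection _ _ T1 T2 R (distribution P rY) S mS).
have U : forall A, measurable A -> (m1 \x distribution P rY)%E A = distribution P rXY A.
  by apply: product_measure_unique => A B mA mB; rewrite /distribution /pushforward/= -hX// -XY.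
exact: esym (U S mS).
Qed.

Lemma measurable_bool (d : measure_display) (T : measurableType d) (f : T -> bool) :
  measurable_fun setT f -> measurable [set x | f x].
Proof.
move=> mf; have := mf measurableT [set true] I; rewrite setTI.
by congr measurable; apply/seteqP; split => x /=; case: (f x).
Qed.

Lemma prob_le_cover (d : measure_display) (T : measurableType d) (R : realType)
  (P : probability T R) (A B C : set T) (x y : R) :
  measurable A -> measurable B -> measurable C -> A `<=` B `|` C ->
  (P B <= x%:E)%E -> (P C <= y%:E)%E -> (P A <= (x + y)%:E)%E.
Proof.
move=> mA mB mC ABC hB hC; apply: (@le_trans _ _ (P (B `|` C))).
  by apply: le_measure; rewrite ?inE//; exact: measurableU.
by apply: (le_trans (measureU2 _ mB mC)); rewrite EFinD leeD.
Qed.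

Section GaussianTailVariance.
Context {R : realType}.

Lemma normal_tail1 (u : R) : 0 < u ->
  (normal_prob 0 1 `]u, +oo[ <= (normal_pdf 0 1 u / u)%:E)%E.
Proof.
move=> u0; apply: (le_trans (normal_tail ltr01 u0)).
by rewrite expr1n mul1r mulrC.
Qed.

(** A variance deficit 2 Th gains a factor exp(- u^2 Th) in the tail at u, since 1 / (1 - 2 Th) >= 1
    + 2 Th. Every gain over phi(u)/u in the pair estimates with J frozen has this source. *)
Lemma normal_pdf_variance_le (u Th : R) : 0 < u -> 0 <= Th -> 0 < 1 - 2 * Th ->
  (1 - 2 * Th) / u * normal_pdf 0 (Num.sqrt (1 - 2 * Th)) u <=
  normal_pdf 0 1 u / u * expR (- (u ^+ 2 * Th)).
Proof.
move=> u0 Th0 w0; set w := 1 - 2 * Th in w0 *.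
have sw0 : 0 < Num.sqrt w by rewrite sqrtr_gt0.
have sw1 : Num.sqrt w <= 1 by rewrite -sqrtr1 ler_wsqrtr// /w; lra.
rewrite !normal_pdf0E// sqr_sqrtr ?(ltW w0)// mul1r expr1n mulr1.
set r := Num.sqrt (2 * pi).
have r0 : 0 < r by rewrite sqrtr_gt0 mulr_gt0// pi_gt0.
have -> : w / u * ((Num.sqrt w * r)^-1 * expR (- (u ^+ 2 / (2 * w)))) =
   (u^-1 * r^-1) * (Num.sqrt w * expR (- (u ^+ 2 / (2 * w)))).
  rewrite -{1}(sqr_sqrtr (ltW w0)); field; by rewrite !gt_eqF.
rewrite (_ : r^-1 * _ / u * _ = u^-1 * r^-1 * (expR (- (u ^+ 2 / 2)) * expR (- (u ^+ 2 * Th)))); last by ring.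
have ur : 0 <= u^-1 / r by rewrite mulr_ge0// invr_ge0 ltW.
apply: ler_wpM2l => //.
rewrite -expRD; apply: (@le_trans _ _ (1 * expR (- (u ^+ 2 / (2 * w))))).
  by apply: ler_wpM2r; first exact: expR_ge0.
rewrite mul1r ler_expR -opprD lerN2.
have -> : u ^+ 2 / 2 + u ^+ 2 * Th = u ^+ 2 * (1 + 2 * Th) / 2 by field.
have -> : u ^+ 2 / (2 * w) = u ^+ 2 * w^-1 / 2 by field; rewrite gt_eqF.
rewrite ler_wpM2r// ler_wpM2l ?sqr_ge0// -[leRHS]mul1r ler_pdivlMr// /w; nra.
Qed.

Lemma expRN_le_inv (x : R) : 0 < x -> expR (- x) <= x^-1.
Proof.
move=> x0; rewrite expRN lef_pV2 ?posrE ?expR_gt0//.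
by have := expR_ge1Dx x; lra.
Qed.

(** The third power is used with x of order k^2: it absorbs a lost factor k^4 and still leaves
    k^-2. *)
Lemma expRN_le_inv3 (x : R) : 0 < x -> expR (- x) <= 6 / x ^+ 3.
Proof.
move=> x0; rewrite expRN -[6 / _]invf_div lef_pV2 ?posrE ?expR_gt0//; last first.
  by rewrite divr_gt0// exprn_gt0.
have := @expR_ge1Dxn _ _ 2 (ltW x0); rewrite (_ : 3`!%:R = 6 :> R)//; lra.
Qed.
End GaussianTailVariance.

Lemma C1_within_continuous (R : realType) (D : set R) (f : R -> R) :
  C1_on D f -> {within D, continuous f}.
Proof.
move=> [g _ fg]; apply/subspace_continuousP => t Dt.
apply/cvgrPdist_lt => e e0.
have h1 : \forall s \near t, s != t -> D s -> `|g t - (f s - f t) / (s - t)| < 1.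
  by have := fg t Dt => /cvgrPdist_lt /(_ 1 ltr01).
pose K := `|g t| + 1.
have K0 : 0 < K by rewrite ltr_wpDl.
have h2 : \forall s \near t, `|t - s| < e / K.
  by apply/nbhs_ballP; exists (e / K) => //=; rewrite divr_gt0.
have : \forall s \near t, D s -> `|f t - f s| < e.
  apply: filterS2 h1 h2 => s h1 h2 Ds.
  have [->|st] := eqVneq s t; first by rewrite subrr normr0.
  have {}h1 := h1 st Ds.
  have st0 : s - t != 0 by rewrite subr_eq0.
  have -> : f t - f s = - ((f s - f t) / (s - t) * (s - t)) by field.
  rewrite normrN normrM.
  have h3 : `|(f s - f t) / (s - t)| <= K.
    rewrite -[X in `|X|](subrK (g t)) (le_trans (ler_normD _ _))// addrC lerD2l.
    by rewrite distrC ltW.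
  apply: (@le_lt_trans _ _ (K * `|s - t|)); first by rewrite ler_wpM2r.
  by move: h2; rewrite distrC ltr_pdivlMr// mulrC.
by [].
Qed.

(** * Grids *)

Section Bonferroni.
Context (d : measure_display) (T : measurableType d) (R : realType) (P : probability T R).

Let Pr (A : set T) : R := fine (P A).

Lemma bonferroni (A : nat -> set T) (n : nat) : (forall i, measurable (A i)) ->
  \sum_(i < n) Pr (A i) - \sum_(j < n) \sum_(i < j) Pr (A i `&` A j)
  <= Pr (\big[setU/set0]_(i < n) A i).
Proof.
move=> mA.
have fin B : measurable B -> P B \is a fin_num by move=> mB; rewrite fin_num_measure.
have mU k : measurable (\big[setU/set0]_(i < k) A i) by apply: bigsetU_measurable.
elim: n => [|n IH]; first by rewrite !big_ord0 subrr fine_ge0.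
rewrite !big_ord_recr/=.
set U := \big[setU/set0]_(i < n) A i in IH *.
have e : Pr (U `|` A n) = Pr U + Pr (A n) - Pr (U `&` A n).
  have PU : (P U < +oo)%E by rewrite (le_lt_trans (probability_le1 _ _)) ?ltry//; exact: mU.
  have mUA : measurable (U `&` A n) by apply: measurableI => //; exact: mU.
  have fU := fin _ (mU n); have fA := fin _ (mA n); have fUA := fin _ mUA.
  by rewrite /Pr (measureUfinl (mU n) (mA n) PU) fineB ?fineD ?fin_numD// fU fA.
have h : Pr (U `&` A n) <= \sum_(i < n) Pr (A i `&` A n).
  rewrite /U big_distrl/= -lee_fin fineK; last by apply: fin; apply: bigsetU_measurable => i _; exact: measurableI.
  have mAA (i : nat) : (i < n)%N -> measurable (A i `&` A n) by move=> _; exact: measurableI.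
  apply: (le_trans (@le_mu_bigsetU _ R T P (fun i => A i `&` A n) n mAA)).
  rewrite -sumEFin; apply: lee_sum => i _.
  by rewrite fineK//; apply: fin; exact: measurableI.
rewrite e; lra.
Qed.
End Bonferroni.

Section Grid.
Context (R : realType) (T : R) (f : R -> R).
Hypothesis hT : 0 < T.

(** The dyadic point used is the first one strictly to the right of s, because only values to the
    right are controlled. For s = T no such point exists, but T itself is on the grid. *)
Lemma dyadic_hit (s u : R) : 0 <= s <= T -> u < f s ->
  (s < T -> exists2 e : R, 0 < e & forall t, s < t < s + e -> t <= T -> u < f t) ->
  exists m i : nat, (i <= 2 ^ m)%N /\ u < f (i%:R * (T / (2 ^ m)%:R)).
Proof.
move=> /andP[s0 sT] us h; have [sT'|] := ltP s T; last first.
  move=> Ts; exists 0%N, 1%N; split => //; rewrite expn0 divr1 mul1r.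
  by rewrite (_ : T = s)//; apply/eqP; rewrite eq_le Ts sT.
have [e e0 he] := h sT'.
have [m hm] : exists m : nat, T / e < (2 ^ m)%:R.
  exists (Num.truncn (T / e)).+1.
  have /andP[_ h2] := truncn_itv (divr_ge0 (ltW hT) (ltW e0)).
  by apply: (lt_le_trans h2); rewrite ler_nat ltnW// ltn_expl.
pose N : R := (2 ^ m)%:R.
have N0 : 0 < N by rewrite ltr0n expn_gt0.
pose i := (Num.truncn (s * N / T)).+1.
have /andP[i1 i2] : (i.-1)%:R <= s * N / T < i%:R.
  by apply: truncn_itv; rewrite divr_ge0 ?mulr_ge0 ?(ltW N0) ?(ltW hT).
have iN : (i <= 2 ^ m)%N.
  rewrite -(ltr_nat R) -/N; apply: (le_lt_trans i1); rewrite ltr_pdivrMr// mulrC ltr_pM2l//.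
exists m, i; split => //; rewrite -/N.
have iE : i%:R = i.-1%:R + 1 :> R by rewrite natr1.
have TN : T / N < e by rewrite ltr_pdivrMr// mulrC -ltr_pdivrMr.
have TN0 : 0 < T / N by rewrite divr_gt0.
have g1 : s < i%:R * (T / N) by move: i2; rewrite mulrA ltr_pdivrMr// ltr_pdivlMr.
have g2 : i.-1%:R * (T / N) <= s by move: i1; rewrite mulrA ler_pdivlMr// ler_pdivrMr.
apply: he.
  by rewrite g1/= iE mulrDl mul1r; lra.
rewrite mulrA ler_pdivrMr// mulrC ler_pM2l// /N ler_nat//.
Qed.
End Grid.

Section GridEvents.
Context (R : realType) (d : measure_display) (Omega : measurableType d)
  (P : probability Omega R) (X : R -> Omega -> R) (T u : R).
Hypotheses (hT : 0 < T) (mX : forall t, measurable_fun setT (X t)).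

(** Index 0 is an exceedance at time 0, index j + 1 an upcrossing over the j-th cell. These events
    need not be disjoint, which is why the lower bound goes through Bonferroni. *)
Definition first_crossing (dl : R) (i : nat) : set Omega :=
  if i is j.+1 then [set w | X (j%:R * dl) w <= u < X (j.+1%:R * dl) w]
  else [set w | u < X 0 w].

Definition grid_exceed (n : nat) : set Omega :=
  \big[setU/set0]_(i < n.+1) first_crossing (T / n%:R) i.

Lemma measurable_first_crossing dl i : measurable (first_crossing dl i).
Proof.
case: i => [|i] /=.
  by apply: measurable_bool; exact: measurable_fun_ltr.
apply: (@measurable_bool _ _ (fun w => X (i%:R * dl) w <= u < X (i.+1%:R * dl) w)).
by apply: measurable_and; [exact: measurable_fun_ler|exact: measurable_fun_ltr].
Qed.

Lemma measurable_grid_exceed n : measurable (grid_exceed n).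
Proof. by apply: bigsetU_measurable => i _; exact: measurable_first_crossing. Qed.

(** Walking back from a grid point above u, one either meets a cell that starts at or below u, which
    is an upcrossing, or reaches time 0. *)
Lemma grid_exceedE n w : grid_exceed n w <->
  exists2 i : nat, (i <= n)%N & u < X (i%:R * (T / n%:R)) w.
Proof.
rewrite /grid_exceed -bigcup_mkord; split.
  move=> [[|i] /= hi]; first by exists 0%N => //; rewrite mul0r.
  by move=> /andP[_ ?]; exists i.+1.
move=> [i]; elim: i => [|i IH] hi hX; first by exists 0%N => //=; rewrite mul0r in hX.
have [h|h] := leP (X (i%:R * (T / n%:R)) w) u.
  by exists i.+1 => //=; apply/andP.
by apply: IH => //; exact: ltnW.
Qed.

End GridEvents.

(** * Crossing bounds relative to the standard normal density *)

Section CrossingAsymptotics.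
Context {R : realType}.
Variables (Q u : R).
Hypotheses (Q0 : 0 < Q) (Q1 : Q < 1) (u0 : 0 < u).
Let S := Num.sqrt (Q / 2).
Let c := Num.sqrt (1 - Q / 2).
Let k : R := u / c ^+ 2.
Let phi : R := normal_pdf 0 1 u.
Let r : R := Num.sqrt (2 * pi).

Let r0 : 0 < r. Proof. by rewrite sqrtr_gt0 mulr_gt0// pi_gt0. Qed.
Let w0 : 0 < 1 - Q / 2. Proof. by have q0 := Q0; have q1 := Q1; lra. Qed.
Let c2E : c ^+ 2 = 1 - Q / 2. Proof. by rewrite sqr_sqrtr// ltW. Qed.
Let S2E : S ^+ 2 = Q / 2. Proof. by rewrite sqr_sqrtr// divr_ge0// ltW. Qed.
Let c0 : 0 < c. Proof. by rewrite sqrtr_gt0. Qed.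

Let SrE : 2 * (S / r) = Num.sqrt (Q / pi).
Proof.
have pi0 : pi != 0 :> R by rewrite gt_eqF// pi_gt0.
have -> : Q / pi = 2 ^+ 2 * (Q / 2 * (2 * pi)^-1).
  by move: (@pi R) pi0 => p p0; field.
rewrite sqrtrM ?sqr_ge0// sqrtr_sqr ger0_norm// sqrtrM ?divr_ge0 ?(ltW Q0)//.
by rewrite sqrtrV// mulr_ge0// pi_ge0.
Qed.

Let phiE : phi = r^-1 * expR (- (u ^+ 2 / 2)).
Proof. by rewrite /phi normal_pdf0E// mul1r expr1n mulr1. Qed.

Let phi0 : 0 < phi. Proof. by rewrite phiE mulr_gt0 ?expR_gt0// invr_gt0. Qed.

Let pdfcE : normal_pdf 0 c u = c^-1 * (r^-1 * expR (- (u ^+ 2 / (2 * (1 - Q / 2))))).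
Proof. by rewrite normal_pdf0E// -/r c2E invfM mulrA. Qed.

Let k2_le : S ^+ 2 * k ^+ 2 <= 2 * (Q * u ^+ 2).
Proof.
have q0 := Q0; have q1 := Q1; have w1 := w0.
rewrite S2E /k c2E exprMn exprVn.
have -> : Q / 2 * (u ^+ 2 / (1 - Q / 2) ^+ 2) = Q * u ^+ 2 / (2 * (1 - Q / 2) ^+ 2).
  by field; rewrite gt_eqF//; lra.
rewrite ler_pdivrMr ?mulr_gt0 ?exprn_gt0//.
have : 1 / 4 <= (1 - Q / 2) ^+ 2 by nra.
have : 0 <= Q * u ^+ 2 by rewrite mulr_ge0 ?sqr_ge0// ltW.
by move: (Q * u ^+ 2) ((1 - Q / 2) ^+ 2) => x y; nra.
Qed.

(** Each correction is a factor 1/(1 - x) with x equal to Q/2, eta or Q u^2 / eta; a product of such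
    1 - x is at least 1 minus the sum. The remaining sqrt(Q / pi) is what becomes linear in the time
    step. *)
Lemma crossing_upper_asym (eta : R) : 0 < eta ->
  0 < 1 - eta - (Q / 2 + Q * u ^+ 2 / eta) ->
  S ^+ 2 * k ^+ 2 < 2 * eta /\
  2 * normal_pdf 0 c u * expR eta * (S / r) / (1 - S ^+ 2 * k ^+ 2 / (2 * eta)) <=
  phi * (Num.sqrt (Q / pi) / (1 - eta - (Q / 2 + Q * u ^+ 2 / eta))).
Proof.
move=> eta0; have q0 := Q0; have q1 := Q1; have w1 := w0; set y := Q * u ^+ 2 / eta => h.
have Qu0 : 0 <= Q * u ^+ 2 by rewrite mulr_ge0 ?sqr_ge0// ltW.
have y0 : 0 <= y by rewrite divr_ge0// ltW.
have h1 : S ^+ 2 * k ^+ 2 / (2 * eta) <= y.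
  rewrite ler_pdivrMr ?mulr_gt0//; apply: (le_trans k2_le).
  by rewrite /y le_eqVlt; apply/orP; left; apply/eqP; field; rewrite gt_eqF.
have y1 : y < 1 by lra.
split.
  by apply: (le_lt_trans k2_le); rewrite ltr_pM2l// -[ltRHS]mul1r -ltr_pdivrMr.
have -> : 2 * normal_pdf 0 c u * expR eta * (S / r) = normal_pdf 0 c u * expR eta * Num.sqrt (Q / pi).
  by rewrite -SrE; ring.
set sQ := Num.sqrt (Q / pi); have sQ0 : 0 <= sQ by exact: sqrtr_ge0.
have e1 : expR eta <= (1 - eta)^-1.
  rewrite -[expR eta]invrK -expRN lef_pV2 ?posrE ?expR_gt0//; last by lra.
  by have := expR_ge1Dx (- eta); lra.
have c1 : c^-1 <= (1 - Q / 2)^-1.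
  rewrite lef_pV2 ?posrE// -c2E expr2 ler_piMl ?(ltW c0)// -sqrtr1 ler_wsqrtr//; lra.
have e2 : expR (- (u ^+ 2 / (2 * (1 - Q / 2)))) <= expR (- (u ^+ 2 / 2)).
  rewrite ler_expR lerN2 ler_wpM2l ?sqr_ge0// lef_pV2 ?posrE ?mulr_gt0//; lra.
have p1 : normal_pdf 0 c u <= (1 - Q / 2)^-1 * phi.
  rewrite pdfcE phiE; apply: ler_pM; rewrite ?invr_ge0 ?(ltW c0)//.
    by rewrite mulr_ge0 ?expR_ge0// invr_ge0 ltW.
  by rewrite ler_wpM2l// invr_ge0 ltW.
have z1 : 0 < 1 - y by lra.
have z2 : 0 < 1 - eta by lra.
apply: (@le_trans _ _ ((1 - Q / 2)^-1 * phi * (1 - eta)^-1 * sQ / (1 - y))).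
  apply: ler_pM.
  - by rewrite mulr_ge0// mulr_ge0 ?expR_ge0// normal_pdf_ge0.
  - by rewrite invr_ge0; lra.
  - apply: ler_wpM2r => //; apply: ler_pM; rewrite ?expR_ge0 ?normal_pdf_ge0//.
  - by rewrite lef_pV2 ?posrE//; lra.
rewrite (_ : _ / (1 - y) = phi * (sQ * ((1 - Q / 2) * (1 - eta) * (1 - y))^-1)); last first.
  by rewrite !invfM; ring.
apply: ler_wpM2l; first exact: ltW.
apply: ler_wpM2l => //; rewrite lef_pV2 ?posrE ?mulr_gt0//.
have gen (A B C : R) : 0 < 1 - A -> 0 < 1 - B -> 0 < 1 - C -> 0 <= A -> 0 <= B -> 0 < C ->
    1 - C - (A + B) <= (1 - A) * (1 - C) * (1 - B).
  move=> hA hB hC A0 B0 C0.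
  have h2 : 1 - A - C <= (1 - A) * (1 - C) by nra.
  have h3 : (1 - A - C) * (1 - B) <= (1 - A) * (1 - C) * (1 - B) by rewrite ler_wpM2r// ltW.
  nra.
by apply: gen => //; lra.
Qed.

Lemma crossing_lower_asym (a : R) : 0 < a ->
  phi * (Num.sqrt (Q / pi) * (1 - (u ^+ 2 * Q / 2 + a) - (Q * u ^+ 2 / a + Q))) <=
  2 * normal_pdf 0 c u * expR (- a) * (S / r) / (1 + S ^+ 2 * (k ^+ 2 / (2 * a) + c ^- 2)).
Proof.
move=> a0; have q0 := Q0; have q1 := Q1; have w1 := w0; set x := u ^+ 2 * Q / 2 + a; set y := Q * u ^+ 2 / a + Q.
have Qu0 : 0 <= Q * u ^+ 2 by rewrite mulr_ge0 ?sqr_ge0// ltW.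
have y0 : 0 <= y by rewrite addr_ge0 ?(ltW Q0)// divr_ge0// ltW.
have x0 : 0 <= x by rewrite addr_ge0 ?(ltW a0)// divr_ge0// mulrC.
set W := S ^+ 2 * _.
have Wy : W <= y.
  rewrite /W mulrDr; apply: lerD.
    have -> : Q * u ^+ 2 / a = 2 * (Q * u ^+ 2) / (2 * a) by field; rewrite gt_eqF.
    by rewrite [leLHS]mulrA ler_wpM2r// invr_ge0 mulr_ge0// ltW.
  by rewrite S2E c2E ler_pdivrMr//; nra.
have W0 : 0 <= W.
  by rewrite /W mulr_ge0 ?sqr_ge0// addr_ge0 ?invr_ge0 ?sqr_ge0// divr_ge0 ?sqr_ge0// mulr_ge0// ltW.
have -> : 2 * normal_pdf 0 c u * expR (- a) * (S / r) = normal_pdf 0 c u * expR (- a) * Num.sqrt (Q / pi).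
  by rewrite -SrE; ring.
set sQ := Num.sqrt (Q / pi); have sQ0 : 0 <= sQ by exact: sqrtr_ge0.
have p1 : phi * expR (- (u ^+ 2 * Q / 2)) <= normal_pdf 0 c u.
  rewrite pdfcE phiE -[leLHS]mulrA -expRD -[leLHS]mul1r; apply: ler_pM => //.
  - by rewrite mulr_ge0 ?expR_ge0// invr_ge0 ltW.
  - by rewrite -[leLHS]invr1 lef_pV2 ?posrE// -sqrtr1 ler_wsqrtr//; lra.
  - rewrite ler_wpM2l ?invr_ge0 ?(ltW r0)// ler_expR -opprD lerN2.
    rewrite ler_pdivrMr ?mulr_gt0//.
    have : 1 <= (1 + Q) * (1 - Q / 2) by nra.
    have := sqr_ge0 u; move: (u ^+ 2) (1 - Q / 2) => v z v0 hz; nra.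
rewrite ler_pdivlMr; last by lra.
apply: (@le_trans _ _ (phi * (sQ * expR (- x)))).
  rewrite -mulrA; apply: ler_wpM2l; first exact: ltW.
  rewrite -mulrA; apply: ler_wpM2l => //.
  have e := expR_ge1Dx (- x).
  (* If 1 - x - y is positive, (1 - x - y) (1 + y) <= 1 - x <= exp(- x); otherwise the left side is
     not positive. *)
  have [h|h] := leP (1 - x - y) 0.
    by apply: le_trans (expR_ge0 _); rewrite mulr_le0_ge0//; lra.
  apply: (@le_trans _ _ ((1 - x - y) * (1 + y))); last by nra.
  by rewrite ler_wpM2l ?(ltW h)//; lra.
rewrite /x opprD expRD.
rewrite (_ : phi * _ = phi * expR (- (u ^+ 2 * Q / 2)) * expR (- a) * sQ); last by ring.
apply: ler_wpM2r => //; apply: ler_wpM2r => //; exact: expR_ge0.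
Qed.
End CrossingAsymptotics.

(** Finite form of dominated convergence: the first K terms are small, and the tail telescopes by
    1/(y+1)^2 <= 1/y - 1/(y+1). Index k stands for distance k + 1. *)
Lemma sum_inverse_squares_le (R : realType) (b : nat -> R) (C e : R) (K : nat) :
  0 <= C -> 0 <= e -> (0 < K)%N ->
  (forall k, (k < K)%N -> b k <= e) ->
  (forall k, (K <= k)%N -> b k <= C / k.+1%:R ^+ 2) ->
  forall j, \sum_(k < j) b k <= K%:R * e + C / K%:R.
Proof.
move=> C0 e0 K0 hb1 hb2 j.
have K0' : 0 < K%:R :> R by rewrite ltr0n.
have CK : 0 <= C / K%:R by rewrite divr_ge0// ltW.
have gen (y : R) : 0 < y -> C / (y + 1) ^+ 2 <= C / y - C / (y + 1).
  move=> y0; have y1 : 0 < y + 1 by rewrite addr_gt0.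
  have -> : C / y - C / (y + 1) = C / (y * (y + 1)).
    by field; rewrite !gt_eqF.
  by rewrite ler_wpM2l// lef_pV2 ?posrE ?exprn_gt0 ?mulr_gt0//; nra.
have small i : (i <= K)%N -> \sum_(k < i) b k <= i%:R * e.
  elim: i => [|i IH] iK; first by rewrite big_ord0 mul0r.
  by rewrite big_ord_recr/= -natr1 mulrDl mul1r lerD ?hb1// IH// ltnW.
have large m : \sum_(k < K + m) b k <= K%:R * e + C / K%:R - C / (K + m)%:R.
  elim: m => [|m IH]; first by rewrite addn0 addrK small.
  rewrite addnS big_ord_recr/=; have := hb2 (K + m)%N (leq_addr _ _).
  move: IH; set S := \sum_(k < K + m) b k; set x := (K + m)%:R.
  have x0 : 0 < x :> R by rewrite /x ltr0n addn_gt0 K0.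
  have -> : (K + m).+1%:R = x + 1 :> R by rewrite -natr1.
  have h := gen x x0.
  lra.
have [jK|Kj] := leqP j K.
  apply: (le_trans (small _ jK)); apply: (@le_trans _ _ (K%:R * e)); last by rewrite lerDl.
  by rewrite ler_wpM2r// ler_nat.
rewrite -(subnKC (ltnW Kj)); apply: (le_trans (large _)).
by rewrite gerBl divr_ge0.
Qed.

(** Reversing the inner index turns it into the distance minus one, so each inner sum becomes a
    partial sum of b. *)
Lemma sum_pairs_le (R : realType) (g : nat -> nat -> R) (b : nat -> R) (B : R) (n : nat) :
  (forall i j, (i < j <= n)%N -> g i j <= b (j - i.+1)%N) ->
  (forall j, \sum_(k < j) b k <= B) ->
  \sum_(j < n.+1) \sum_(i < j) g i j <= n.+1%:R * B.
Proof.
move=> gb bB.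
have -> : n.+1%:R * B = \sum_(j < n.+1) B by rewrite sumr_const card_ord mulr_natl.
apply: ler_sum => j _; apply: le_trans (bB j).
rewrite (reindex_inj rev_ord_inj) /=; apply: ler_sum => i _.
apply: (le_trans (gb _ _ _)); first by apply/andP; split; [have := ltn_ord i; lia|rewrite -ltnS].
by rewrite (_ : (j - (j - i.+1).+1 = i)%N)//; have := ltn_ord i; lia.
Qed.

(** * Exceedance probabilities *)

Section Model.
Context (R : realType) (d : measure_display)
    (Omega : measurableType d) (P : probability Omega R)
    (T rho lambda : R) (Z J : R -> {RV P >-> R}).
Hypotheses (hT : 0 < T) (hrho : `|rho| < 1) (hlambda : 0 < lambda)
    (Zgauss : gaussian_process `[0, T] Z)
    (Zcentered : centered_process `[0, T] Z)
    (Zstat : stationary_process `[0, T] Z)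
    (ZC1 : forall w, C1_on `[0, T] (fun t => Z t w))
    (Gamma0 : cov_fun Z 0 = 2^-1)
    (JPAR : PAR_process rho lambda J)
    (ZJindep : indep_systems P
       (sigma_gen `[0, T] (fun t => Z t : Omega -> R))
       (sigma_gen `[0, T] (fun t => J t : Omega -> R))).

Local Notation D := (`[0, T]%classic : set R).
Let q (tau : R) : R := 2^-1 - cov_fun Z tau.
Let GZ : set (set Omega) := \bigcup_(i in D) preimage_set_system setT (Z i : Omega -> R) measurable.
Let GJ : set (set Omega) := \bigcup_(i in D) preimage_set_system setT (J i : Omega -> R) measurable.

Let mZ t : measurable_fun setT (Z t : Omega -> R).
Proof. exact: measurable_funP. Qed.
Let mJ t : measurable_fun setT (J t : Omega -> R).
Proof. exact: measurable_funP. Qed.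

Let D_ge0 t : D t -> 0 <= t.
Proof. by rewrite /= in_itv/= => /andP[]. Qed.

Definition comb3 (c1 c2 c3 t1 t2 t3 : R) (w : Omega) : R :=
  c1 * Z t1 w + c2 * Z t2 w + c3 * Z t3 w.

Definition comb3_var (c1 c2 c3 t1 t2 t3 : R) : R :=
  (c1 + c2 + c3) ^+ 2 / 2 -
      2 * (c1 * c2 * q (t2 - t1) + c1 * c3 * q (t3 - t1) + c2 * c3 * q (t3 - t2)).

Lemma measurable_comb3 c1 c2 c3 t1 t2 t3 : measurable_fun setT (comb3 c1 c2 c3 t1 t2 t3).
Proof. by apply: measurable_funD; [apply: measurable_funD|]; exact: measurable_funM. Qed.

Let measurable_comb3_Z c1 c2 c3 t1 t2 t3 : D t1 -> D t2 -> D t3 ->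
  measurable_fun [set: g_sigma_algebraType GZ] (comb3 c1 c2 c3 t1 t2 t3 : g_sigma_algebraType GZ -> R).
Proof.
move=> h1 h2 h3.
have m t : D t -> measurable_fun [set: g_sigma_algebraType GZ] (Z t : g_sigma_algebraType GZ -> R).
  by move=> Dt; exact: measurable_sigma_gen.
apply: measurable_funD; [apply: measurable_funD|]; apply: measurable_funM => //; exact: m.
Qed.

Let measurable_J_J t : D t ->
  measurable_fun [set: g_sigma_algebraType GJ] (J t : g_sigma_algebraType GJ -> R).
Proof. by move=> Dt; exact: measurable_sigma_gen. Qed.

Lemma comb3_indep c1 c2 c3 t1 t2 t3 (d' : measure_display) (E : measurableType d')
    (Y : g_sigma_algebraType GJ -> E) : D t1 -> D t2 -> D t3 -> measurable_fun setT Y ->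
  forall A B, measurable A -> measurable B ->
    P (comb3 c1 c2 c3 t1 t2 t3 @^-1` A `&` Y @^-1` B) =
    (P (comb3 c1 c2 c3 t1 t2 t3 @^-1` A) * P (Y @^-1` B))%E.
Proof.
move=> D1 D2 D3 mY A B mA mB; apply: ZJindep.
  exact: (sigma_gen_preimage (measurable_comb3_Z c1 c2 c3 D1 D2 D3) mA).
exact: (sigma_gen_preimage mY mB).
Qed.

Lemma gcf_comb3J c1 c2 c3 t1 t2 t3 a r : D t1 -> D t2 -> D t3 -> D r ->
  gcf P (fun w => comb3 c1 c2 c3 t1 t2 t3 w + a * J r w)
    (comb3_var c1 c2 c3 t1 t2 t3 + a ^+ 2 / 2).
Proof.
move=> D1 D2 D3 Dr.
apply: (@gcf_indep_sum _ _ _ P (comb3 c1 c2 c3 t1 t2 t3) (fun w => a * J r w)).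
- exact: measurable_comb3.
- exact: measurable_funM.
- move=> A B mA mB.
  apply: (@comb3_indep _ _ _ _ _ _ _ _ (fun w => a * J r w)) => //.
  by apply: measurable_funM => //; exact: measurable_J_J.
- exact: (gcf_comb3 Zgauss Zcentered Zstat Gamma0).
- by apply: gcf_scale; apply: (gcf_PAR hrho hlambda JPAR); exact: D_ge0.
Qed.

Lemma comb3J_tail c1 c2 c3 t1 t2 t3 r u : D t1 -> D t2 -> D t3 -> D r ->
  0 < u -> let v := comb3_var c1 c2 c3 t1 t2 t3 + 2^-1 in 0 < v ->
  (P [set w | (u < comb3 c1 c2 c3 t1 t2 t3 w + J r w)%R] <=
   (v / u * normal_pdf 0 (Num.sqrt v) u)%:E)%E.
Proof.
move=> D1 D2 D3 Dr u0 v v0.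
have := gcf_comb3J c1 c2 c3 1 D1 D2 D3 Dr; rewrite expr1n mul1r -/v => g.
have mY : measurable_fun setT (fun w => comb3 c1 c2 c3 t1 t2 t3 w + 1 * J r w).
  by apply: measurable_funD; [exact: measurable_comb3|exact: measurable_funM].
have := gcf_law mY v0 g (measurable_itv `]u, +oo[).
rewrite (_ : _ @^-1` _ = [set w | u < comb3 c1 c2 c3 t1 t2 t3 w + J r w]); last first.
  by apply/seteqP; split => w /=; rewrite in_itv/= andbT mul1r.
move=> ->; have := @normal_tail R (Num.sqrt v) u.
by rewrite sqrtr_gt0 sqr_sqrtr; [apply|exact: ltW].
Qed.

Lemma X_law t r (B : set R) : D t -> D r -> measurable B ->
  P [set w | B (Z t w + J r w)] = normal_prob 0 1 B.
Proof.
move=> Dt Dr mB.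
have := gcf_comb3J 1 0 0 1 Dt Dt Dt Dr.
have -> : comb3_var 1 0 0 t t t + 1 ^+ 2 / 2 = 1 by rewrite /comb3_var; field.
move=> g.
have mY : measurable_fun setT (fun w => comb3 1 0 0 t t t w + 1 * J r w).
  by apply: measurable_funD; [exact: measurable_comb3|exact: measurable_funM].
have := gcf_law mY ltr01 g mB; rewrite sqrtr1 => <-.
congr (P _); apply/seteqP; split => w /=; rewrite /comb3 !mul0r !addr0 !mul1r//.
Qed.

(* Z is only assumed independent of J, not of the Poisson process: jumps are
   controlled through the event [J s1 != J s2]. *)
Lemma X_jump t r s1 s2 u : D t -> D r -> 0 <= s1 -> s1 <= s2 -> s2 <= T ->
  (P [set w | (u < Z t w + J r w)%R /\ J s1 w != J s2 w] <=
   (lambda * (s2 - s1))%:E * normal_prob 0 1 `]u, +oo[)%E.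
Proof.
move=> Dt Dr s10 s12 s2T.
have Ds1 : D s1 by rewrite /= in_itv/= s10 (le_trans s12).
have Ds2 : D s2 by rewrite /= in_itv/= s2T (le_trans s10).
have K0 : 0 <= lambda * (s2 - s1) by rewrite mulr_ge0 ?subr_ge0// ltW.
pose Y w : R * bool := (J r w, J s1 w != J s2 w).
have mY0 : measurable_fun [set: g_sigma_algebraType GJ] (Y : g_sigma_algebraType GJ -> R * bool).
  apply: measurable_fun_pair; first exact: measurable_J_J.
  by apply: measurable_neg; apply: measurable_fun_eqr; exact: measurable_J_J.
have mY : measurable_fun setT Y.
  by apply: measurable_fun_pair => //; apply: measurable_neg; exact: measurable_fun_eqr.
pose X := comb3 1 0 0 t t t.
have XE w : X w = Z t w by rewrite /X /comb3 !mul0r !addr0 mul1r.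
have mX : measurable_fun setT X by exact: measurable_comb3.
pose m1 := distribution P (mk_rv P mX).
have ind := @comb3_indep 1 0 0 t t t _ _ Y Dt Dt Dt mY0.
have ind2 := @comb3_indep 1 0 0 t t t _ _ (J r : g_sigma_algebraType GJ -> R) Dt Dt Dt (measurable_J_J Dr).
pose S1 : set (R * (R * bool)) := [set x : R * (R * bool) | (u < x.1 + x.2.1) && x.2.2].
pose S2 : set (R * R) := [set x : R * R | u < x.1 + x.2].
have mS1 : measurable S1.
  apply: measurable_bool; apply: measurable_and.
    apply: measurable_fun_ltr => //; apply: measurable_funD => //.
    exact: (measurableT_comp measurable_fst measurable_snd).
  exact: (measurableT_comp measurable_snd measurable_snd).
have mS2 : measurable S2.
  by apply: measurable_bool; apply: measurable_fun_ltr => //; exact: measurable_funD.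
have [m1f e1] := indep_section (m1 := m1) mX mY ind (fun A mA => erefl) mS1.
have [m2f e2] := indep_section (m1 := m1) mX (mJ r) ind2 (fun A mA => erefl) mS2.
have -> : [set w | (u < Z t w + J r w)%R /\ J s1 w != J s2 w] = [set w | S1 (X w, Y w)].
  by apply/seteqP; split => w; rewrite /S1/= XE => /andP.
have := X_law Dt Dr (measurable_itv `]u, +oo[).
have -> : [set w | `]u, +oo[%classic (Z t w + J r w)] = [set w | S2 (X w, J r w)].
  by apply/seteqP; split => w; rewrite /S2/= XE in_itv/= andbT.
move=> <-; rewrite e1 e2 -ge0_integralZl//.
apply: ge0_le_integral => //.
- exact: measurable_funeM.
(* With the value x of Z frozen, the inequality is the one for J_r on the section, the half-line
   above u - x. *)
- move=> x _; have [|_ h] := @PAR_law_jump _ _ _ P rho lambda J hrho hlambda JPAR s1 s2 r (xsection S2 x) s10 s12 (D_ge0 Dr).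
    exact: measurable_xsection.
  apply: le_trans h; apply: le_measure; rewrite ?inE.
  + by apply: measurable_preimage => //; exact: measurable_xsection.
  + apply: measurableI; first by apply: measurable_preimage => //; exact: measurable_xsection.
    by apply: (@measurable_bool _ _ (fun w => J s1 w != J s2 w)); apply: measurable_neg; exact: measurable_fun_eqr.
  + by move=> w /=; rewrite /xsection/= !inE /S1 /S2/= => /andP[? ?]; split.
Qed.
Let qE0 : q 0 = 0. Proof. by rewrite /q Gamma0 subrr. Qed.

(** The variance of Z_0 + Z_tau is 2 - 2 q(tau). *)
Lemma q_le1 tau : 0 <= tau <= T -> q tau <= 1.
Proof.
move=> /andP[t0 tT].
have D0 : D 0 by rewrite /= in_itv/= lexx ltW.
have Dt : D tau by rewrite /= in_itv/= t0.
have := gcf_ge0 (measurable_comb3 1 1 0 0 tau tau)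
  (gcf_comb3 Zgauss Zcentered Zstat Gamma0 1 1 0 D0 Dt Dt).
by rewrite -/(q _) -/(q _) subr0; lra.
Qed.

Lemma X_crossing s t r u : D s -> D t -> D r -> s <= t -> 0 < q (t - s) ->
  let S := Num.sqrt (q (t - s) / 2) in let c := Num.sqrt (1 - q (t - s) / 2) in
  let f := fun h : R => normal_prob 0 c `]u - h, u + h] in
  measurable_fun setT f /\
  P [set w | Z s w + J r w <= u < Z t w + J r w] = (\int[normal_prob 0 S]_h f h)%E.
Proof.
move=> Ds Dt Dr st Q0 S c f.
have Q1 : q (t - s) <= 1.
  apply: q_le1; rewrite subr_ge0 st/=; move: Ds Dt; rewrite /= !in_itv/= => /andP[s0 _] /andP[_ tT].
  by rewrite lerBlDr (le_trans tT)// lerDl.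
(* H and G are independent, and the event reads u - H < G <= u + H. *)
pose H := comb3 (- 2^-1) 2^-1 0 s t t.
pose G w := comb3 2^-1 2^-1 0 s t t w + 1 * J r w.
have mH : measurable_fun setT H by exact: measurable_comb3.
have mG : measurable_fun setT G.
  by apply: measurable_funD; [exact: measurable_comb3|exact: measurable_funM].
have qtt : q (t - t) = 0 by rewrite subrr.
(* No mixed term in a b appears because Z_s and Z_t have the same variance; this is the independence
   of half-sum and half-difference. *)
have gHG a b : gcf P (fun w => a * H w + b * G w) (a ^+ 2 * (q (t - s) / 2) + b ^+ 2 * (1 - q (t - s) / 2)).
  have := gcf_comb3J ((b - a) / 2) ((b + a) / 2) 0 b Ds Dt Dt Dr.
  have -> : comb3_var ((b - a) / 2) ((b + a) / 2) 0 s t t + b ^+ 2 / 2 =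
    a ^+ 2 * (q (t - s) / 2) + b ^+ 2 * (1 - q (t - s) / 2).
    by rewrite /comb3_var qtt; field.
  by congr (gcf P _ _); apply/funext => w; rewrite /H /G /comb3; field.
have gH : gcf P H (q (t - s) / 2).
  have := gHG 1 0; rewrite expr1n expr0n/= mul0r addr0 mul1r.
  by congr (gcf P _ _); apply/funext => w; rewrite mul1r mul0r addr0.
have gG : gcf P G (1 - q (t - s) / 2).
  have := gHG 0 1; rewrite expr1n expr0n/= mul0r add0r mul1r.
  by congr (gcf P _ _); apply/funext => w; rewrite mul1r mul0r add0r.
pose B : set (measurableTypeR R * R) := [set x | (u - x.1 < x.2) && (x.2 <= u + x.1)].
have mB : measurable B.
  have m1 : measurable_fun setT (fun x : measurableTypeR R * R => x.1 : R) by exact: measurable_fst.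
  apply: measurable_bool; apply: measurable_and.
    by apply: measurable_fun_ltr => //; exact: measurable_funB.
  by apply: measurable_fun_ler => //; exact: measurable_funD.
have v0 : 0 < 1 - q (t - s) / 2 by lra.
have Q2 : 0 < q (t - s) / 2 by rewrite divr_gt0.
have xB (h : R) : P (G @^-1` xsection B h) = normal_prob 0 c `]u - h, u + h].
  rewrite -(gcf_law mG v0 gG)//; congr (P (_ @^-1` _)).
  by apply/seteqP; split => x; rewrite /xsection/= inE /B/= in_itv/=.
have [m1 e1] := @indep_section _ _ _ Omega (measurableTypeR R) R R P H G (normal_prob 0 S) B mH mG
  (fun A C mA mC => gcf_indep mH mG gHG mA mC) (gcf_law mH Q2 gH) mB.
have fE : (fun h : R => P (G @^-1` xsection B h)) = f by apply/funext => h; exact: xB.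
rewrite fE in m1 e1; split; first exact: m1.
rewrite -e1; congr (P _).
apply/seteqP; split => w; rewrite /B/= /G /H /comb3.
  by move=> /andP[h1 h2]; apply/andP; split; lra.
by move=> /andP[h1 h2]; apply/andP; split; lra.
Qed.

(** The half-sum of the two values exceeds u. Its J-part is a mixture of unknown law, so only an
    exponential moment is used: convexity bounds exp(u (J_s + J_t)/2) by the mean of exp(u J_s) and
    exp(u J_t), which involve one time each. The Z-part has variance (1 - q)/2 and provides the
    gain. *)
Lemma X_chernoff s t u : D s -> D t -> s <= t -> q (t - s) < 1 -> 0 < u ->
  (P [set w | (u < Z s w + J s w)%R /\ (u < Z t w + J t w)%R] <=
   (expR (- (u ^+ 2 / 2) - u ^+ 2 * q (t - s) / 4))%:E)%E.
Proof.
move=> Ds Dt st Q1 u0.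
have qtt : q (t - t) = 0 by rewrite subrr.
pose V := comb3 2^-1 2^-1 0 s t t.
pose v := (1 - q (t - s)) / 2.
have v0 : 0 < v by rewrite divr_gt0// subr_gt0.
have mV : measurable_fun setT V by exact: measurable_comb3.
have gV : gcf P V v.
  have := gcf_comb3 Zgauss Zcentered Zstat Gamma0 2^-1 2^-1 0 Ds Dt Dt.
  by congr (gcf P _ _); rewrite -/(q _) -/(q _) qtt /v; field.
pose Y w := (J s w + J t w) / 2.
have mY : measurable_fun setT Y by apply: measurable_funM => //; exact: measurable_funD.
pose m1 := distribution P (mk_rv P mY).
pose B : set (R * R) := [set x | u < x.2 + x.1].
have mB : measurable B.
  by apply: measurable_bool; apply: measurable_fun_ltr => //; exact: measurable_funD.
have ind A C : measurable A -> measurable C -> P (Y @^-1` A `&` V @^-1` C) = (P (Y @^-1` A) * P (V @^-1` C))%E.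
  move=> mA mC; rewrite setIC muleC; apply: (@comb3_indep _ _ _ _ _ _ _ _ Y) => //.
  by apply: measurable_funM => //; apply: measurable_funD; exact: measurable_J_J.
have [mf e1] := indep_section (m1 := m1) mY mV ind (fun A mA => erefl) mB.
have mexp (a b : R) : measurable_fun setT (fun y : R => (expR (a + b * y))%:E).
  by apply/measurable_EFinP; apply: measurableT_comp => //; apply: measurable_funD => //; exact: measurable_funM.
apply: (@le_trans _ _ (P [set w | B (Y w, V w)])).
  apply: le_measure; rewrite ?inE.
  - apply: measurableI; apply: measurable_bool; apply: measurable_fun_ltr => //; exact: measurable_funD.
  - apply: measurable_bool; apply: measurable_fun_ltr => //; exact: measurable_funD.
  - by move=> w [h1 h2]; rewrite /B/= /Y /V /comb3; lra.
rewrite e1.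
apply: (@le_trans _ _ (\int[m1]_y (expR (- u ^+ 2 + u ^+ 2 * v / 2 + u * y))%:E)%E).
  apply: ge0_le_integral => //=.
  move=> y _; have -> : V @^-1` xsection B y = V @^-1` `]u - y, +oo[.
    by apply/seteqP; split => w; rewrite /xsection/= inE /B/= in_itv/= andbT ltrBlDr.
  rewrite (gcf_law mV v0 gV)//.
  apply: (le_trans (normal_chernoff _ _ (ltW u0))); first by rewrite sqrtr_gt0.
  rewrite lee_fin ler_expR sqr_sqrtr; last exact: ltW.
  by nra.
rewrite ge0_integral_distribution//=.
have Jexp r : D r -> (\int[P]_w (expR (u * J r w))%:E = (expR (u ^+ 2 / 4))%:E)%E.
  move=> Dr; transitivity (\int[distribution P (real_rv P (mJ r))]_x (expR (u * x))%:E)%E.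
    rewrite ge0_integral_distribution//=.
    by have := mexp 0 u; under eq_fun do rewrite add0r.
  transitivity (\int[normal_prob 0 (Num.sqrt 2^-1)]_x (expR (u * x))%:E)%E.
    apply: eq_measure_integral => A mA _.
    have [h _] := PAR_law_jump hrho hlambda JPAR (D_ge0 Dr) (lexx r) (D_ge0 Dr) mA.
    exact: h.
  by rewrite normal_mgf ?sqrtr_gt0// sqr_sqrtr//; congr (expR _)%:E; field.
pose K := expR (- u ^+ 2 + u ^+ 2 * v / 2) / 2.
have mJe r : measurable_fun setT (fun w => (expR (u * J r w))%:E).
  by apply/measurable_EFinP; apply: measurableT_comp => //; exact: measurable_funM.
apply: (@le_trans _ _ (\int[P]_w (K%:E * ((expR (u * J s w))%:E + (expR (u * J t w))%:E)))%E).
  apply: ge0_le_integral => //=.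
  - by apply/measurable_EFinP; apply: measurableT_comp => //; apply: measurable_funD => //; exact: measurable_funM.
  - by apply: emeasurable_funM => //; exact: emeasurable_funD.
  - move=> w _; rewrite -EFinD -EFinM lee_fin expRD /K.
    rewrite -[leRHS]mulrA; apply: ler_wpM2l; first exact: expR_ge0.
    have -> : u * Y w = u * J s w / 2 + u * J t w / 2 by rewrite /Y; field.
    have e (x : R) : expR x = expR (x / 2) ^+ 2 by rewrite -expRM_natl; congr expR; field.
    rewrite expRD (e (u * J s w)) (e (u * J t w)).
    move: (expR (u * J s w / 2)) (expR (u * J t w / 2)) => a b.
    by have := sqr_ge0 (a - b); nra.
rewrite ge0_integralZl//=; last 3 first.
- exact: emeasurable_funD.
- by move=> w _; rewrite adde_ge0// lee_fin expR_ge0.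
- by rewrite lee_fin divr_ge0// expR_ge0.
rewrite ge0_integralD//= !Jexp// -EFinD -EFinM lee_fin /K.
rewrite (_ : expR _ / 2 * _ = expR (- u ^+ 2 + u ^+ 2 * v / 2) * expR (u ^+ 2 / 4)); last by field.
by rewrite -expRD ler_expR /v; lra.
Qed.

(** * Two exceedances at distance k on the grid *)

Variables (l2 cq : R).
Hypotheses (l20 : 0 < l2) (cq0 : 0 < cq)
  (qlim : forall e, 0 < e -> exists2 r : R, 0 < r &
     forall h, 0 < h < r -> `|q h - l2 / 2 * h ^+ 2| <= e * h ^+ 2)
  (q_low : forall tau, 0 <= tau <= T -> cq * tau ^+ 2 <= q tau)
  (q_lt1 : forall tau, 0 <= tau <= T -> q tau < 1).

Let X t w := Z t w + J t w.
Let phi (u : R) : R := normal_pdf 0 1 u.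

Let mX t : measurable_fun setT (X t).
Proof. by apply: measurable_funD; exact: measurable_funP. Qed.

Let phi_gt0 u : 0 < phi u.
Proof. by rewrite /phi normal_pdf0E// mulr_gt0 ?expR_gt0// invr_gt0 mul1r sqrtr_gt0 mulr_gt0// pi_gt0. Qed.

Let mgt (Y : Omega -> R) u : measurable_fun setT Y -> measurable [set w | u < Y w].
Proof. by move=> mY; apply: measurable_bool; exact: measurable_fun_ltr. Qed.

Let mjump (Y : Omega -> R) u s t : measurable_fun setT Y -> measurable [set w | u < Y w /\ J s w != J t w].
Proof.
move=> mY; apply: measurableI; first exact: mgt.
by apply: (@measurable_bool _ _ (fun w => J s w != J t w)); apply: measurable_neg; exact: measurable_fun_eqr.
Qed.

Lemma X_jump_pdf t r s1 s2 u : D t -> D r -> 0 <= s1 -> s1 <= s2 -> s2 <= T -> 0 < u ->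
  (P [set w | (u < Z t w + J r w)%R /\ J s1 w != J s2 w] <=
   (lambda * (s2 - s1) * (phi u / u))%:E)%E.
Proof.
move=> Dt Dr s10 s12 s2T u0.
have := @X_jump t r s1 s2 u Dt Dr s10 s12 s2T.
move=> h; apply: (le_trans h); rewrite [leRHS]EFinM; apply: lee_wpmul2l; last exact: normal_tail1.
by rewrite lee_fin mulr_ge0 ?subr_ge0// ltW.
Qed.

Definition cross_event (u s t' t : R) : set Omega :=
  [set w | u < X s w /\ X t' w <= u < X t w].

Lemma measurable_cross_event u s t' t : measurable (cross_event u s t' t).
Proof.
apply: measurableI; first exact: mgt.
by apply: (@measurable_bool _ _ (fun w => X t' w <= u < X t w)); apply: measurable_and; [exact: measurable_fun_ler|exact: measurable_fun_ltr].
Qed.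

Lemma comb3J_tail_le c1 c2 c3 t1 t2 t3 r u Th : D t1 -> D t2 -> D t3 -> D r ->
  0 < u -> comb3_var c1 c2 c3 t1 t2 t3 + 2^-1 = 1 - 2 * Th -> 0 <= Th -> 0 < 1 - 2 * Th ->
  (P [set w | (u < comb3 c1 c2 c3 t1 t2 t3 w + J r w)%R] <=
   (phi u / u * expR (- (u ^+ 2 * Th)))%:E)%E.
Proof.
move=> D1 D2 D3 Dr u0 e Th0 w0.
have := @comb3J_tail c1 c2 c3 t1 t2 t3 r u D1 D2 D3 Dr u0.
rewrite /= e => /(_ w0) h; apply: (le_trans h); rewrite lee_fin; exact: normal_pdf_variance_le.
Qed.

(* Both X_s and X_t exceed u. For k^4 <= u the tail of their half-sum is
   compared with phi(u) on {J_s = J_t}; for k^4 > u Chernoff's bound loses a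
   factor u but needs no control of the jumps. *)
Lemma pair_dominated (a : R) : 0 < a -> exists2 C : R, 0 <= C &
  forall (u dl s t' : R) (k : nat), 1 <= u -> a / 2 <= u * dl <= a -> (0 < k)%N ->
    0 <= s -> s + k%:R * dl <= T ->
    (P (cross_event u s t' (s + k%:R * dl)) <= (C / k%:R ^+ 2 * (phi u / u))%:E)%E.
Proof.
(* Chosen so that u^2 q(k dl) / 4 >= b k^2, from q(tau) >= cq tau^2 and u dl >= a/2. *)
move=> a0; pose b := cq * a ^+ 2 / 16.
have b0 : 0 < b by rewrite divr_gt0// mulr_gt0// exprn_gt0.
pose r : R := Num.sqrt (2 * pi).
have r0 : 0 < r by rewrite sqrtr_gt0 mulr_gt0// pi_gt0.
have C1 : 0 <= b^-1 + lambda * a by rewrite addr_ge0 ?invr_ge0 ?mulr_ge0// ltW.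
have C2 : 0 <= r * 6 / b ^+ 3 by rewrite divr_ge0 ?mulr_ge0 ?exprn_ge0 ?(ltW r0)// ltW.
exists (b^-1 + lambda * a + r * 6 / b ^+ 3); first exact: addr_ge0.
move=> u dl s t' k u1 /andP[ud1 ud2] k0 s0 tT.
have u0 : 0 < u by rewrite (lt_le_trans ltr01).
have dl0 : 0 < dl by rewrite -(pmulr_rgt0 dl u0) (lt_le_trans _ ud1)// divr_gt0.
have k1 : 1 <= k%:R :> R by rewrite ler1n.
set K : R := k%:R in k1 tT *; set t := s + K * dl.
have K0 : 0 < K by rewrite (lt_le_trans ltr01).
have Kd0 : 0 < K * dl by rewrite mulr_gt0.
have ts : t - s = K * dl by rewrite /t; ring.
have st : s <= t by rewrite lerDl ltW.
have Ds : D s by rewrite /= in_itv/= s0 (le_trans st).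
have Dt : D t by rewrite /= in_itv/= tT (le_trans s0).
have Q0 : cq * (K * dl) ^+ 2 <= q (K * dl) by rewrite q_low// ltW//= -ts lerBlDr (le_trans tT)// lerDl.
have Q1 : q (K * dl) < 1 by rewrite q_lt1// ltW//= -ts lerBlDr (le_trans tT)// lerDl.
have Qge0 : 0 <= q (K * dl) by rewrite (le_trans _ Q0)// mulr_ge0 ?sqr_ge0// ltW.
have y0 : b * K ^+ 2 <= u ^+ 2 * (q (K * dl) / 4).
  have h1 : (a / 2) ^+ 2 <= (u * dl) ^+ 2 by rewrite ler_sqr ?nnegrE// ?divr_ge0 ?mulr_ge0// ltW.
  have h2 : u ^+ 2 * (cq * (K * dl) ^+ 2) <= u ^+ 2 * q (K * dl) by rewrite ler_wpM2l ?sqr_ge0.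
  have h3 : cq * K ^+ 2 * (a / 2) ^+ 2 <= cq * K ^+ 2 * (u * dl) ^+ 2 by rewrite ler_wpM2l// mulr_ge0 ?sqr_ge0// ltW.
  have e1 : b * K ^+ 2 = cq * K ^+ 2 * (a / 2) ^+ 2 / 4 by rewrite /b; field.
  have e2 : u ^+ 2 * (cq * (K * dl) ^+ 2) = cq * K ^+ 2 * (u * dl) ^+ 2 by ring.
  by rewrite e1; lra.
have bK : 0 < b * K ^+ 2 by rewrite mulr_gt0// exprn_gt0.
have mE : measurable (cross_event u s t' t) by exact: measurable_cross_event.
have [Ku|Ku] := leP (K ^+ 4) u.
  pose Y := comb3 2^-1 2^-1 0 s t t.
  have mY : measurable_fun setT (fun w => Y w + J s w).
    by apply: measurable_funD; [exact: measurable_comb3|exact: measurable_funP].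
  have b1 : (P [set w | (u < Y w + J s w)%R] <= (phi u / u * expR (- (u ^+ 2 * (q (K * dl) / 4))))%:E)%E.
    apply: comb3J_tail_le => //.
    - by rewrite /comb3_var ts subrr -/(q _) -/(q _) /q Gamma0; field.
    - by rewrite divr_ge0.
    - by lra.
  have b2 := X_jump_pdf Ds Ds s0 st tT u0.
  have b3 : (P (cross_event u s t' t) <= (phi u / u * expR (- (u ^+ 2 * (q (K * dl) / 4))) + lambda * (t - s) * (phi u / u))%:E)%E.
    apply: prob_le_cover b1 b2 => //; [exact: mgt|exact: (mjump u s t (mX s))|].
    move=> w [h1 /andP[_ h2]]; have [Je|Jn] := eqVneq (J s w) (J t w); last by right.
    by left; move: h1 h2; rewrite /= /X /Y /comb3 -Je; lra.
  apply: (le_trans b3); rewrite lee_fin ts.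
  have pu : 0 <= phi u / u by rewrite divr_ge0// ltW.
  rewrite [phi u / u * _]mulrC -mulrDl; apply: ler_wpM2r => //.
  apply: (@le_trans _ _ ((b^-1 + lambda * a) / K ^+ 2)); last first.
    by rewrite ler_pM2r ?invr_gt0 ?exprn_gt0// lerDl.
  rewrite [leRHS]mulrDl; apply: lerD.
    apply: (@le_trans _ _ (expR (- (b * K ^+ 2)))); first by rewrite ler_expR lerN2.
    by apply: (le_trans (expRN_le_inv bK)); rewrite invfM.
  rewrite -!mulrA ler_wpM2l ?(ltW hlambda)// ler_pdivlMr ?exprn_gt0//.
  (* The jump cost lambda K dl must be O(1/K^2), that is K^3 dl bounded; K^4 <= u reduces this to u
     dl <= a. *)
  have h : K ^+ 3 * dl <= u * dl.
    rewrite ler_pM2r// (le_trans _ Ku)// ler_weXn2l//.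
  by move: h; nra.
have b1 := @X_chernoff s t u Ds Dt st.
rewrite ts in b1; have {}b1 := b1 Q1 u0.
apply: (@le_trans _ _ (P [set w | u < X s w /\ u < X t w])).
  apply: le_measure; rewrite ?inE//.
    by apply: measurableI; exact: mgt.
  by move=> w [h1 /andP[_ h2]].
apply: (le_trans b1); rewrite lee_fin.
have phiE : expR (- (u ^+ 2 / 2)) = r * phi u.
  by rewrite /phi normal_pdf0E// mul1r expr1n mulr1 -/r mulVKf// gt_eqF.
rewrite -[u ^+ 2 * q _ / 4]mulrA expRD phiE -mulrA.
apply: (@le_trans _ _ (r * 6 / b ^+ 3 / K ^+ 2 * (phi u / u))); last first.
  apply: ler_wpM2r; first by rewrite divr_ge0// ltW.
  by rewrite ler_pM2r ?invr_gt0 ?exprn_gt0// lerDr.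
rewrite (_ : r * (phi u * _) = (phi u / u) * (u * r * expR (- (u ^+ 2 * (q (K * dl) / 4))))); last first.
  by field; rewrite gt_eqF.
rewrite [leRHS]mulrC; apply: ler_wpM2l; first by rewrite divr_ge0// ltW.
apply: (@le_trans _ _ (K ^+ 4 * r * (6 / (b * K ^+ 2) ^+ 3))).
  apply: ler_pM; rewrite ?expR_ge0 ?mulr_ge0 ?(ltW u0) ?(ltW r0)//.
    by rewrite ler_pM2r// ltW.
  apply: le_trans (expRN_le_inv3 bK).
  by rewrite ler_expR lerN2.
rewrite le_eqVlt; apply/orP; left; apply/eqP; field.
by rewrite !gt_eqF.
Qed.

(* With p = (k - 1) / k, on the event W = (1 - p) X_s + p X_t - X_t' > 0, so that
   X_s + B W > u; this variable has variance 1 - l2 B (k - 1) dl^2 + o(dl^2), and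
   B is chosen large. *)
Lemma pair_negligible (a e : R) (k : nat) : 0 < a -> 0 < e -> (1 < k)%N ->
  exists U : R, forall u dl s : R, U <= u -> a / 2 <= u * dl <= a ->
    0 <= s -> s + k%:R * dl <= T ->
    (P (cross_event u s (s + k.-1%:R * dl) (s + k%:R * dl)) <= (e * (phi u / u))%:E)%E.
Proof.
move=> a0 e0 k1.
(* Makes u^2 Th at least l2 B (a/2)^2 / 4 = 3/e, hence the exponential factor at most e/3. *)
pose B := 48 / (e * a ^+ 2 * l2).
have B0 : 0 < B by rewrite divr_gt0// !mulr_gt0// exprn_gt0.
have k0 : (0 < k)%N by exact: leq_trans k1.
set K : R := k%:R; set L : R := k.-1%:R.
have KL : K = L + 1 by rewrite /K /L -(prednK k0)/= -natr1.
have L1 : 1 <= L by rewrite /L ler1n -ltnS prednK.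
have K0 : 0 < K by rewrite /K ltr0n.
move: KL L1 K0; move: K L => {k k1 k0} K L KL L1 K0.
pose c1 := 1 + B * (1 / K); pose c2 := - B; pose c3 := B * (L / K).
pose Th dl := c1 * c2 * q (L * dl) + c1 * c3 * q (K * dl) + c2 * c3 * q dl.
pose M := `|c1 * c2| * L ^+ 2 + `|c1 * c3| * K ^+ 2 + `|c2 * c3|.
have M0 : 0 < M + 1.
  rewrite ltr_pwDr//; apply: addr_ge0; last exact: normr_ge0.
  by apply: addr_ge0; apply: mulr_ge0; rewrite ?normr_ge0 ?sqr_ge0.
have L0 : 0 < L by rewrite (lt_le_trans ltr01).
have N0 : 0 < l2 * B * L / 4 by rewrite divr_gt0// mulr_gt0// mulr_gt0.
have [rr rr0 rrP] := qlim (divr_gt0 N0 M0).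
(* The terms in B^2 cancel at order dl^2 because the weights of W annihilate affine functions of
   time. The main term stays linear in B, so a large B is a pure gain. *)
have ThE dl : 0 < dl -> K * dl < rr -> `|Th dl - l2 / 2 * (B * L) * dl ^+ 2| <= l2 * B * L / 4 * dl ^+ 2.
  move=> dl0 Kr.
  have hL : L * dl < rr by apply: le_lt_trans Kr; rewrite ler_pM2r// KL lerDl.
  have h1 : dl < rr by apply: le_lt_trans hL; rewrite ler_peMl// ltW.
  have := rrP (L * dl); rewrite mulr_gt0// hL => /(_ isT).
  have := rrP (K * dl); rewrite mulr_gt0// Kr => /(_ isT).
  have := rrP dl; rewrite dl0 h1 => /(_ isT).
  set e' := _ / (M + 1) => g1 gK gL.
  have -> : Th dl - l2 / 2 * (B * L) * dl ^+ 2 =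
      c1 * c2 * (q (L * dl) - l2 / 2 * (L * dl) ^+ 2) +
      c1 * c3 * (q (K * dl) - l2 / 2 * (K * dl) ^+ 2) + c2 * c3 * (q dl - l2 / 2 * dl ^+ 2).
    by rewrite /Th /c1 /c2 /c3 KL; field; rewrite -KL gt_eqF.
  apply: (@le_trans _ _ (e' * M * dl ^+ 2)); last first.
    rewrite ler_wpM2r ?sqr_ge0// /e' -mulrA ler_piMr ?(ltW N0)// ler_pdivrMl//.
    by rewrite mulr1 lerDl.
  apply: (le_trans (ler_normD _ _)).
  rewrite (_ : e' * M * dl ^+ 2 = (`|c1 * c2| * (e' * (L * dl) ^+ 2) + `|c1 * c3| * (e' * (K * dl) ^+ 2)) + `|c2 * c3| * (e' * dl ^+ 2)); last by rewrite /M; ring.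
  apply: lerD; last by rewrite normrM ler_wpM2l.
  apply: (le_trans (ler_normD _ _)).
  by apply: lerD; rewrite normrM ler_wpM2l.
(* In this order the thresholds give u >= 1, a step small enough for the expansion of q, a positive
   variance 1 - 2 Th, and a jump cost of at most e/3. *)
pose U := Num.max 1 (Num.max (2 * K * a / rr) (Num.max (a ^+ 2 * l2 * B * L * 4) (3 * lambda * K * a / e))).
exists U => u dl s Uu /andP[ud1 ud2] s0 tT.
move: Uu; rewrite /U !ge_max => /andP[u1 /andP[u2 /andP[u3 u4]]].
have u0 : 0 < u by rewrite (lt_le_trans ltr01).
have dl0 : 0 < dl by rewrite -(pmulr_rgt0 dl u0) (lt_le_trans _ ud1)// divr_gt0.
have dlu : dl <= a / u by rewrite ler_pdivlMr// mulrC.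
have Kr : K * dl < rr.
  apply: (@le_lt_trans _ _ (K * a / u)); first by rewrite -mulrA ler_pM2l.
  rewrite ltr_pdivrMr//; move: u2; rewrite ler_pdivrMr// [rr * u]mulrC.
  by have : 0 < K * a by [rewrite mulr_gt0]; lra.
have := ThE dl dl0 Kr; rewrite ler_norml => /andP[Th1 Th2].
set t := s + K * dl; set t' := s + L * dl.
have tt' : t - t' = dl by rewrite /t /t' KL; ring.
have st' : s <= t' by rewrite lerDl mulr_ge0// ltW.
have t't : t' <= t by rewrite -subr_ge0 tt' ltW.
have st : s <= t by exact: le_trans t't.
have Ds : D s by rewrite /= in_itv/= s0 (le_trans st).
have Dt : D t by rewrite /= in_itv/= tT (le_trans s0).
have Dt' : D t' by rewrite /= in_itv/= (le_trans s0)// (le_trans t't).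
have mE : measurable (cross_event u s t' t) by exact: measurable_cross_event.
have ge1 : l2 * B * L / 4 * dl ^+ 2 <= Th dl by lra.
have Th0 : 0 <= Th dl by rewrite (le_trans _ ge1)// mulr_ge0 ?sqr_ge0// ltW.
have Thlt : 0 < 1 - 2 * Th dl.
  have h1 : dl ^+ 2 <= (a / u) ^+ 2 by rewrite ler_sqr ?nnegrE// ?divr_ge0// ltW.
  have h2 : (a / u) ^+ 2 * (l2 * B * L * 4) <= 1.
    rewrite exprMn exprVn mulrAC ler_pdivrMr ?exprn_gt0// mul1r.
    apply: (@le_trans _ _ u); last by rewrite expr2 ler_peMl// ltW.
    by apply: le_trans u3; rewrite le_eqVlt; apply/orP; left; apply/eqP; ring.
  have h3 : dl ^+ 2 * (l2 * B * L * 4) <= 1 by apply: le_trans h2; apply: ler_wpM2r => //; lra.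
  nra.
pose Y := comb3 c1 c2 c3 s t' t.
have mY : measurable_fun setT (fun w => Y w + J s w).
  by apply: measurable_funD; [exact: measurable_comb3|exact: measurable_funP].
have b1 : (P [set w | (u < Y w + J s w)%R] <= (phi u / u * expR (- (u ^+ 2 * Th dl)))%:E)%E.
  apply: comb3J_tail_le => //.
  have -> : comb3_var c1 c2 c3 s t' t = (c1 + c2 + c3) ^+ 2 / 2 - 2 * (c1 * c2 * q (t' - s) + c1 * c3 * q (t - s) + c2 * c3 * q (t - t')) by [].
  have e1 : t' - s = L * dl by rewrite /t'; ring.
  have e2 : t - s = K * dl by rewrite /t; ring.
  rewrite tt' e1 e2.
  have -> : c1 + c2 + c3 = 1 by rewrite /c1 /c2 /c3 KL; field; rewrite -KL gt_eqF.
  by rewrite /Th; field.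
have b2 := X_jump_pdf Ds Ds s0 st' (le_trans t't tT) u0.
have b3 := X_jump_pdf Dt Dt (le_trans s0 st') t't tT u0.
have b4 : (P (cross_event u s t' t) <= (phi u / u * expR (- (u ^+ 2 * Th dl)) +
    (lambda * (t' - s) * (phi u / u) + lambda * (t - t') * (phi u / u)))%:E)%E.
  pose J1 := [set w | u < X s w /\ J s w != J t' w].
  pose J2 := [set w | u < X t w /\ J t' w != J t w].
  have mJ1 : measurable J1 by exact: mjump.
  have mJ2 : measurable J2 by exact: mjump.
  have bJ : (P (J1 `|` J2) <= (lambda * (t' - s) * (phi u / u) + lambda * (t - t') * (phi u / u))%:E)%E.
    by apply: prob_le_cover b2 b3 => //; exact: measurableU.
  apply: prob_le_cover b1 bJ => //; [exact: mgt|exact: measurableU|].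
  move=> w [h1 /andP[h2 h3]]; have [Je|Jn] := eqVneq (J s w) (J t' w); last by right; left.
  have [Je'|Jn'] := eqVneq (J t' w) (J t w); last by right; right.
  left; move: h1 h2 h3; rewrite /= /X /Y /comb3 -Je' -Je; set j := J s w; move: (Z s w) (Z t' w) (Z t w) => z z' z'' h1 h2 h3.
  rewrite (_ : _ + j = z + j + B / K * ((z + j) + L * (z'' + j) - K * (z' + j))); last first.
    by rewrite /c1 /c2 /c3 KL; field; rewrite -KL gt_eqF.
  have : 0 <= B / K * ((z + j) + L * (z'' + j) - K * (z' + j)).
    apply: mulr_ge0; first exact: divr_ge0 (ltW B0) (ltW K0).
    rewrite KL.
    have : L * u <= L * (z'' + j) by rewrite ler_pM2l// ltW.
    have : (L + 1) * (z' + j) <= (L + 1) * u by rewrite ler_pM2l// -KL.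
    lra.
  by lra.
apply: (le_trans b4); rewrite lee_fin.
rewrite [phi u / u * _]mulrC -!mulrDl; apply: ler_wpM2r; first by rewrite divr_ge0// ltW.
have -> : lambda * (t' - s) + lambda * (t - t') = lambda * K * dl by rewrite /t; ring.
have h1 : expR (- (u ^+ 2 * Th dl)) <= e / 3.
  have y0 : 3 / e <= u ^+ 2 * Th dl.
    have g1 : (a / 2) ^+ 2 <= (u * dl) ^+ 2 by rewrite ler_sqr ?nnegrE// ?divr_ge0 ?mulr_ge0// ltW.
    have g2 : u ^+ 2 * (l2 * B * L / 4 * dl ^+ 2) <= u ^+ 2 * Th dl by rewrite ler_wpM2l ?sqr_ge0.
    apply: le_trans g2.
    have -> : u ^+ 2 * (l2 * B * L / 4 * dl ^+ 2) = L * (l2 * B / 4 * (u * dl) ^+ 2) by field.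
    apply: (@le_trans _ _ (l2 * B / 4 * (a / 2) ^+ 2)).
      by rewrite le_eqVlt; apply/orP; left; apply/eqP; rewrite /B; field; rewrite !gt_eqF.
    have g3 : l2 * B / 4 * (a / 2) ^+ 2 <= l2 * B / 4 * (u * dl) ^+ 2.
      by rewrite ler_wpM2l// ltW// divr_gt0// mulr_gt0.
    apply: (le_trans g3); rewrite ler_peMl//; apply: mulr_ge0; last exact: sqr_ge0.
    by rewrite ltW// divr_gt0// mulr_gt0.
  have e3 : 0 < 3 / e by rewrite divr_gt0.
  apply: (@le_trans _ _ (expR (- (3 / e)))); first by rewrite ler_expR lerN2.
  by apply: (le_trans (expRN_le_inv e3)); rewrite invf_div.
have h2 : lambda * K * dl <= e / 3.
  apply: (@le_trans _ _ (lambda * K * (a / u))); first by rewrite ler_pM2l// mulr_gt0.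
  rewrite mulrA ler_pdivrMr//; move: u4; rewrite ler_pdivrMr//; lra.
by lra.
Qed.

(** * Probability of one upcrossing *)

Let kap : R := Num.sqrt (l2 / (2 * pi)).
Let L : R := l2 / 2 + 1.

Let kap0 : 0 < kap. Proof. by rewrite sqrtr_gt0 divr_gt0// mulr_gt0// pi_gt0. Qed.
Let L0 : 0 < L. Proof. by rewrite addr_gt0// divr_gt0. Qed.

Let q_gt0 tau : 0 < tau <= T -> 0 < q tau.
Proof.
move=> /andP[t0 tT]; apply: (lt_le_trans _ (q_low _)); last by rewrite (ltW t0) tT.
by rewrite mulr_gt0// exprn_gt0.
Qed.

Let q_up : exists2 r : R, 0 < r & forall h, 0 < h < r -> q h <= L * h ^+ 2.
Proof.
have [r r0 hr] := qlim ltr01; exists r => // h /hr.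
by rewrite ler_norml mul1r => /andP[_]; rewrite /L mulrDl mul1r; lra.
Qed.

(** Divide q(h)/pi - kap^2 h^2, a difference of squares, by the sum of the roots, which is at least
    kap h. Through this expansion the Rice rate kap phi(u) appears. *)
Lemma sqrt_q_asym (e : R) : 0 < e -> exists2 r : R, 0 < r &
  forall h, 0 < h < r -> h <= T -> `|Num.sqrt (q h / pi) - kap * h| <= e * h.
Proof.
move=> e0; have pi0 : 0 < pi :> R by exact: pi_gt0.
have e1 : 0 < e * pi * kap by rewrite !mulr_gt0.
have [r r0 hr] := qlim e1; exists r => // h hh hT'; have h0 : 0 < h by case/andP: hh.
have {hr} := hr h hh.
set s := Num.sqrt (q h / pi).
have s0 : 0 <= s by exact: sqrtr_ge0.
have s2 : s ^+ 2 = q h / pi by rewrite sqr_sqrtr// divr_ge0 ?(ltW pi0)// ltW// q_gt0// h0 hT'.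
have k2 : kap ^+ 2 = l2 / (2 * pi) by rewrite sqr_sqrtr// divr_ge0 ?(ltW l20)// mulr_ge0// ltW.
have -> : q h - l2 / 2 * h ^+ 2 = pi * ((s - kap * h) * (s + kap * h)).
  have -> : (s - kap * h) * (s + kap * h) = s ^+ 2 - kap ^+ 2 * h ^+ 2 by ring.
  by rewrite s2 k2; move: (@pi R) pi0 => p p0; field; rewrite gt_eqF.
have kh0 : 0 < kap * h by rewrite mulr_gt0.
rewrite !normrM (gtr0_norm pi0) (ger0_norm (addr_ge0 s0 (ltW kh0))) => hq.
have h3 : pi * kap * h * `|s - kap * h| <= pi * kap * h * (e * h).
  apply: (@le_trans _ _ (pi * (`|s - kap * h| * (s + kap * h)))).
    rewrite -!mulrA ler_pM2l// mulrA mulrC ler_wpM2l// lerDr//.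
  by apply: (le_trans hq); rewrite le_eqVlt; apply/orP; left; apply/eqP; ring.
by rewrite -(ler_pM2l (_ : 0 < pi * kap * h))// mulr_gt0// mulr_gt0.
Qed.

Definition upcrossing (u s t : R) : set Omega := [set w | X s w <= u < X t w].

Lemma measurable_upcrossing u s t : measurable (upcrossing u s t).
Proof.
apply: (@measurable_bool _ _ (fun w => X s w <= u < X t w)).
by apply: measurable_and; [exact: measurable_fun_ler|exact: measurable_fun_ltr].
Qed.

Let upcrossing_Z u s t : set Omega := [set w | Z s w + J s w <= u < Z t w + J s w].

Let measurable_upcrossing_Z u s t : measurable (upcrossing_Z u s t).
Proof.
have m r : measurable_fun setT (fun w => Z r w + J s w) by apply: measurable_funD; exact: measurable_funP.
apply: (@measurable_bool _ _ (fun w => Z s w + J s w <= u < Z t w + J s w)).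
by apply: measurable_and; [exact: measurable_fun_ler|exact: measurable_fun_ltr].
Qed.

Let measurable_jump r u s t : measurable [set w | u < Z t w + J r w /\ J s w != J t w].
Proof.
have m : measurable_fun setT (fun w => Z t w + J r w) by apply: measurable_funD; exact: measurable_funP.
apply: measurableI; first by apply: measurable_bool; exact: measurable_fun_ltr.
by apply: (@measurable_bool _ _ (fun w => J s w != J t w)); apply: measurable_neg; exact: measurable_fun_eqr.
Qed.

(** Here u is fixed and dl tends to 0, so q(dl) u^2 is as small as desired and the Young parameter
    eta can be fixed by e alone. *)
Lemma upcrossing_le (u e : R) : 0 < u -> 0 < e -> exists2 r : R, 0 < r &
  forall dl s, 0 < dl < r -> 0 <= s -> s + dl <= T ->
   (P (upcrossing u s (s + dl)) <= (dl * ((kap + e) * phi u + lambda * (phi u / u)))%:E)%E.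
Proof.
move=> u0 e0.
have ke : 0 < kap + e by rewrite addr_gt0.
(* Solves (kap + e) (1 - 2 eta) = kap + e/2, leaving e/2 for the error in the square root of q. *)
pose eta := e / (4 * (kap + e)).
have eta0 : 0 < eta by rewrite divr_gt0// mulr_gt0.
have e2 : 0 < e / 2 by rewrite divr_gt0.
have [r1 r10 h1] := sqrt_q_asym e2.
have [r2 r20 h2] := q_up.
pose V := L * (1 / 2 + u ^+ 2 / eta).
have V0 : 0 < V by rewrite mulr_gt0// addr_gt0// divr_gt0// exprn_gt0.
pose r := Num.min (Num.min r1 r2) (Num.min 1 (eta / V)).
exists r; first by rewrite /r !lt_min r10 r20 ltr01 divr_gt0.
move=> dl s /andP[dl0]; rewrite /r !lt_min => /andP[/andP[dr1 dr2] /andP[d1 d2]] s0 tT.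
set t := s + dl in tT *.
have ts : t - s = dl by rewrite /t; ring.
have st : s <= t by rewrite lerDl ltW.
have Ds : D s by rewrite /= in_itv/= s0 (le_trans st).
have Dt : D t by rewrite /= in_itv/= tT (le_trans s0).
have dT : dl <= T by rewrite -ts lerBlDr (le_trans tT)// lerDl.
have Q0 : 0 < q dl by rewrite q_gt0// dl0 dT.
have Q1 : q dl < 1 by rewrite q_lt1// (ltW dl0) dT.
have dd : 0 < dl < r1 by rewrite dl0 dr1.
have := h1 dl dd dT; rewrite ler_norml => /andP[_ hs].
have hq : q dl <= L * dl by apply: (le_trans (h2 dl _)); rewrite ?dl0//; apply: ler_wpM2l; [exact: ltW|rewrite expr2 ler_piMl// ltW].
have hx : q dl / 2 + q dl * u ^+ 2 / eta <= eta.
  have -> : q dl / 2 + q dl * u ^+ 2 / eta = q dl * (1 / 2 + u ^+ 2 / eta) by field; rewrite gt_eqF.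
  have w0 : 0 <= 1 / 2 + u ^+ 2 / eta by rewrite addr_ge0// divr_ge0 ?sqr_ge0// ltW.
  apply: (le_trans (ler_wpM2r w0 hq)).
  by rewrite mulrAC -/V mulrC -ler_pdivlMr// ltW.
have etaE : 4 * ((kap + e) * eta) = e by rewrite /eta; field; rewrite gt_eqF.
have eta4 : 4 * eta < 1.
  rewrite -(ltr_pM2l ke) mulr1 mulrCA etaE; have := kap0; lra.
have den0 : 0 < 1 - eta - (q dl / 2 + q dl * u ^+ 2 / eta) by lra.
have [S1 S2] := @crossing_upper_asym R (q dl) u Q0 Q1 eta eta0 den0.
have [mf eZ] := @X_crossing s t s u Ds Dt Ds st (ltac:(by rewrite ts)).
rewrite ts -/(q _) in mf eZ.
have sS : 0 < Num.sqrt (q dl / 2) by rewrite sqrtr_gt0 divr_gt0.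
have sc : 0 < Num.sqrt (1 - q dl / 2) by rewrite sqrtr_gt0; lra.
have bZ : (P (upcrossing_Z u s t) <= (dl * ((kap + e) * phi u))%:E)%E.
  rewrite /upcrossing_Z eZ; apply: (le_trans (crossing_integral_le sS sc u0 eta0 mf S1)).
  rewrite lee_fin; apply: (le_trans S2); rewrite -/(phi u).
  rewrite [in leRHS]mulrA [leRHS]mulrC; apply: ler_wpM2l; first exact: ltW.
  rewrite ler_pdivrMr//; set den := 1 - eta - _ in den0 *.
  have hden : 1 - 2 * eta <= den by rewrite /den; lra.
  have g1 : (kap + e) * (1 - 2 * eta) <= (kap + e) * den by rewrite ler_wpM2l// ltW.
  have g2 : kap + e / 2 <= (kap + e) * den by lra.
  have g3 : dl * (kap + e / 2) <= dl * ((kap + e) * den) by rewrite ler_wpM2l// ltW.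
  by rewrite -mulrA; lra.
have bJ := @X_jump_pdf t t s t u Dt Dt s0 st tT u0.
rewrite mulrDr (_ : dl * (lambda * _) = lambda * (t - s) * (phi u / u)); last by rewrite ts; ring.
apply: prob_le_cover bZ bJ => //.
- exact: measurable_upcrossing.
- move=> w /andP[h3 h4]; have [Je|Jn] := eqVneq (J s w) (J t w); last by right.
  by left; apply/andP; split => //; rewrite Je.
Qed.

(** Here u dl is of order a, so u^2 q(dl) is only O(a^2) and does not vanish as u grows. Taking a
    itself as Young parameter makes u^2 q(dl) / a an O(a), like all other errors. *)
Lemma upcrossing_ge (e : R) : 0 < e -> exists2 a0 : R, 0 < a0 & forall a, 0 < a <= a0 ->
  exists U : R, forall u dl s, U <= u -> a / 2 <= u * dl <= a -> 0 <= s -> s + dl <= T ->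
   ((dl * ((kap - e) * phi u - lambda * (phi u / u)))%:E <= P (upcrossing u s (s + dl)))%E.
Proof.
move=> e0.
(* Sum of the relative errors in units of a: L/2 and 1 from the exponentials, L twice from the
   denominator. *)
pose V := 5 / 2 * L + 1.
have V0 : 0 < V by rewrite addr_gt0// mulr_gt0.
have kV : 0 < 2 * (kap * V) by rewrite !mulr_gt0.
exists (Num.min (Num.min 1 V^-1) (e / (2 * (kap * V)))).
  by rewrite !lt_min ltr01 invr_gt0 V0 divr_gt0.
move=> a /andP[a0]; rewrite !le_min => /andP[/andP[a1 aV1]]; rewrite ler_pdivlMr// => aV.
have {}aV1 : V * a <= 1 by rewrite -(mulfV (lt0r_neq0 V0)) ler_pM2l.
have e2 : 0 < e / 2 by rewrite divr_gt0.
have [r1 r10 h1] := sqrt_q_asym e2.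
have [r2 r20 h2] := q_up.
exists (Num.max 1 (Num.max (2 * a / r1) (2 * a / r2))) => u dl s.
rewrite !ge_max => /andP[u1 /andP[ur1 ur2]] /andP[ud1 ud2] s0 tT.
have u0 : 0 < u by rewrite (lt_le_trans ltr01).
have dl0 : 0 < dl by rewrite -(pmulr_rgt0 dl u0) (lt_le_trans _ ud1)// divr_gt0.
have dlu : dl <= a / u by rewrite ler_pdivlMr// mulrC.
have small r' : 0 < r' -> 2 * a / r' <= u -> dl < r'.
  move=> r'0 h; apply: (le_lt_trans dlu); rewrite ltr_pdivrMr//.
  by move: h; rewrite ler_pdivrMr// [r' * u]mulrC; lra.
have dr1 := small _ r10 ur1; have dr2 := small _ r20 ur2.
set t := s + dl in tT *.
have ts : t - s = dl by rewrite /t; ring.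
have st : s <= t by rewrite lerDl ltW.
have Ds : D s by rewrite /= in_itv/= s0 (le_trans st).
have Dt : D t by rewrite /= in_itv/= tT (le_trans s0).
have dT : dl <= T by rewrite -ts lerBlDr (le_trans tT)// lerDl.
have Q0 : 0 < q dl by rewrite q_gt0// dl0 dT.
have Q1 : q dl < 1 by rewrite q_lt1// (ltW dl0) dT.
have dd : 0 < dl < r1 by rewrite dl0 dr1.
have := h1 dl dd dT; rewrite ler_norml => /andP[hs _].
have hq : q dl <= L * dl ^+ 2 by apply: h2; rewrite dl0.
have [mf eZ] := @X_crossing s t s u Ds Dt Ds st (ltac:(by rewrite ts)).
rewrite ts -/(q _) in mf eZ.
have sS : 0 < Num.sqrt (q dl / 2) by rewrite sqrtr_gt0 divr_gt0.
have sc : 0 < Num.sqrt (1 - q dl / 2) by rewrite sqrtr_gt0; lra.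
have S1 := @crossing_lower_asym R (q dl) u Q0 Q1 a a0.
have bZ : ((dl * ((kap - e) * phi u))%:E <= P (upcrossing_Z u s t))%E.
  rewrite /upcrossing_Z eZ; apply: le_trans (crossing_integral_ge sS sc u0 a0 mf).
  rewrite lee_fin; apply: le_trans S1; rewrite -/(phi u).
  rewrite mulrA [leLHS]mulrC; apply: ler_wpM2l; first exact: ltW.
  set sq := Num.sqrt (q dl / pi) in hs *.
  have sq0 : 0 <= sq by exact: sqrtr_ge0.
  have hu : u ^+ 2 * q dl <= L * a ^+ 2.
    have g1 : (u * dl) ^+ 2 <= a ^+ 2 by rewrite ler_sqr ?nnegrE// ?mulr_ge0// ltW.
    apply: (@le_trans _ _ (u ^+ 2 * (L * dl ^+ 2))); first by rewrite ler_wpM2l ?sqr_ge0.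
    by rewrite (_ : u ^+ 2 * (L * dl ^+ 2) = L * (u * dl) ^+ 2); [rewrite ler_wpM2l// ltW|ring].
  have hu1 : q dl <= L * a.
    apply: (@le_trans _ _ (u ^+ 2 * q dl)).
      by rewrite ler_peMl ?(ltW Q0)// exprn_ege1.
    apply: (le_trans hu); apply: ler_wpM2l; first exact: ltW.
    by rewrite expr2 ler_piMl// ltW.
  have hu2 : q dl * u ^+ 2 / a <= L * a.
    by rewrite ler_pdivrMr// -[leRHS]mulrA -expr2 [leLHS]mulrC.
  have hu3 : u ^+ 2 * q dl / 2 <= L / 2 * a.
    have : L * a ^+ 2 <= L * a by apply: ler_wpM2l; [exact: ltW|rewrite expr2 ler_piMl// ltW].
    lra.
  have hz : 1 - V * a <= 1 - (u ^+ 2 * q dl / 2 + a) - (q dl * u ^+ 2 / a + q dl).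
    by rewrite /V; lra.
  apply: (@le_trans _ _ (sq * (1 - V * a))); last by rewrite ler_wpM2l.
  have hs2 : (kap - e / 2) * dl <= sq by move: hs; lra.
  have Va : 2 * (kap * (V * a)) <= e by move: aV; lra.
  have Va0 : 0 < V * a by rewrite mulr_gt0.
  have k0 := kap0; move: (V * a) Va Va0 aV1 => y Va Va0 aV1.
  apply: (@le_trans _ _ ((kap - e / 2) * dl * (1 - y))); last by rewrite ler_wpM2r// subr_ge0.
  rewrite mulrC mulrAC; apply: ler_wpM2r; first exact: ltW.
  have := mulr_gt0 e0 Va0; lra.
have bJ := @X_jump_pdf t s s t u Dt Ds s0 st tT u0.
have c : (P (upcrossing_Z u s t) <= P (upcrossing u s t) + P [set w | (u < Z t w + J s w)%R /\ J s w != J t w])%E.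
  have m1 : measurable (upcrossing u s t) by exact: measurable_upcrossing.
  have m2 := measurable_jump s u s t.
  apply: le_trans (measureU2 _ m1 m2); apply: le_measure; rewrite ?inE//; first exact: measurableU.
  move=> w /andP[h3 h4]; have [Je|Jn] := eqVneq (J s w) (J t w); last by right.
  by left; apply/andP; split => //; rewrite /X -Je.
rewrite mulrBr EFinB leeBlDr//; apply: (le_trans bZ); apply: (le_trans c).
by rewrite leeD2l// (_ : dl * (lambda * _) = lambda * (t - s) * (phi u / u)); last by rewrite ts; ring.
Qed.

(** * From grids to the supremum *)

Lemma exceed_sup (u : R) (w : Omega) :
  u < sup [set X s w | s in `[0, T]] <-> exists2 s, 0 <= s <= T & u < X s w.
Proof.
have T0 := ltW hT.
(* The path must be shown bounded, since the supremum of an unbounded set is a default value. *)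
have [c _ Zmax] := EVT_max T0 (C1_within_continuous (ZC1 w)).
have [C JC] := PAR_bounded JPAR w T0.
have ub : has_ubound [set X s w | s in `[0, T]].
  exists (Z c w + C) => _ [s /= hs <-]; apply: lerD; first exact: Zmax.
  by apply: JC; move: hs; rewrite in_itv.
split.
  move=> h; have [|y [s /= hs <-] us] := @sup_gt _ [set X s w | s in `[0, T]] u _ h.
    by exists (X 0 w), 0 => //=; rewrite in_itv/= lexx.
  by exists s => //; move: hs; rewrite in_itv.
move=> [s hs us]; apply: (lt_le_trans us); apply: (ub_le_sup ub).
by exists s => //=; rewrite in_itv.
Qed.

Lemma X_right_open (u s : R) (w : Omega) : 0 <= s < T -> u < X s w ->
  exists2 e : R, 0 < e & forall t, s < t < s + e -> t <= T -> u < X t w.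
Proof.
move=> /andP[s0 sT] us.
have Ds : `[0, T]%classic s by rewrite /= in_itv/= s0 ltW.
have e0 : 0 < X s w - u by rewrite subr_gt0.
have h1 : \forall t \near s, `[0, T]%classic t -> `|Z s w - Z t w| < X s w - u.
  have /subspace_continuousP/(_ s Ds) := C1_within_continuous (ZC1 w).
  by move=> /cvgrPdist_lt /(_ _ e0).
have h2 : \forall t \near s, s < t -> J t w = J s w by exact: (PAR_right_cont JPAR).
have : \forall t \near s, s < t -> t <= T -> u < X t w.
  apply: filterS2 h1 h2 => t h1 h2 st tT.
  have {h1} := h1 _; rewrite /= in_itv/= tT (le_trans s0 (ltW st)) => /(_ isT).
  by rewrite /X (h2 st) ltr_norml => /andP[_]; rewrite /X; lra.
move=> /nbhs_ballP[e /= e00 he]; exists e => // t /andP[st ts] tT.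
by apply: he => //; rewrite /ball/= ltr_norml; apply/andP; split; lra.
Qed.

Lemma exceed_grid (u : R) :
  [set w | u < sup [set X s w | s in `[0, T]]] = \bigcup_m grid_exceed X T u (2 ^ m).
Proof.
apply/seteqP; split => w /=.
  move=> /exceed_sup[s hs us].
  have [m [i [im hi]]] := @dyadic_hit R T (X ^~ w) hT s u hs us
    (fun sT => X_right_open (introT andP (conj (proj1 (elimT andP hs)) sT)) us).
  by exists m => //; apply/grid_exceedE; exists i.
move=> [m _ /grid_exceedE[i im hi]]; apply/exceed_sup; exists (i%:R * (T / (2 ^ m)%:R)) => //.
have N0 : 0 < (2 ^ m)%:R :> R by rewrite ltr0n expn_gt0.
rewrite mulr_ge0 ?divr_ge0 ?(ltW hT) ?(ltW N0)//= mulrA ler_pdivrMr// mulrC.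
by rewrite ler_pM2l// ler_nat.
Qed.

Lemma grid_exceed_le (u : R) (n : nat) : (0 < n)%N ->
  grid_exceed X T u n `<=` [set w | u < sup [set X s w | s in `[0, T]]].
Proof.
move=> n0 w /grid_exceedE[i im hi]; apply/exceed_sup; exists (i%:R * (T / n%:R)) => //.
have N0 : 0 < n%:R :> R by rewrite ltr0n.
rewrite mulr_ge0 ?divr_ge0 ?(ltW hT) ?(ltW N0)//= mulrA ler_pdivrMr// mulrC.
by rewrite ler_pM2l// ler_nat.
Qed.

Lemma grid_exceed_nd (u : R) : {homo (fun m => grid_exceed X T u (2 ^ m)) : m m' / (m <= m')%N >-> m `<=` m'}.
Proof.
move=> m m' mm' w /grid_exceedE[i im hi]; apply/grid_exceedE.
have e : (2 ^ m' = 2 ^ m * 2 ^ (m' - m))%N by rewrite -expnD subnKC.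
exists (i * 2 ^ (m' - m))%N; first by rewrite e leq_mul2r im orbT.
have N0 : (2 ^ (m' - m))%:R != 0 :> R by rewrite pnatr_eq0 -lt0n expn_gt0.
have N1 : (2 ^ m)%:R != 0 :> R by rewrite pnatr_eq0 -lt0n expn_gt0.
rewrite e !natrM (_ : _ * _ * _ = i%:R * (T / (2 ^ m)%:R))//.
by field; rewrite N0 N1.
Qed.

(** * Upper and lower bounds for the exceedance probability *)

Let M w := sup [set X s w | s in `[0, T]].
Let Psi (u : R) : R := fine (normal_prob 0 1 `]u, +oo[).
Let Pr (A : set Omega) : R := fine (P A).

Let D0 : D 0. Proof. by rewrite /= in_itv/= lexx ltW. Qed.

Let X0_law u : P [set w | u < X 0 w] = (Psi u)%:E.
Proof.
have := @X_law 0 0 `]u, +oo[ D0 D0 (measurable_itv _).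
rewrite /Psi fineK ?fin_num_measure// => <-.
by congr (P _); apply/seteqP; split => w /=; rewrite in_itv/= andbT.
Qed.

Let Pr_le A x : measurable A -> (P A <= x%:E)%E -> Pr A <= x.
Proof. by move=> mA h; rewrite -lee_fin /Pr fineK// fin_num_measure. Qed.

Let Pr_ge A x : measurable A -> (x%:E <= P A)%E -> x <= Pr A.
Proof. by move=> mA h; rewrite -lee_fin /Pr fineK// fin_num_measure. Qed.

Let measurable_M u : measurable [set w | u < M w].
Proof.
rewrite /M exceed_grid; apply: bigcup_measurable => m _.
exact: measurable_grid_exceed.
Qed.

Lemma exceed_upper (u : R) : 0 < u ->
  Pr [set w | u < M w] <= Psi u + T * kap * phi u + T * lambda * (phi u / u).
Proof.
move=> u0; apply/ler_addgt0Pr => e e0.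
have Tphi : 0 < T * phi u by rewrite mulr_gt0.
(* An error e / (T phi(u)) in the slope, summed over cells of total length T, adds exactly e. *)
have e' : 0 < e / (T * phi u) by rewrite divr_gt0.
have [r r0 hr] := @upcrossing_le u _ u0 e'.
set c := (_ + _ + e).
have cE : c = Psi u + T * ((kap + e / (T * phi u)) * phi u + lambda * (phi u / u)).
  by rewrite /c; field; rewrite !gt_eqF.
apply: Pr_le => //; rewrite /M exceed_grid.
have cv := @nondecreasing_cvg_mu _ _ _ P (fun m => grid_exceed X T u (2 ^ m))
  (fun m => measurable_grid_exceed T u mX (2 ^ m))
  (bigcup_measurable (fun m _ => measurable_grid_exceed T u mX (2 ^ m))) _.
rewrite -(cvg_lim _ (cv _))//; last first.
  by move=> m m' mm'; apply/subsetPset; exact: grid_exceed_nd.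
apply: lime_le; first by apply/cvg_ex; eexists; apply: cv => m m' mm'; apply/subsetPset; exact: grid_exceed_nd.
exists (Num.truncn (T / r)).+1 => // m /= hm.
have N0 : 0 < (2 ^ m)%:R :> R by rewrite ltr0n expn_gt0.
pose dl := T / (2 ^ m)%:R.
have dl0 : 0 < dl by rewrite divr_gt0.
have dlr : dl < r.
  rewrite ltr_pdivrMr// mulrC -ltr_pdivrMr//.
  have /andP[_ h2] := truncn_itv (divr_ge0 (ltW hT) (ltW r0)).
  by apply: (lt_le_trans h2); rewrite ler_nat (leq_trans hm)// ltnW// ltn_expl.
have mF i : measurable (first_crossing X u dl i) by exact: measurable_first_crossing.
apply: (le_trans (@le_mu_bigsetU _ R Omega P (first_crossing X u dl) (2 ^ m).+1 (fun i _ => mF i))).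
rewrite big_ord_recl/= X0_law cE EFinD leeD2l//.
apply: (@le_trans _ _ (\sum_(i < 2 ^ m) (dl * ((kap + e / (T * phi u)) * phi u + lambda * (phi u / u)))%:E)%E).
  apply: lee_sum => i _.
  have -> : i.+1%:R * dl = i%:R * dl + dl by rewrite -natr1 mulrDl mul1r.
  apply: hr; [by rewrite dl0 dlr|by rewrite mulr_ge0// ltW|].
  rewrite -[X in _ + X]mul1r -mulrDl natr1 /dl mulrA ler_pdivrMr// mulrC ler_pM2l//.
  by rewrite ler_nat add0n.
rewrite sumEFin sumr_const card_ord lee_fin -mulr_natl [leLHS]mulrA.
by rewrite (_ : _ * dl = T)// /dl mulrC divfK// gt_eqF.
Qed.

Lemma exceed_lower (e : R) : 0 < e -> exists U : R, forall u, U <= u ->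
  Psi u + T * kap * phi u - e * phi u <= Pr [set w | u < M w].
Proof.
move=> e0.
(* Error budget in units of phi(u): e/4 from the slope, e/2 from the pairs, e/4 from the jumps. *)
have e1 : 0 < e / (4 * T) by rewrite divr_gt0// mulr_gt0.
have [a a0 ha] := @upcrossing_ge _ e1.
have [|U1 hU1] := ha a; first by rewrite a0 lexx.
have [C C0 hC] := @pair_dominated _ a0.
(* K and [e2] make C/K and K e2 at most a e / (16 T) each. With n a <= 2 T u, the pairs then sum to
   at most e/2 phi(u). *)
pose K := (Num.truncn (16 * T * C / (a * e))).+1.
have K0 : 0 < K%:R :> R by rewrite ltr0n.
have hK : 16 * T * C <= K%:R * (a * e).
  have ae : 0 < a * e by rewrite mulr_gt0.
  have c0 : 0 <= 16 * T * C / (a * e) by rewrite divr_ge0 ?(ltW ae)// mulr_ge0// mulr_ge0// ltW.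
  have /andP[_ h] := truncn_itv c0.
  by rewrite -ler_pdivrMr// ltW.
pose e2 := a * e / (16 * T * K%:R).
have e20 : 0 < e2 by rewrite divr_gt0 ?mulr_gt0.
have neg k : exists U : R, forall u dl s : R, U <= u -> a / 2 <= u * dl <= a ->
    0 <= s -> (1 < k)%N -> s + k%:R * dl <= T ->
    (P (cross_event u s (s + k.-1%:R * dl) (s + k%:R * dl)) <= (e2 * (phi u / u))%:E)%E.
  have [k1|k1] := ltnP 1 k; last first.
    by exists 0 => u dl s _ _ _.
  have [U hU] := @pair_negligible a e2 k a0 e20 k1.
  by exists U => u dl s Uu ud s0 _ tT; exact: hU.
(* The threshold in u depends on k; only finitely many k are treated this way, so a maximum serves
   all of them. *)
have [U2 hU2] : exists U : R, forall k, (k <= K)%N -> forall u dl s : R, U <= u -> a / 2 <= u * dl <= a ->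
    0 <= s -> (1 < k)%N -> s + k%:R * dl <= T ->
    (P (cross_event u s (s + k.-1%:R * dl) (s + k%:R * dl)) <= (e2 * (phi u / u))%:E)%E.
  elim: (K) => [|k [U IH]].
    by have [U hU] := neg 0%N; exists U => k; rewrite leqn0 => /eqP ->; exact: hU.
  have [U' hU'] := neg k.+1; exists (Num.max U U') => k'; rewrite leq_eqVlt => /predU1P[->|k'k] u dl s; rewrite ge_max => /andP[h1 h2].
    exact: hU'.
  exact: IH.
exists (Num.max (Num.max 1 (a / T)) (Num.max (Num.max U1 U2) (4 * T * lambda / e))) => u.
rewrite !ge_max => /andP[/andP[u1 uaT] /andP[/andP[uU1 uU2] ul]].
have u0 : 0 < u by rewrite (lt_le_trans ltr01).
have uT0 : 0 <= u * T / a by rewrite divr_ge0 ?mulr_ge0// ltW.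
(* Rounding up gives u T/n <= a, and u T >= a keeps u T/n >= a/2. *)
pose n := (Num.truncn (u * T / a)).+1.
have /andP[n1 n2] := truncn_itv uT0; rewrite -/n in n2.
have nE : n%:R = (Num.truncn (u * T / a))%:R + 1 :> R by rewrite natr1.
have N0 : 0 < n%:R :> R by rewrite ltr0n.
pose dl := T / n%:R.
have dl0 : 0 < dl by rewrite divr_gt0.
have ndl : n%:R * dl = T by rewrite /dl mulrC divfK// gt_eqF.
have ud : a / 2 <= u * dl <= a.
  rewrite /dl mulrA ler_pdivlMr// ler_pdivrMr//; apply/andP; split; last first.
    by rewrite [leRHS]mulrC -ler_pdivrMr// ltW.
  have h1 : a <= u * T by move: uaT; rewrite ler_pdivrMr.
  have h2 : (Num.truncn (u * T / a))%:R * a <= u * T by rewrite -ler_pdivlMr.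
  by rewrite nE; move: h2; set x := _%:R; nra.
have tle i : (i <= n)%N -> i%:R * dl <= T by move=> i_n; rewrite -ndl ler_pM2r// ler_nat.
pose A := first_crossing X u dl.
have mA i : measurable (A i) by exact: measurable_first_crossing.
have mG : measurable (grid_exceed X T u n) by exact: measurable_grid_exceed.
have step1 : Pr (grid_exceed X T u n) <= Pr [set w | u < M w].
  apply: Pr_le => //; rewrite /Pr fineK ?fin_num_measure//; apply: le_measure; rewrite ?inE//.
  exact: grid_exceed_le.
have bonf := bonferroni P n.+1 mA.
have pu : 0 < phi u / u by rewrite divr_gt0.
have singles : Psi u + T * ((kap - e / (4 * T)) * phi u - lambda * (phi u / u)) <= \sum_(i < n.+1) Pr (A i).
  rewrite big_ord_recl; apply: lerD; first by rewrite /Pr /A/= X0_law.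
  apply: (@le_trans _ _ (\sum_(i < n) dl * ((kap - e / (4 * T)) * phi u - lambda * (phi u / u)))).
    by rewrite sumr_const card_ord -[leRHS]mulr_natl [leRHS]mulrA ndl.
  apply: ler_sum => i _; apply: Pr_ge; first exact: mA.
  rewrite /A lift0/=.
  have -> : i.+1%:R * dl = i%:R * dl + dl by rewrite -natr1 mulrDl mul1r.
  apply: hU1 => //; first by rewrite mulr_ge0// ltW.
  by rewrite -[X in _ + X]mul1r -mulrDl natr1 tle.
(* Index k is distance k + 1. At distance 1 the events are disjoint: the value at the common grid
   point would be both above u and at most u. *)
pose b k := if k == 0%N then 0 else if (k < K)%N then e2 else C / k.+1%:R ^+ 2.
have pairs : \sum_(j < n.+1) \sum_(i < j) Pr (A i `&` A j) <= n.+1%:R * ((K%:R * e2 + C / K%:R) * (phi u / u)).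
  apply: (@sum_pairs_le R (fun i j => Pr (A i `&` A j)) (fun k => b k * (phi u / u))); last first.
    move=> j; rewrite -mulr_suml ler_pM2r//; apply: sum_inverse_squares_le => //; first exact: ltW.
      by move=> k kK; rewrite /b kK; case: eqP => // _; exact: ltW.
    by move=> k kK; rewrite /b ltnNge kK/=; case: eqP => // _; rewrite divr_ge0// sqr_ge0.
  move=> i j /andP[ij jn]; apply: Pr_le; first exact: measurableI.
  pose k := (j - i)%N.
  have jE : j = (i + k)%N by rewrite /k subnKC// ltnW.
  have k0 : (0 < k)%N by rewrite /k subn_gt0.
  have tj : j%:R * dl = i%:R * dl + k%:R * dl by rewrite -mulrDl -natrD -jE.
  have tj' : j.-1%:R * dl = i%:R * dl + k.-1%:R * dl.
    by rewrite -mulrDl -natrD jE -{1}(prednK k0) addnS.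
  have sub : A i `&` A j `<=` cross_event u (i%:R * dl) (i%:R * dl + k.-1%:R * dl) (i%:R * dl + k%:R * dl).
    rewrite -tj -tj'; case: (j) ij => [//|j'] _ w /= [h1 h2].
    split => //; move: h1; rewrite /A; case: (i) => [|i'] /=; first by rewrite mul0r.
    by case/andP.
  have mC : measurable (cross_event u (i%:R * dl) (i%:R * dl + k.-1%:R * dl) (i%:R * dl + k%:R * dl)).
    exact: measurable_cross_event.
  apply: (@le_trans _ _ (P (cross_event u (i%:R * dl) (i%:R * dl + k.-1%:R * dl) (i%:R * dl + k%:R * dl)))).
    by apply: le_measure; rewrite ?inE//; exact: measurableI.
  have -> : (j - i.+1 = k.-1)%N by rewrite subnS.
  have s0 : 0 <= i%:R * dl by rewrite mulr_ge0// ltW.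
  have tT : i%:R * dl + k%:R * dl <= T by rewrite -tj tle.
  rewrite /b; case: eqP => [k1|/eqP k1].
    rewrite k1 mul0r addr0 mul0r (_ : cross_event _ _ _ _ = set0) ?measure0//.
    by apply/seteqP; split => w //= [h1 /andP[h2 _]]; move: (lt_le_trans h1 h2); rewrite ltxx.
  have k2 : (1 < k)%N by move: k0 k1; case: (k) => [|[|k']].
  case: ifPn => kK; first by apply: hU2 => //; rewrite -(prednK k0).
  by rewrite prednK//; apply: hC.
have n2E : n.+1%:R * ((K%:R * e2 + C / K%:R) * (phi u / u)) <= e / 2 * phi u.
  have nn : n.+1%:R <= 2 * n%:R :> R.
    by rewrite -natr1; have : 1 <= n%:R :> R by [rewrite ler1n]; lra.
  have B0 : 0 <= K%:R * e2 + C / K%:R by apply: addr_ge0; [apply: mulr_ge0|apply: divr_ge0]; rewrite ?C0 ?ler0n ?(ltW e20).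
  have B1 : K%:R * e2 + C / K%:R <= a * e / (8 * T).
    have -> : K%:R * e2 = a * e / (16 * T) by rewrite /e2; field; rewrite !gt_eqF.
    have h : C / K%:R <= a * e / (16 * T).
      by rewrite ler_pdivrMr// mulrAC ler_pdivlMr ?mulr_gt0//; move: hK; lra.
    have -> : a * e / (8 * T) = a * e / (16 * T) + a * e / (16 * T) by field; rewrite gt_eqF.
    by rewrite lerD2l.
  have nu : n%:R * a <= 2 * T * u.
    have /andP[h _] := ud.
    have : n%:R * (a / 2) <= n%:R * (u * dl) by rewrite ler_pM2l.
    by rewrite (mulrCA n%:R u) ndl; lra.
  apply: (@le_trans _ _ (2 * n%:R * (a * e / (8 * T) * (phi u / u)))).
    by apply: ler_pM => //; [rewrite mulr_ge0// ltW|rewrite ler_wpM2r// ltW].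
  have -> : 2 * n%:R * (a * e / (8 * T) * (phi u / u)) = n%:R * a * (e / (4 * T) * (phi u / u)).
    by field; rewrite !gt_eqF.
  have -> : e / 2 * phi u = 2 * T * u * (e / (4 * T) * (phi u / u)) by field; rewrite !gt_eqF.
  by rewrite ler_wpM2r// mulr_ge0 ?(ltW pu)// ltW.
have jmp : T * lambda * (phi u / u) <= e / 4 * phi u.
  have h : 4 * T * lambda <= u * e by rewrite -ler_pdivrMr.
  have h' : phi u * (T * lambda) <= phi u * (u * e / 4) by rewrite ler_pM2l//; lra.
  rewrite mulrA ler_pdivrMr// (_ : T * lambda * phi u = phi u * (T * lambda)); last by ring.
  by rewrite (_ : e / 4 * phi u * u = phi u * (u * e / 4)); last by ring.
have sE : Psi u + T * ((kap - e / (4 * T)) * phi u - lambda * (phi u / u)) =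
   Psi u + T * kap * phi u - e / 4 * phi u - T * lambda * (phi u / u).
  by field; rewrite !gt_eqF.
rewrite sE in singles.
move: bonf; rewrite -/(grid_exceed X T u n) => bonf.
apply: le_trans step1; apply: le_trans bonf; lra.
Qed.
End Model.

Theorem theorem11 (R : realType) (d : measure_display)
    (Omega : measurableType d) (P : probability Omega R)
    (T rho lambda : R) (Z J : R -> {RV P >-> R})
    (hT : 0 < T) (hrho : `|rho| < 1) (hlambda : 0 < lambda)
    (Zgauss : gaussian_process `[0, T] Z)
    (Zcentered : centered_process `[0, T] Z)
    (Zstat : stationary_process `[0, T] Z)
    (ZC1 : forall w, C1_on `[0, T] (fun t => Z t w))
    (Gamma0 : cov_fun Z 0 = 2^-1)
    (JPAR : PAR_process rho lambda J)
    (ZJindep : indep_systems P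
       (sigma_gen `[0, T] (fun t => Z t : Omega -> R))
       (sigma_gen `[0, T] (fun t => J t : Omega -> R)))
    (Gamma_neq : forall tau, 0 < tau <= T ->
       cov_fun Z tau != 2^-1 /\ cov_fun Z tau != - 2^-1)
    (Geman : geman_condition T (cov_fun Z)) :
  let X := fun t w => Z t w + J t w in
  let M := fun w => sup [set X s w | s in `[0, T]] in
  (fine (P [set w | u < M w])
     - (1 - std_gauss_cdf u
        + T * Num.sqrt (- ((cov_fun Z)^`()^`())%classic 0 / (2 * pi))
            * std_gauss_pdf u))
  / std_gauss_pdf u @[u --> +oo] --> (0 : R).
Proof.
move=> X M.
have Gamma_neq1 tau (h : 0 < tau <= T) : cov_fun Z tau != 2^-1 by have [] := Gamma_neq tau h.
have [l2 [cq [[l20 cq0] ql G2 q_low]]] := covariance_facts hT Zgauss Zcentered Zstat ZC1 Gamma0 Gamma_neq1.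
pose q tau : R := 2^-1 - cov_fun Z tau.
(* Equality q(tau) = 1 means Gamma(tau) = -1/2. Strictness keeps the variance of the half-sum of Z
   positive in the Chernoff bound. *)
have q_lt1 tau : 0 <= tau <= T -> q tau < 1.
  move=> ht; rewrite lt_neqAle (q_le1 hT Zgauss Zcentered Zstat Gamma0 ht) andbT.
  have [->|t0] := eqVneq tau 0; first by rewrite /q Gamma0 subrr eq_sym oner_eq0.
  have [|_] := Gamma_neq tau; first by rewrite lt_neqAle eq_sym t0.
  apply: contra => /eqP qE; apply/eqP; move: qE; rewrite /q; lra.
have qlim e : 0 < e -> exists2 r : R, 0 < r &
    forall h, 0 < h < r -> `|q h - l2 / 2 * h ^+ 2| <= e * h ^+ 2.
  move=> e0; move/cvgrPdist_lt : ql => /(_ e e0) near_e.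
  have {near_e} : \forall h \near (0 : R), h != 0 -> `|l2 / 2 - q h / h ^+ 2| < e by exact: near_e.
  move=> /nbhs_ballP[r /= r0 hr]; exists r => // h /andP[h0 hlt].
  have := hr h; rewrite /ball/= sub0r normrN gtr0_norm// => /(_ hlt).
  rewrite gt_eqF// => /(_ isT) => lt_e.
  have -> : q h - l2 / 2 * h ^+ 2 = - (l2 / 2 - q h / h ^+ 2) * h ^+ 2 by field; rewrite gt_eqF.
  by rewrite normrM normrN (ger0_norm (sqr_ge0 h)) ler_wpM2r ?sqr_ge0// ltW.
have up := @exceed_upper _ _ _ _ _ _ _ _ _ hT hrho hlambda Zgauss Zcentered Zstat ZC1 Gamma0 JPAR ZJindep l2 cq l20 cq0 qlim q_low q_lt1.
have low := @exceed_lower _ _ _ _ _ _ _ _ _ hT hrho hlambda Zgauss Zcentered Zstat ZC1 Gamma0 JPAR ZJindep l2 cq l20 cq0 qlim q_low q_lt1.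
have phi0 u : 0 < normal_pdf 0 1 u :> R.
  by rewrite normal_pdf0E// mulr_gt0 ?expR_gt0// invr_gt0 mul1r sqrtr_gt0 mulr_gt0// pi_gt0.
have cdfE u : 1 - std_gauss_cdf u = fine (normal_prob 0 1 `]u, +oo[) :> R.
  rewrite /std_gauss_cdf.
  have e : normal_prob 0 1 `]u, +oo[ = (1 - normal_prob 0 1 `]-oo, u])%E :> \bar R.
    by rewrite -(@probability_setC _ (measurableTypeR R) R (normal_prob 0 1))// setCitvl.
  have f : normal_prob 0 1 `]-oo, u] \is a fin_num.
    exact: (@fin_num_measure _ _ _ (normal_prob 0 1 : probability (measurableTypeR R) R)).
  by rewrite e -[in RHS](fineK f).
rewrite G2 opprK; apply/cvgrPdist_le => e e0.
have [U hU] := low e e0.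
near=> u.
have u0 : 0 < u by near: u; exact: nbhs_pinfty_gt.
have uU : U <= u by near: u; apply: nbhs_pinfty_ge; exact: num_real.
have uT : T * lambda / e <= u by near: u; apply: nbhs_pinfty_ge; exact: num_real.
rewrite sub0r normrN normrM normfV (gtr0_norm (phi0 u)) ler_pdivrMr//.
have h1 := up u u0; have h2 := hU u uU.
have h3 : T * lambda * (normal_pdf 0 1 u / u) <= e * normal_pdf 0 1 u.
  rewrite mulrA ler_pdivrMr// [leRHS]mulrAC ler_pM2r//.
  by rewrite [leRHS]mulrC -ler_pdivrMr.
rewrite cdfE /std_gauss_pdf ler_norml; apply/andP; split; lra.
Unshelve. all: by end_near.
Qed.
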